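(* Let $h>0$ and $\theta\in\mathbb R$. Assume that $(s_r)_{r\ge1}$ is given by $s_r=e^{-rh}$ and $(\psi_r)_{r\ge1}$ by $\psi_r=r\theta h$. Then there exists $\rho>0$ such that the corresponding element of $\mathcal T((s_r)_{r\ge1})$, i.e. the one with angles $(\psi_r)_{r\ge1}$, is holomorphic and bounded in the disc $|z|<1+\rho$.
   Context: $\mathbb T=\mathbb R/2\pi\mathbb Z$. $L^2_+(\mathbb T)$ is the space of $v\in L^2(\mathbb T)$ with $\hat v(n)=0$ for all $n<0$, identified with holomorphic functions $v(z)=\sum_{n\ge0}\hat v(n)z^n$ on the unit disc; $\Pi$ is the orthogonal projector of $L^2(\mathbb T)$ onto $L^2_+(\mathbb T)$, and $H^{1/2}_+(\mathbb T)=H^{1/2}(\mathbb T)\cap L^2_+(\mathbb T)$. Being holomorphic in a larger disc means extending holomorphically to it. For $u\in H^{1/2}_+(\mathbb T)$, define antilinear operators on $L^2_+(\mathbb T)$ by $H_u(h)=\Pi(u\bar h)$ and $K_u=S^*H_u$, where $S$ is multiplication by $e^{ix}$. For a square summable strictly decreasing sequence $(s_r)_{r\ge1}$ of positive numbers, $\mathcal T((s_r)_{r\ge1})$ is the set of all $u\in H^{1/2}_+(\mathbb T)$ such that the positive eigenvalues of $H_u^2$ (with multiplicity) are $s_1^2>s_3^2>s_5^2>\cdots$ and those of $K_u^2$ are $s_2^2>s_4^2>s_6^2>\cdots$. It is known that $\mathcal T((s_r)_{r\ge1})$ is parametrised by sequences of angles $(\psi_r)_{r\ge1}\in\mathbb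 T^\infty$: the element with angles $(\psi_r)_{r\ge1}$ is $$u(z)=\lim_{N\to\infty}\langle\mathscr C_N(z)^{-1}(\mathbf 1_N),\mathbf 1_N\rangle,\ |z|<1,\qquad \mathscr C_N(z)=\left(\frac{s_{2j-1}e^{i\psi_{2j-1}}-z\,s_{2k}e^{i\psi_{2k}}}{s_{2j-1}^2-s_{2k}^2}\right)_{1\le j,k\le N},$$ where $\mathbf 1_N=(1,\dots,1)^T\in\mathbb C^N$. *)

(* Defs.v *)
From HB Require Import structures.
From mathcomp Require Import all_boot all_order all_algebra.
From mathcomp Require Import all_classical all_reals all_analysis.
From mathcomp Require Import complex.

Set Implicit Arguments.
Unset Strict Implicit.
Unset Printing Implicit Defensive.

Import Order.TTheory GRing.Theory Num.Theory.
Import numFieldNormedType.Exports.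

Local Open Scope classical_set_scope.
Local Open Scope ring_scope.
Local Open Scope complex_scope.

Definition expi (R : realType) (t : R) : R[i] := cos t +i* sin t.

(* A function on the circle R/2piZ is represented by a function R -> R[i], of
   which only the restriction to [0, 2pi[, up to a.e. equality, is relevant. *)

Definition circle (R : realType) : set R := `[0, 2 * pi[.

Definition ae_eqT (R : realType) (f g : R -> R[i]) : Prop :=
  {ae (@lebesgue_measure R), forall x : R, circle x -> f x = g x}.

Definition integralT (R : realType) (f : R -> R[i]) : R[i] :=
  (\int[@lebesgue_measure R]_(x in @circle R) complex.Re (f x))%R +i*
  (\int[@lebesgue_measure R]_(x in @circle R) complex.Im (f x))%R.

Definition fourier (R : realType) (f : R -> R[i]) (n : int) : R[i] :=
  ((2 * pi)^-1)%:C * integralT (fun x => f x * expi (- (n%:~R * x))).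

Definition innerT (R : realType) (f g : R -> R[i]) : R[i] :=
  ((2 * pi)^-1)%:C * integralT (fun x => f x * (g x)^*).

Definition L2 (R : realType) : set (R -> R[i]) :=
  [set f : R -> R[i] | [/\ measurable_fun (@circle R) (fun x => complex.Re (f x)),
               measurable_fun (@circle R) (fun x => complex.Im (f x)) &
               (\int[@lebesgue_measure R]_(x in @circle R)
                  ((Normc.normc (f x)) ^+ 2)%:E < +oo)%E]].

Definition L2plus (R : realType) : set (R -> R[i]) :=
  [set f : R -> R[i] | L2 f /\ forall n : int, n < 0 -> fourier f n = 0].

Definition Hhalf (R : realType) : set (R -> R[i]) :=
  [set f : R -> R[i] | L2 f /\
    (\esum_(n in [set: int])
       (Num.sqrt (1 + n%:~R ^+ 2) * Normc.normc (fourier f n) ^+ 2)%:E < +oo)%E].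

Definition Hhalfplus (R : realType) : set (R -> R[i]) :=
  @Hhalf R `&` @L2plus R.

(* On L^2 this is the orthogonal projector onto L2plus.  It is phrased through
   Fourier coefficients because u * conj h is only integrable in general when u
   is in H^{1/2} and h in L^2; the projection is nevertheless in L^2.  The
   result is defined up to a.e. equality, xget picking a representative. *)
Definition szego (R : realType) (f : R -> R[i]) : R -> R[i] :=
  xget (fun=> 0)
    [set g : R -> R[i] | L2plus g /\ forall n : nat, fourier g n%:Z = fourier f n%:Z].

Definition hankel (R : realType) (u h : R -> R[i]) : R -> R[i] :=
  szego (fun x => u x * (h x)^*).

Definition shift (R : realType) (f : R -> R[i]) : R -> R[i] :=
  fun x => expi x * f x.

Definition shift_adj (R : realType) (f : R -> R[i]) : R -> R[i] :=
  xget (fun=> 0)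
    [set g : R -> R[i] | L2plus g /\
       forall w : R -> R[i], L2plus w -> innerT g w = innerT f (shift w)].

Definition shifted_hankel (R : realType) (u h : R -> R[i]) : R -> R[i] :=
  shift_adj (hankel u h).

Definition eigenvector (R : realType) (A : (R -> R[i]) -> R -> R[i]) (lam : R)
    (f : R -> R[i]) : Prop :=
  [/\ L2plus f, ~ ae_eqT f (fun=> 0) & ae_eqT (A f) (fun x => lam%:C * f x)].

Definition eigenvalue_of (R : realType) (A : (R -> R[i]) -> R -> R[i])
    (lam : R) : Prop :=
  exists f, eigenvector A lam f.

Definition simple_eigenvalue_of (R : realType) (A : (R -> R[i]) -> R -> R[i])
    (lam : R) : Prop :=
  exists2 f, eigenvector A lam f &
    forall g, eigenvector A lam g -> exists c : R[i], ae_eqT g (fun x => c * f x).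

(* Meant for pairwise distinct l 0, l 1, ...: listing the positive eigenvalues of
   A with multiplicity as l then amounts to each of them being simple. *)
Definition positive_eigenvalues (R : realType)
    (A : (R -> R[i]) -> R -> R[i]) (l : nat -> R) : Prop :=
  (forall j, simple_eigenvalue_of A (l j)) /\
  (forall lam, 0 < lam -> eigenvalue_of A lam -> exists j, lam = l j).

(* The sequences s and psi are indexed by r >= 1; their value at 0 is unused. *)
Definition torusT (R : realType) (s : nat -> R) : set (R -> R[i]) :=
  [set u | [/\ Hhalfplus u,
     positive_eigenvalues (hankel u \o hankel u)
       (fun j => s (2 * j + 1)%N ^+ 2) &
     positive_eigenvalues (shifted_hankel u \o shifted_hankel u)
       (fun j => s (2 * j + 2)%N ^+ 2)]].

(* Rows and columns are numbered from 0, hence 2 * j + 1 and 2 * k + 2.  For s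
   positive and strictly decreasing this matrix is invertible when |z| < 1. *)
Definition matC (R : realType) (s psi : nat -> R) (N : nat) (z : R[i]) :
    'M[R[i]]_N :=
  \matrix_(j < N, k < N)
    (((s (2 * j + 1)%N)%:C * expi (psi (2 * j + 1)%N)
      - z * ((s (2 * k + 2)%N)%:C * expi (psi (2 * k + 2)%N)))
     / (s (2 * j + 1)%N ^+ 2 - s (2 * k + 2)%N ^+ 2)%:C).

Definition invC_one_one (R : realType) (s psi : nat -> R) (N : nat)
    (z : R[i]) : R[i] :=
  \sum_(j < N) (invmx (matC s psi N z) *m (const_mx 1 : 'cV[R[i]]_N)) j 0.

(* R[i]^o carries the topology of R[i] as a normed space over itself. *)
Definition disc_value (R : realType) (u : R -> R[i]) (z : R[i]) : R[i] :=
  lim ((fun N : nat =>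
          \sum_(0 <= n < N) fourier u n%:Z * z ^+ n : R[i]^o) @ \oo).

Definition has_angles (R : realType) (s psi : nat -> R) (u : R -> R[i]) : Prop :=
  forall z : R[i], `|z| < 1 ->
    (fun N : nat => invC_one_one s psi N z : R[i]^o) @ \oo
      --> (disc_value u z : R[i]^o).

Definition disc (R : realType) (r : R) : set R[i] := [set z | `|z| < r%:C].

Definition holomorphic_on (R : realType) (D : set R[i]) (f : R[i] -> R[i]) :
    Prop :=
  forall z, D z -> derivable (f : R[i]^o -> R[i]^o) z 1.

Definition bounded_on (R : realType) (D : set R[i]) (f : R[i] -> R[i]) : Prop :=
  exists M : R, forall z, D z -> `|f z| <= M%:C.

Definition holomorphic_bounded_in_disc (R : realType) (u : R -> R[i]) (r : R) :
    Prop :=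
  exists U : R[i] -> R[i],
    [/\ forall z, disc 1 z -> U z = disc_value u z,
        holomorphic_on (disc r) U & bounded_on (disc r) U].

(* Main.v *)
(* Put q = e^(-h), v = e^(i theta h).  Up to row factors, C_N(z) is the N x N
   Toeplitz matrix T0 - z T1 with entries t_(k-j) - z v^(2(k-j)+1) g_(k-j), where
   t_l = 1 / (1 - q^(2(2l+1))) and g_l = 1 / (2 sinh ((2l+1)h)), and the right-hand
   side becomes a fixed exponentially decaying vector.
   The symbol of T0 has an explicit Wiener-Hopf factorization given by the
   q-binomial series, and on the unit circle the quotient of the two symbols is
   1/c0 times the product of the Fourier series of g and of its rotation: up to
   normalisation it is k sn(x) sn(x + a), with 0 < k < 1 the elliptic modulus of
   nome e^(-h).  The identity sn^2 + cn^2 = 1, read on Fourier coefficients, bounds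
   the compression of this quotient to l^2(N) by k.  This produces row functionals
   Lambda_n of size O(k^n) with Lambda_0 T0 = (1, 1, ...) and
   Lambda_(n+1) T0 = Lambda_n T1, so that the sum of the components of the solution
   of the full system is the power series with coefficients Lambda_n(rhs), which
   converges for |z| < 1/k.  For |z| < 1 the orthogonality relations of Cauchy
   matrices bound the solution of the N x N system by O(q^k) uniformly in N; it
   solves the infinite system up to an error tending to 0. *)
Require Import Defs.
From mathcomp Require Import all_boot all_order all_algebra.
From mathcomp Require Import all_classical all_reals all_analysis.
From mathcomp Require Import complex.
From mathcomp Require Import zify ring lra.

Set Implicit Arguments.
Unset Strict Implicit.
Unset Printing Implicit Defensive.

Import Order.TTheory GRing.Theory Num.Theory.
Import numFieldNormedType.Exports.

Local Open Scope ring_scope.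
Local Open Scope complex_scope.

(** [kerT q l] tends to 1 as l goes to +oo. So the symbol of T0 has a pole at 1, the rows of T0 are
    not summable and T0 is unbounded on l^2(N). Hence T0 is never inverted: the functionals act from
    the left, and only on columns of T0 and T1, which decay. The starting row of the recursion, read
    through the Wiener-Hopf factor, is a constant sequence, which is not square summable either. The
    quotient symbol vanishes at 1, so that a single step turns this row into a geometrically
    decaying one; the norm bound takes over from there. The bound k < 1 is needed for every h. Here
    k is the sum of [half_sech] over the odd powers of q divided by its sum over the even powers.
    Both sums obey quadratic doubling identities relating q and q^2, so that small q suffices. All
    these identities rest on two devices: partial fractions in q^(2 l + 1), which express a product
    of kernels through shifted sequences whose sums vanish or cancel, and the fact that an
    autocorrelation summed over all lags is the square of a sum. *)

Local Ltac arith := first [by clear; lia | lia].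

(** * Unconditional sums *)

Section FiniteSums.
Variable K : numDomainType.

Lemma big_subset_cond (T : eqType) (F : T -> K) (I J : seq T) :
  uniq I -> uniq J -> {subset I <= J} ->
  \sum_(i <- J | i \in I) F i = \sum_(i <- I) F i.
Proof.
move=> uI uJ IJ; rewrite -big_filter; apply: perm_big; apply: uniq_perm => //.
  exact: filter_uniq.
by move=> x; rewrite mem_filter; case: (boolP (x \in I)) => // /IJ ->.
Qed.

Lemma ler_sum_subset (T : eqType) (F : T -> K) (I J : seq T) :
  (forall i, 0 <= F i) -> uniq I -> uniq J -> {subset I <= J} ->
  \sum_(i <- I) F i <= \sum_(i <- J) F i.
Proof.
move=> F0 uI uJ IJ; rewrite [leRHS](bigID (mem I)) /= big_subset_cond //.
by rewrite lerDl sumr_ge0.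
Qed.

Lemma big_zero_outside (T : eqType) (F : T -> K) (I J : seq T) :
  uniq I -> uniq J -> {subset I <= J} ->
  (forall i, i \in J -> i \notin I -> F i = 0) ->
  \sum_(i <- J) F i = \sum_(i <- I) F i.
Proof.
move=> uI uJ IJ F0; rewrite (bigID (mem I)) /= [X in _ + X]big_seq_cond.
rewrite [X in _ + X]big1 ?addr0; last by move=> i /andP[iJ iI]; exact: F0.
exact: big_subset_cond.
Qed.

End FiniteSums.

Section UnconditionalSums.
Variable K : numFieldType.

(** Convergence along the net of finite subsets, a finite subset being a list without repetition. No
    enumeration of the index type enters, so shifts, reflections, pairs and the embeddings of the
    naturals into the integers are all handled by one reindexing lemma. *)
Definition hsum (T : eqType) (f : T -> K) (s : K) : Prop :=
  forall e, 0 < e -> exists J : seq T, forall I : seq T,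
    uniq I -> {subset J <= I} -> `|s - \sum_(i <- I) f i| < e.

Definition asummable (T : eqType) (f : T -> K) : Prop :=
  exists B, forall I : seq T, uniq I -> \sum_(i <- I) `|f i| <= B.

Lemma norm_lt_eps_eq0 (x : K) : (forall e, 0 < e -> `|x| < e) -> x = 0.
Proof.
move=> h; apply/eqP; rewrite -normr_eq0 -[_ == 0]negbK; apply/negP => x0.
have : 0 < `|x| by rewrite lt_def x0 normr_ge0.
by move/h; rewrite ltxx.
Qed.

(** The order of K may be partial, as for the complex numbers, so a negation of [0 <= x] would give
    nothing. The argument shows instead that [|x| - x] is smaller than every positive number. *)
Lemma ge0_closed (x : K) :
  (forall e, 0 < e -> exists2 y, 0 <= y & `|x - y| < e) -> 0 <= x.
Proof.
move=> h; suff /subr0_eq <- : `|x| - x = 0 by [].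
apply: norm_lt_eps_eq0 => e e0.
have [y y0 xy] := h _ (divr_gt0 e0 (ltr0n _ 2)).
have -> : `|x| - x = (`|x| - `|y|) - (x - y) by rewrite (ger0_norm y0); ring.
rewrite (le_lt_trans (ler_normB _ _)) // [ltRHS](splitr e) ltrD //.
exact: le_lt_trans (ler_dist_dist _ _) xy.
Qed.

Lemma norm_le_closed (x B : K) :
  (forall e, 0 < e -> exists2 y, `|y| <= B & `|x - y| < e) -> `|x| <= B.
Proof.
move=> h; rewrite -subr_ge0; apply: ge0_closed => e /h[y yB xy].
exists (B - `|y|); first by rewrite subr_ge0.
rewrite opprB addrCA addrAC subrr add0r [X in X < _]distrC.
by rewrite distrC (le_lt_trans (ler_dist_dist _ _)) // distrC.
Qed.

Section OneIndex.
Variable T : eqType.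
Implicit Types f g : T -> K.

Lemma eq_hsum f g s : f =1 g -> hsum f s -> hsum g s.
Proof.
move=> fg h e /h[J HJ]; exists J => I uI JI.
by rewrite -(eq_bigr _ (fun i _ => fg i)); exact: HJ.
Qed.

Lemma hsum_unique f s s' : hsum f s -> hsum f s' -> s = s'.
Proof.
move=> h h'; apply/eqP; rewrite -subr_eq0; apply/eqP/norm_lt_eps_eq0 => e e0.
have e20 : 0 < e / 2 by rewrite divr_gt0 // ltr0n.
have [J HJ] := h _ e20; have [J' HJ'] := h' _ e20.
set I := undup (J ++ J').
have /HJ : {subset J <= I} by move=> x xJ; rewrite mem_undup mem_cat xJ.
move/(_ (undup_uniq _)) => H.
have /HJ' : {subset J' <= I} by move=> x xJ; rewrite mem_undup mem_cat xJ orbT.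
move/(_ (undup_uniq _)) => H'.
have -> : s - s' = (s - \sum_(i <- I) f i) - (s' - \sum_(i <- I) f i) by ring.
by rewrite (le_lt_trans (ler_normB _ _)) // [ltRHS](splitr e) ltrD.
Qed.

Lemma hsumD f g s s' : hsum f s -> hsum g s' ->
  hsum (fun i => f i + g i) (s + s').
Proof.
move=> h h' e e0; have e20 : 0 < e / 2 by rewrite divr_gt0 // ltr0n.
have [J HJ] := h _ e20; have [J' HJ'] := h' _ e20.
exists (J ++ J') => I uI JI; rewrite big_split /= opprD addrACA.
rewrite (le_lt_trans (ler_normD _ _)) // [ltRHS](splitr e) ltrD //.
  by apply: HJ => // x xJ; rewrite JI // mem_cat xJ.
by apply: HJ' => // x xJ; rewrite JI // mem_cat xJ orbT.
Qed.

Lemma hsumZ (a : K) f s : hsum f s -> hsum (fun i => a * f i) (a * s).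
Proof.
move=> h e e0; have a0 : 0 < `|a| + 1 by rewrite ltr_wpDl.
have [J HJ] := h _ (divr_gt0 e0 a0).
exists J => I uI JI; rewrite -mulr_sumr -mulrBr normrM.
have := HJ I uI JI; rewrite ltr_pdivlMr // => H; apply: le_lt_trans H.
by rewrite mulrC ler_wpM2l // lerDl.
Qed.

Lemma hsumN f s : hsum f s -> hsum (fun i => - f i) (- s).
Proof.
by move=> /(hsumZ (-1)); rewrite mulN1r; apply: eq_hsum => i; rewrite mulN1r.
Qed.

Lemma hsumB f g s s' : hsum f s -> hsum g s' ->
  hsum (fun i => f i - g i) (s - s').
Proof. by move=> h /hsumN; exact: hsumD. Qed.

Lemma hsum_fin f (I : seq T) : uniq I -> (forall i, i \notin I -> f i = 0) ->
  hsum f (\sum_(i <- I) f i).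
Proof.
move=> uI f0 e e0; exists I => J uJ IJ.
by rewrite (big_zero_outside uI uJ IJ) ?subrr ?normr0 // => i _; exact: f0.
Qed.

Lemma hsum_delta (x : T) (c : K) : hsum (fun i => if i == x then c else 0) c.
Proof.
have := @hsum_fin (fun i => if i == x then c else 0) [:: x] isT.
by rewrite big_seq1 eqxx; apply=> i; rewrite inE => /negbTE ->.
Qed.

Lemma hsum0 : hsum (fun _ : T => 0) 0.
Proof. by move=> e e0; exists [::] => I _ _; rewrite big1 // subr0 normr0. Qed.

Lemma hsum_sum (U : Type) (r : seq U) (F : U -> T -> K) (S : U -> K) :
  (forall u, hsum (F u) (S u)) ->
  hsum (fun i => \sum_(u <- r) F u i) (\sum_(u <- r) S u).
Proof.
move=> h; elim: r => [|u r IH].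
  by rewrite big_nil; apply: eq_hsum hsum0 => i; rewrite big_nil.
by rewrite big_cons; apply: eq_hsum (hsumD (h u) IH) => i; rewrite big_cons.
Qed.

Lemma hsum_ge0 f s : hsum f s -> (forall i, 0 <= f i) -> 0 <= s.
Proof.
move=> h f0; apply: ge0_closed => e /h[J HJ].
exists (\sum_(i <- undup J) f i); first by rewrite sumr_ge0.
by apply: HJ; [exact: undup_uniq|move=> x; rewrite mem_undup].
Qed.

Lemma hsum_le_partial f s (I : seq T) : hsum f s -> (forall i, 0 <= f i) ->
  uniq I -> \sum_(i <- I) f i <= s.
Proof.
move=> h f0 uI; rewrite -subr_ge0.
have hI : hsum (fun i => if i \in I then f i else 0) (\sum_(i <- I) f i).
  rewrite big_seq (eq_bigr (fun i => if i \in I then f i else 0)) -?big_seq.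
    by apply: hsum_fin => // i /negbTE ->.
  by move=> i ->.
apply: (hsum_ge0 (hsumB h hI)) => i.
by case: ifP; rewrite ?subrr ?subr0.
Qed.

Lemma hsum_norm_le f s B : hsum f s ->
  (forall I, uniq I -> `|\sum_(i <- I) f i| <= B) -> `|s| <= B.
Proof.
move=> h fB; apply: norm_le_closed => e /h[J HJ].
exists (\sum_(i <- undup J) f i); first by rewrite fB ?undup_uniq.
by apply: HJ; [exact: undup_uniq|move=> x; rewrite mem_undup].
Qed.

Lemma hsum_le_hsum f g s s' : hsum f s -> hsum g s' ->
  (forall i, `|f i| <= g i) -> `|s| <= s'.
Proof.
move=> h h' fg; apply: (hsum_norm_le h) => I uI.
apply: le_trans (ler_norm_sum _ _ _) _.
apply: le_trans (ler_sum _ (fun i _ => fg i)) _.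
by apply: hsum_le_partial h' _ uI => i; exact: le_trans (fg i).
Qed.

Lemma asummable_le f g : asummable g -> (forall i, `|f i| <= `|g i|) ->
  asummable f.
Proof.
move=> [B HB] fg; exists B => I /HB; apply: le_trans.
by apply: ler_sum => i _.
Qed.

Lemma asummableZ (a : K) f : asummable f -> asummable (fun i => a * f i).
Proof.
move=> [B HB]; exists (`|a| * B) => I /HB H.
under eq_bigr do rewrite normrM.
by rewrite -mulr_sumr ler_wpM2l.
Qed.

Lemma asummableD f g : asummable f -> asummable g ->
  asummable (fun i => f i + g i).
Proof.
move=> [B HB] [B' HB']; exists (B + B') => I uI.
apply: le_trans (_ : \sum_(i <- I) (`|f i| + `|g i|) <= _).
  by apply: ler_sum => i _; exact: ler_normD.
by rewrite big_split /= lerD ?HB ?HB'.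
Qed.

Lemma asummable_norm f : asummable f -> asummable (fun i => `|f i|).
Proof. by move=> /asummable_le; apply=> i; rewrite normr_id. Qed.

Lemma asummable_bounded f : asummable f -> exists2 B, 0 <= B &
  forall i, `|f i| <= B.
Proof.
move=> [B HB]; exists B; first by have := HB [::] isT; rewrite big_nil.
by move=> i; have := HB [:: i] isT; rewrite big_seq1.
Qed.

Lemma asummableMbounded f g B : asummable f -> (forall i, `|g i| <= B) ->
  asummable (fun i => f i * g i).
Proof.
move=> sf gB.
have [] := @asummableZ B _ (asummable_norm sf) => D HD.
exists D => I /HD; apply: le_trans; apply: ler_sum => i _.
rewrite !normrM normr_id mulrC; apply: ler_wpM2r => //.
by apply: le_trans (gB i) _; rewrite ger0_norm // (le_trans _ (gB i)).
Qed.

End OneIndex.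

Section TwoIndices.
Variables T U : eqType.

(** A classical partial inverse of an injection: it pulls a finite subset of [U] back to a finite
    subset of [T]. *)
Let partial_inv (phi : T -> U) (j : U) : option T :=
  if pselect (exists i, phi i = j) is left h then Some (projT1 (cid h))
  else None.

Let partial_invK phi : ocancel (partial_inv phi) phi.
Proof.
by move=> j; rewrite /partial_inv; case: pselect => //= h; case: cid.
Qed.

Let partial_invI phi : injective phi -> pcancel phi (partial_inv phi).
Proof.
move=> inj i; rewrite /partial_inv; case: pselect => [h|[]]; last by exists i.
by case: cid => /= x /inj ->.
Qed.

Let big_partial_inv (phi : T -> U) (f : U -> K) (I : seq U) :
  (forall j, (forall i, phi i <> j) -> f j = 0) ->
  \sum_(j <- I) f j = \sum_(i <- pmap (partial_inv phi) I) f (phi i).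
Proof.
move=> f0; rewrite big_pmap; apply: eq_bigr => j _.
rewrite /partial_inv; case: pselect => [h|nh] /=; first by case: cid => i /= ->.
by apply: f0 => i ij; apply: nh; exists i.
Qed.

Lemma hsum_comp (phi : T -> U) (f : U -> K) s : injective phi ->
  (forall j, (forall i, phi i <> j) -> f j = 0) ->
  hsum (fun i => f (phi i)) s <-> hsum f s.
Proof.
move=> inj f0; split=> h e /h[J HJ].
  exists (map phi J) => I uI JI; rewrite (big_partial_inv _ f0); apply: HJ.
    exact: (pmap_uniq (@partial_invK phi)).
  move=> i iJ; rewrite (can2_mem_pmap (@partial_invK phi) (partial_invI inj)).
  by apply: JI; exact: map_f.
exists (pmap (partial_inv phi) J) => I uI JI.
(* The points of [J] outside the image of [phi] may be added freely, since [f] vanishes there. *)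
have uL : uniq (undup (map phi I ++ J)) by exact: undup_uniq.
have -> : \sum_(i <- I) f (phi i) = \sum_(j <- undup (map phi I ++ J)) f j.
  rewrite -(big_map phi xpredT); apply/esym/big_zero_outside => //.
  - by rewrite map_inj_uniq.
  - by move=> j jI; rewrite mem_undup mem_cat jI.
  - move=> j; rewrite mem_undup mem_cat => /orP[-> //|jJ jI].
    apply: f0 => i ij; move/negP: jI; apply; rewrite -ij map_f // JI //.
    by rewrite (can2_mem_pmap (@partial_invK phi) (partial_invI inj)) ij.
by apply: HJ => // j jJ; rewrite mem_undup mem_cat jJ orbT.
Qed.

Lemma asummable_comp (phi : T -> U) (f : U -> K) : injective phi -> asummable f ->
  asummable (fun i => f (phi i)).
Proof.
move=> inj [B HB]; exists B => I uI.
by rewrite -(big_map phi xpredT (fun j => `|f j|)) HB // map_inj_uniq.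
Qed.

Lemma asummableM (f : T -> K) (g : U -> K) : asummable f -> asummable g ->
  asummable (fun ij : T * U => f ij.1 * g ij.2).
Proof.
move=> [B HB] [B' HB']; exists (B * B') => I uI.
set I1 := undup (map fst I); set I2 := undup (map snd I).
have uu : uniq (allpairs pair I1 I2).
  by rewrite allpairs_uniq ?undup_uniq // => -[? ?] [].
apply: le_trans (@ler_sum_subset _ _ (fun ij => `|f ij.1 * g ij.2|) _
   (allpairs pair I1 I2) _ uI uu _) _ => //.
  move=> -[i j] ij; apply/allpairsP; exists (i, j) => /=; split=> //.
    by rewrite mem_undup; apply/mapP; exists (i, j).
  by rewrite mem_undup; apply/mapP; exists (i, j).
rewrite big_allpairs /=.
under eq_bigr => i _.
  under eq_bigr => j _ do rewrite normrM.
  rewrite -mulr_sumr.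
  over.
rewrite -mulr_suml ler_pM ?sumr_ge0 ?HB ?HB' ?undup_uniq //.
Qed.

Lemma hsum_fubini (f : T * U -> K) (g : T -> K) s : hsum f s ->
  (forall i, hsum (fun j => f (i, j)) (g i)) -> hsum g s.
Proof.
move=> h hg e e0; have e20 : 0 < e / 2 by rewrite divr_gt0 // ltr0n.
have [J HJ] := h _ e20; exists (map fst J) => I uI JI.
have [L LJ HL] : exists2 L : seq U, {subset map snd J <= L} & uniq L /\
    (forall i, i \in I ->
      `|g i - \sum_(j <- L) f (i, j)| <= e / 2 / (size I).+1%:R).
  (* The tolerance is shared among the rows of [I], so that one list [L] of columns serves all of
     them with total error at most e/2; the successor avoids a division by zero. *)
  have e3 : 0 < e / 2 / (size I).+1%:R by rewrite divr_gt0 // ltr0Sn.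
  have [c Hc] := choice (fun i => hg i _ e3).
  exists (undup (map snd J ++ flatten (map c I))).
    by move=> j jJ; rewrite mem_undup mem_cat jJ.
  split=> [|i iI]; first exact: undup_uniq.
  apply/ltW/Hc; first exact: undup_uniq.
  move=> j jc; rewrite mem_undup mem_cat; apply/orP; right.
  by apply/flattenP; exists (c i) => //; exact: map_f.
have [uL HLe] := HL.
have uu : uniq (allpairs pair I L).
  by rewrite allpairs_uniq // => -[? ?] [].
have JIL : {subset J <= allpairs pair I L}.
  move=> -[i j] ij; apply/allpairsP; exists (i, j) => /=; split=> //.
    by apply: JI; apply/mapP; exists (i, j).
  by apply: LJ; apply/mapP; exists (i, j).
have := HJ _ uu JIL; rewrite big_allpairs /= => H.
have -> : s - \sum_(i <- I) g i = (s - \sum_(i <- I) \sum_(j <- L) f (i, j))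
    - \sum_(i <- I) (g i - \sum_(j <- L) f (i, j)) by rewrite sumrB; ring.
rewrite (le_lt_trans (ler_normB _ _)) // [ltRHS](splitr e) ltr_leD //.
apply: le_trans (ler_norm_sum _ _ _) _.
rewrite big_seq; apply: le_trans (ler_sum _ HLe) _.
rewrite -big_seq big_const_seq count_predT iter_addr_0 -[leLHS]mulr_natr -[leLHS]mulrA.
apply: ler_piMr; first exact: ltW.
by rewrite mulrC ler_pdivrMr ?ltr0Sn // mul1r ler_nat.
Qed.

End TwoIndices.

(** This is the form in which associativity of convolutions is used below: the total of the double
    family is never named, only the two ways of summing it. *)
Lemma hsum_fubini_swap (T U : eqType) (f : T * U -> K) (g : T -> K)
    (g' : U -> K) s t : hsum f s ->
  (forall i, hsum (fun j => f (i, j)) (g i)) ->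
  (forall j, hsum (fun i => f (i, j)) (g' j)) ->
  hsum g t -> hsum g' t.
Proof.
move=> hf hg hg' ht.
have <- : s = t by apply: hsum_unique (hsum_fubini hf hg) ht.
have hf' : hsum (fun ji : U * T => f (ji.2, ji.1)) s.
  apply/(@hsum_comp _ _ (fun ji : U * T => (ji.2, ji.1)) f s) => //.
    by move=> [? ?] [? ?] /= [-> ->].
  by move=> [i j] /(_ (j, i)).
exact: hsum_fubini hf' hg'.
Qed.

End UnconditionalSums.

Definition tsum (K : numFieldType) (T : eqType) (f : T -> K) : K :=
  xget 0 [set s | hsum f s]%classic.

Lemma tsumP (K : numFieldType) (T : eqType) (f : T -> K) :
  (exists s, hsum f s) -> hsum f (tsum f).
Proof. by move=> [s hs]; exact: (@xgetPex _ 0 [set s | hsum f s]%classic (ex_intro _ s hs)). Qed.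

Lemma hsum_tsumE (K : numFieldType) (T : eqType) (f : T -> K) s :
  hsum f s -> tsum f = s.
Proof. by move=> hs; apply: (hsum_unique _ hs); apply: tsumP; exists s. Qed.

(** * Absolutely summable families over the real and complex numbers have a sum *)

Section Existence.
Variables (R : realType) (T : eqType).

Lemma asummable_ge0_hsum (f : T -> R) : (forall i, 0 <= f i) ->
  asummable f -> exists s, hsum f s.
Proof.
move=> f0 [B HB].
set E := [set x : R | exists2 I : seq T, uniq I & x = \sum_(i <- I) f i]%classic.
have supE : has_sup E.
  split; first by exists 0, [::] => //; rewrite big_nil.
  exists B => x [I uI ->]; rewrite -(eq_bigr _ (fun i _ => ger0_norm (f0 i))).
  exact: HB.
exists (sup E) => e e0.
have [x [J uJ xJ] Hx] := sup_adherent e0 supE.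
exists J => I uI JI.
have H1 : \sum_(i <- I) f i <= sup E.
  by apply: (ub_le_sup supE.2); exists I.
have H2 := ler_sum_subset f0 uJ uI JI.
rewrite ger0_norm ?subr_ge0 // ltrBlDr -ltrBlDl.
by rewrite (lt_le_trans Hx) // xJ.
Qed.

(** The family is the difference of the nonnegative families [|f|] and [|f| - f], each summed by a
    supremum. *)
Lemma asummable_hsumR (f : T -> R) : asummable f -> hsum f (tsum f).
Proof.
move=> sf; apply: tsumP.
have [s hs] := asummable_ge0_hsum (fun i => normr_ge0 (f i)) (asummable_norm sf).
have [i||s' hs'] := @asummable_ge0_hsum (fun i => `|f i| - f i).
- by rewrite subr_ge0 ler_norm.
- rewrite (_ : (fun i => _) = (fun i => `|f i| + -1 * f i)).
    by apply: asummableD; [exact: asummable_norm|exact: asummableZ].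
  by apply/funext => i; rewrite mulN1r.
- by exists (s - s'); apply: eq_hsum (hsumB hs hs') => i; ring.
Qed.

Local Notation C := R[i].

Lemma hsum_RtoC (f : T -> R) s : hsum f s -> hsum (fun i => (f i)%:C : C) s%:C.
Proof.
move=> h e e0.
have eE : e = (complex.Re e)%:C by rewrite RRe_real // gtr0_real.
have [|J HJ] := h (complex.Re e); first by rewrite -ltcR -eE.
exists J => I uI JI; rewrite -rmorph_sum -rmorphB /= eE normc_def /= expr0n.
by rewrite addr0 sqrtr_sqr ltcR; exact: HJ.
Qed.

Lemma normcR (x : R) : `|x%:C| = (`|x|)%:C :> C.
Proof. by rewrite normc_def /= expr0n addr0 sqrtr_sqr. Qed.

Lemma asummable_dominated (f : T -> C) (F : T -> R) :
  asummable F -> (forall i, `|f i| <= (F i)%:C) -> asummable f.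
Proof.
move=> [B HB] fF; exists B%:C => I uI.
apply: le_trans (ler_sum _ (fun i _ => fF i)) _.
rewrite -rmorph_sum /= lecR; apply: le_trans (HB I uI).
by apply: ler_sum => i _; exact: ler_norm.
Qed.

Lemma asummable_RtoC (f : T -> R) : asummable f ->
  asummable (fun i => (f i)%:C : C).
Proof.
by move=> /asummable_norm /asummable_dominated; apply=> i; rewrite normcR.
Qed.

Lemma normc_ge_Im (x : C) : `|complex.Im x|%:C <= `|x|.
Proof.
rewrite normc_def lecR -[leLHS]ger0_norm // -sqrtr_sqr ler_wsqrtr //.
by rewrite real_normK ?num_real // lerDr sqr_ge0.
Qed.

Lemma asummable_hsum (f : T -> C) : asummable f -> hsum f (tsum f).
Proof.
move=> [B HB]; apply: tsumP.
have bnd (g : T -> R) : (forall i, `|g i|%:C <= `|f i|) -> asummable g.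
  move=> gf; exists (complex.Re B) => I uI.
  have : (\sum_(i <- I) `|g i|)%:C <= B.
    by rewrite rmorph_sum /=; apply: le_trans (HB I uI); exact: ler_sum.
  by rewrite lecE => /andP[].
have hr := asummable_hsumR (bnd _ (fun i => normc_ge_Re (f i))).
have hi := asummable_hsumR (bnd _ (fun i => normc_ge_Im (f i))).
exists ((tsum (fun i => complex.Re (f i)))%:C
  + 'i%C * (tsum (fun i => complex.Im (f i)))%:C).
apply: eq_hsum (hsumD (hsum_RtoC hr) (hsumZ 'i%C (hsum_RtoC hi))) => i.
by rewrite -complexE.
Qed.

End Existence.

Lemma geometric_partial_le (R : numFieldType) (r : R) n : 0 <= r -> r < 1 ->
  \sum_(i < n) r ^+ i <= (1 - r)^-1.
Proof.
move=> r0 r1; have r1' : 0 < 1 - r by rewrite subr_gt0.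
rewrite -(ler_pM2l r1') divff ?gt_eqF // -opprB mulNr -subrX1 opprB.
by rewrite lerBlDr lerDl exprn_ge0.
Qed.

Lemma asummable_nat (R : numFieldType) (f : nat -> R) B :
  (forall n, \sum_(i < n) `|f i| <= B) -> asummable f.
Proof.
move=> H; exists B => I uI; apply: le_trans (H (\max_(i <- I) i).+1).
rewrite -(big_mkord xpredT (fun i => `|f i|)) ler_sum_subset ?iota_uniq //.
move=> i iI; rewrite mem_index_iota /= ltnS; exact: leq_bigmax_seq.
Qed.

Lemma asummable_geometric (R : numFieldType) (r : R) : 0 <= r -> r < 1 ->
  asummable (fun n : nat => r ^+ n).
Proof.
move=> r0 r1; apply: (@asummable_nat _ _ (1 - r)^-1) => n.
under eq_bigr do rewrite ger0_norm ?exprn_ge0 //.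
exact: geometric_partial_le.
Qed.

Lemma asummable_int (R : numFieldType) (f : int -> R) :
  asummable (fun n : nat => f n%:Z) -> asummable (fun n : nat => f (Negz n)) ->
  asummable f.
Proof.
move=> [B HB] [B' HB']; exists (B + B') => I uI.
rewrite (bigID (fun l => 0 <= l)) /= lerD //.
  rewrite -big_filter.
  have -> : \sum_(l <- [seq l <- I | 0 <= l]) `|f l|
      = \sum_(n <- map absz [seq l <- I | 0 <= l]) `|f n%:Z|.
    rewrite big_map big_seq [RHS]big_seq; apply: eq_bigr => l.
    by rewrite mem_filter => /andP[l0 _]; rewrite gez0_abs.
  apply: HB; rewrite map_inj_in_uniq ?filter_uniq // => x y.
  by rewrite !mem_filter; arith.
rewrite -big_filter.
have -> : \sum_(l <- [seq l <- I | ~~ (0 <= l)]) `|f l|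
    = \sum_(n <- map (fun l => `|l|%N.-1) [seq l <- I | ~~ (0 <= l)])
        `|f (Negz n)|.
  rewrite big_map big_seq [RHS]big_seq; apply: eq_bigr => l.
  rewrite mem_filter => /andP[l0 _]; congr (`|f _|); arith.
apply: HB'; rewrite map_inj_in_uniq ?filter_uniq // => x y.
by rewrite !mem_filter; arith.
Qed.

Lemma asummable_geometric_int (R : numFieldType) (r : R) : 0 <= r -> r < 1 ->
  asummable (fun l : int => r ^+ `|l|%N).
Proof.
move=> r0 r1; have h := asummable_geometric r0 r1.
apply: asummable_int => //; apply: asummable_le h _ => n /=.
by rewrite !ger0_norm ?exprn_ge0 // exprS ler_piMl ?exprn_ge0 // ltW.
Qed.

(** * The kernels *)

Lemma hsum_shift (K : numFieldType) (f : int -> K) s n :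
  hsum f s -> hsum (fun l => f (l + n)) s.
Proof.
move=> h; apply/(@hsum_comp K _ _ (fun l => l + n)) => //; first exact: addIr.
by move=> j /(_ (j - n)); rewrite subrK.
Qed.

Lemma hsum_reflect (K : numFieldType) (f : int -> K) s n :
  hsum f s -> hsum (fun l => f (n - l)) s.
Proof.
move=> h; apply/(@hsum_comp K _ _ (fun l => n - l)) => //.
  by move=> x y; arith.
by move=> j /(_ (n - j)); rewrite opprB addrC subrK.
Qed.

Lemma asummable_shift (K : numFieldType) (f : int -> K) n :
  asummable f -> asummable (fun l => f (l + n)).
Proof. by apply: asummable_comp; exact: addIr. Qed.

Lemma asummable_reflect (K : numFieldType) (f : int -> K) n :
  asummable f -> asummable (fun l => f (n - l)).
Proof. by apply: (@asummable_comp _ _ _ (fun l => n - l)) => x y; arith. Qed.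

Section Autocorrelation.
Variable R : realType.

Lemma hsumM (T U : eqType) (u : T -> R) (v : U -> R) x y :
  asummable u -> asummable v -> hsum u x -> hsum v y ->
  hsum (fun ij : T * U => u ij.1 * v ij.2) (x * y).
Proof.
move=> su sv hu hv; have h := asummable_hsumR (asummableM su sv).
have hr i : hsum (fun j => u i * v j) (u i * y) by exact: hsumZ.
have := hsum_fubini h hr.
have /hsum_unique H : hsum (fun i => u i * y) (x * y).
  by rewrite mulrC; apply: eq_hsum (hsumZ y hu) => i; exact: mulrC.
by move=> /H ->.
Qed.

(** The double family a_i a_j is regrouped along the lag m = j - i. An autocorrelation concentrated
    at m = 0 therefore gives the square of the sum of [a] in closed form. *)
Lemma hsum_autocorrelation (a c : int -> R) x :
  asummable a -> hsum a x ->
  (forall m, hsum (fun n => a n * a (n + m)) (c m)) ->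
  hsum c (x ^+ 2).
Proof.
move=> sa ha hc.
have h0 := hsumM sa sa ha ha.
have h1 : hsum (fun mn : int * int => a mn.2 * a (mn.2 + mn.1)) (x * x).
  apply/(@hsum_comp R _ _ (fun mn : int * int => (mn.2, mn.2 + mn.1))
    (fun ij => a ij.1 * a ij.2)) => //.
    by move=> [? ?] [? ?] /= [-> /addrI ->].
  by move=> [i j] /(_ (j - i, i)); rewrite /= addrC subrK.
exact: hsum_fubini h1 hc.
Qed.

End Autocorrelation.

Section Powers.
Variables (R : realType) (q : R).
Hypotheses (q0 : 0 < q) (q1 : q < 1).

Let q_neq0 : q != 0. Proof. by rewrite gt_eqF. Qed.

Lemma exprz_eq1 (n : int) : n != 0 -> q ^ n != 1.
Proof.
move=> n0; rewrite -(expr0z q); apply/eqP => /(ieexprIz q0) H.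
by move/eqP: n0; apply; apply: H; rewrite lt_eqF.
Qed.

Definition oddpow (l : int) : R := q ^ (2 * l + 1).

Definition evenpow (l : int) : R := q ^ (2 * l).

Lemma oddpow_gt0 l : 0 < oddpow l. Proof. exact: exprz_gt0. Qed.

Lemma evenpow_gt0 l : 0 < evenpow l. Proof. exact: exprz_gt0. Qed.

Lemma oddpowD l m : oddpow (l + m) = oddpow l * evenpow m.
Proof.
rewrite /oddpow /evenpow -expfzDr //; congr (_ ^ _); arith.
Qed.

Lemma evenpowD l m : evenpow (l + m) = evenpow l * evenpow m.
Proof.
rewrite /evenpow -expfzDr //; congr (_ ^ _); arith.
Qed.

Lemma oddpowE l : oddpow l = evenpow l * q.
Proof. by rewrite /oddpow /evenpow expfzDr // expr1z. Qed.

Lemma oddpow_reflect l : oddpow (-1 - l) = (oddpow l)^-1.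
Proof.
rewrite /oddpow invr_expz; congr (_ ^ _); arith.
Qed.

Lemma evenpow_neq1 n : n != 0 -> evenpow n != 1.
Proof. by move=> n0; apply: exprz_eq1; arith. Qed.

Lemma oddpow_neq1 n : oddpow n != 1.
Proof. by apply: exprz_eq1; arith. Qed.

Lemma oddpow_sqr_neq1 n : 1 - oddpow n ^+ 2 != 0.
Proof.
rewrite subr_eq0 eq_sym sqrf_eq1 negb_or oddpow_neq1 /=.
by rewrite gt_eqF // (lt_trans _ (oddpow_gt0 n)) // oppr_lt0.
Qed.

Lemma oddpow_nat (n : nat) : oddpow n = q ^+ (2 * n).+1.
Proof. by rewrite /oddpow exprnP; congr (_ ^ _); arith. Qed.

Lemma oddpow_Negz (n : nat) : oddpow (Negz n) = (q ^+ (2 * n).+1)^-1.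
Proof. by rewrite /oddpow exprnN; congr (_ ^ _); arith. Qed.

Lemma evenpow_nat (n : nat) : evenpow n = q ^+ (2 * n).
Proof. by rewrite /evenpow exprnP; congr (_ ^ _); arith. Qed.

Lemma evenpow_Negz (n : nat) : evenpow (Negz n) = (q ^+ (2 * n).+2)^-1.
Proof. by rewrite /evenpow exprnN; congr (_ ^ _); arith. Qed.

Let asummable_pow k : asummable (fun n : nat => q ^+ (2 * n + k)).
Proof.
apply: asummable_le (asummable_geometric (ltW q0) q1) _ => n.
rewrite !ger0_norm ?exprn_ge0 ?(ltW q0) //.
by apply: ler_wiXn2l; [exact: ltW|exact: ltW|arith].
Qed.

(** The values of [oddpow] at l >= 0 are numbers of ]0, q], those at l < 0 are inverses of such
    numbers. The two hypotheses thus control the two ends of the integers. *)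
Lemma asummable_oddpow (F : R -> R) C :
  (forall x, 0 < x -> x <= q -> `|F x| <= C * x) ->
  (forall x, 0 < x -> x <= q -> `|F x^-1| <= C * x) ->
  asummable (fun l => F (oddpow l)).
Proof.
move=> h h'.
have xq n : q ^+ (2 * n).+1 <= q.
  by rewrite -[leRHS]expr1; apply: ler_wiXn2l => //; exact: ltW.
apply: asummable_int; apply: asummable_le (asummableZ C (asummable_pow 1)) _.
  move=> n /=; rewrite oddpow_nat addn1 (le_trans (h _ _ _)) ?exprn_gt0 //.
  exact: ler_norm.
move=> n /=; rewrite oddpow_Negz addn1 (le_trans (h' _ _ _)) ?exprn_gt0 //.
exact: ler_norm.
Qed.

Lemma asummable_evenpow (F : R -> R) C :
  (forall x, 0 < x -> x <= 1 -> `|F x| <= C * x) ->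
  (forall x, 0 < x -> x <= 1 -> `|F x^-1| <= C * x) ->
  asummable (fun l => F (evenpow l)).
Proof.
move=> h h'.
have xq n : q ^+ n <= 1 by rewrite exprn_ile1 // ltW.
apply: asummable_int.
  apply: asummable_le (asummableZ C (asummable_pow 0)) _ => n /=.
  rewrite evenpow_nat addn0 (le_trans (h _ _ _)) ?exprn_gt0 //.
  exact: ler_norm.
apply: asummable_le (asummableZ C (asummable_pow 2)) _ => n /=.
rewrite evenpow_Negz addn2 (le_trans (h' _ _ _)) ?exprn_gt0 //.
exact: ler_norm.
Qed.

End Powers.

Section Kernels.
Variables (R : realType).

(* At [x = exp (- y)] these are [1 / (2 sinh y)] and [1 / (2 cosh y)]. *)
Definition half_csch (x : R) : R := x / (1 - x ^+ 2).
Definition half_sech (x : R) : R := x / (1 + x ^+ 2).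

Definition kerS (q : R) (l : int) : R := half_csch (oddpow q l).
Definition kerT (q : R) (l : int) : R := (1 - oddpow q l ^+ 2)^-1.

(** The constants c0 and M: c0 normalises the convolution inverse of [kerT] ([kerT_kerS]), M bounds
    the squared l^2 norm of the convolution by [kerS] ([kerS_norm_bound]). *)
Definition kerS_toeplitz_const (q : R) : R :=
  tsum (fun l => kerT q l * kerS q l).
Definition kerS_norm_const (q : R) : R :=
  tsum (fun l => kerS q l ^+ 2 + half_sech (oddpow q l) ^+ 2).

(** In terms of theta constants taken at [q ^+ 2], these two sums are theta_2^2 / 2 and theta_3^2 /
    2. The quadratic relations proved below are classical theta identities. *)
Definition sech_odd_sum (q : R) : R := tsum (fun l => half_sech (oddpow q l)).
Definition sech_even_sum (q : R) : R := tsum (fun l => half_sech (evenpow q l)).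

Lemma half_cschV x : x != 0 -> 1 - x ^+ 2 != 0 -> half_csch x^-1 = - half_csch x.
Proof.
rewrite /half_csch => x0 x1; have x2 : x ^+ 2 - 1 != 0 by rewrite -oppr_eq0 opprB.
by field; rewrite x0 x1.
Qed.

Lemma sum1sqr_neq0 (x : R) : 1 + x ^+ 2 != 0.
Proof. by rewrite gt_eqF // ltr_pwDl // sqr_ge0. Qed.

Lemma half_sechV x : half_sech x^-1 = half_sech x.
Proof.
have [->|x0] := eqVneq x 0; first by rewrite invr0.
rewrite /half_sech; field.
by rewrite x0 sum1sqr_neq0.
Qed.

Lemma half_sech_bound x : 0 < x -> 0 <= half_sech x <= x.
Proof.
move=> x0; have x2 : 0 < 1 + x ^+ 2 by rewrite ltr_pwDl // sqr_ge0.
rewrite /half_sech divr_ge0 ?(ltW x0) ?(ltW x2) //=.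
by rewrite ler_pdivrMr // ler_pMr // lerDl sqr_ge0.
Qed.

Lemma asummable_half_sech_even (q : R) : 0 < q -> q < 1 ->
  asummable (fun l => half_sech (evenpow q l)).
Proof.
move=> q0 q1; apply: (asummable_evenpow q0 q1 (C := 1)) => x x0 _;
  rewrite ?half_sechV mul1r; have /andP[? ?] := half_sech_bound x0;
  by rewrite ger0_norm.
Qed.

Section FixedBase.
Variable q : R.
Hypotheses (q0 : 0 < q) (q1 : q < 1).

Let q21 : 0 < 1 - q ^+ 2.
Proof. by rewrite subr_gt0 expr_lt1 // ltW. Qed.

Let pow_neq0 l : oddpow q l != 0.
Proof. by rewrite gt_eqF // oddpow_gt0. Qed.

Let sub_pow x : 0 < x -> x <= q -> 1 - q ^+ 2 <= 1 - x ^+ 2.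
Proof. by move=> x0 xq; rewrite lerD2l lerN2 lerXn2r // nnegrE ltW. Qed.

Lemma half_csch_bound x : 0 < x -> x <= q ->
  `|half_csch x| <= (1 - q ^+ 2)^-1 * x.
Proof.
move=> x0 xq; have h := sub_pow x0 xq; have h' := lt_le_trans q21 h.
rewrite /half_csch ger0_norm ?divr_ge0 ?(ltW x0) ?(ltW h') //.
by rewrite mulrC ler_wpM2r ?(ltW x0) // lef_pV2.
Qed.

Lemma half_cschV_bound x : 0 < x -> x <= q ->
  `|half_csch x^-1| <= (1 - q ^+ 2)^-1 * x.
Proof.
move=> x0 xq; have h' := lt_le_trans q21 (sub_pow x0 xq).
by rewrite half_cschV ?gt_eqF // normrN half_csch_bound.
Qed.

Lemma asummable_kerS : asummable (kerS q).
Proof.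
by apply: (asummable_oddpow q0 q1); [exact: half_csch_bound|
  exact: half_cschV_bound].
Qed.

Lemma asummable_half_sech_odd : asummable (fun l => half_sech (oddpow q l)).
Proof.
apply: (asummable_oddpow q0 q1 (C := 1)) => x x0 _;
  rewrite ?half_sechV mul1r; have /andP[? ?] := half_sech_bound x0;
  by rewrite ger0_norm.
Qed.

Lemma kerS_reflect l : kerS q (-1 - l) = - kerS q l.
Proof.
by rewrite /kerS oddpow_reflect // half_cschV // oddpow_sqr_neq1.
Qed.

Lemma hsum_kerS : hsum (kerS q) 0.
Proof.
have h := asummable_hsumR asummable_kerS.
have := hsum_unique (eq_hsum kerS_reflect (hsum_reflect (-1) h)) (hsumN h).
move=> E; have E0 : tsum (kerS q) = 0 by lra.
by move: h; rewrite E0.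
Qed.

Lemma kerSE l : kerS q l = oddpow q l * kerT q l.
Proof. by []. Qed.

(** Boundedness is all that is available, as [kerT q l] tends to 1 when l tends to +oo. In every
    series containing [kerT], summability comes from the other factor. *)
Lemma kerT_bounded : exists2 B, 0 <= B & forall l, `|kerT q l| <= B.
Proof.
have hB x : 0 < x -> x <= q -> `|(1 - x ^+ 2)^-1| <= (1 - q ^+ 2)^-1 /\
    `|(1 - x^-1 ^+ 2)^-1| <= (1 - q ^+ 2)^-1.
  move=> x0 xq; have h := sub_pow x0 xq; have h' := lt_le_trans q21 h.
  have H : (1 - x ^+ 2)^-1 <= (1 - q ^+ 2)^-1 by rewrite lef_pV2.
  split; first by rewrite ger0_norm // invr_ge0 ltW.
  have -> : (1 - x^-1 ^+ 2)^-1 = - (x ^+ 2 * (1 - x ^+ 2)^-1).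
    have x2 : x ^+ 2 - 1 != 0 by rewrite -oppr_eq0 opprB gt_eqF.
    by field; rewrite (gt_eqF x0) x2 gt_eqF.
  rewrite normrN ger0_norm; last first.
    by rewrite mulr_ge0 ?invr_ge0 ?sqr_ge0 ?ltW.
  apply: le_trans H; rewrite ler_piMl ?invr_ge0 ?(ltW h') //.
  by rewrite -subr_ge0 ltW.
have xq n : 0 < q ^+ (2 * n).+1 <= q.
  rewrite exprn_gt0 //= -[leRHS]expr1.
  by apply: ler_wiXn2l => //; exact: ltW.
exists (1 - q ^+ 2)^-1; first by rewrite invr_ge0 ltW.
rewrite /kerT; case=> n; have /andP[n0 nq] := xq n.
  by rewrite oddpow_nat; have [] := hB _ n0 nq.
by rewrite oddpow_Negz; have [] := hB _ n0 nq.
Qed.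

Lemma asummable_kerTS n : asummable (fun l => kerT q l * kerS q (l + n)).
Proof.
have [B _ HB] := kerT_bounded.
under [X in asummable X]eq_fun do rewrite mulrC.
exact: asummableMbounded (asummable_shift n asummable_kerS) HB.
Qed.

(** For n != 0, partial fractions write the product as a combination of [kerS q l] and
    [kerS q (l + n)], and both of these sum to 0. Up to the factor c0, the reflection of [kerS] is
    thus a convolution inverse of [kerT]. *)
Lemma kerT_kerS n : hsum (fun l => kerT q l * kerS q (l + n))
  (if n == 0 then kerS_toeplitz_const q else 0).
Proof.
case: eqVneq => [->|n0].
  rewrite /kerS_toeplitz_const; apply: eq_hsum (asummable_hsumR _) => [l|].
    by rewrite addr0.
  by have := asummable_kerTS 0; under [X in asummable X]eq_fun do rewrite addr0.
set b := evenpow q n.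
have b1 : 1 - b != 0 by rewrite subr_eq0 eq_sym evenpow_neq1.
have b2 : 1 - b ^+ 2 != 0.
  rewrite subr_eq0 eq_sym sqrf_eq1 negb_or evenpow_neq1 //=.
  by rewrite gt_eqF // (lt_trans _ (evenpow_gt0 q0 n)) // oppr_lt0.
have := hsumB (hsumZ (b / (1 - b ^+ 2)) hsum_kerS)
  (hsumZ (b ^+ 2 / (1 - b ^+ 2)) (hsum_shift n hsum_kerS)).
rewrite !mulr0 subr0; apply: eq_hsum => l.
have := oddpow_sqr_neq1 q0 q1 (l + n).
rewrite /kerT /kerS /half_csch oddpowD // -/b => d2.
have := oddpow_sqr_neq1 q0 q1 l; move: d2.
set a := oddpow q l => d2 d1; field.
by rewrite d1 d2 b2.
Qed.

Lemma asummable_kerS_autocorrelation m :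
  asummable (fun n => kerS q n * kerS q (n + m)).
Proof.
have [B _ HB] := asummable_bounded asummable_kerS.
by apply: (asummableMbounded asummable_kerS) => l; exact: HB.
Qed.

Lemma asummable_sech_autocorrelation m :
  asummable (fun n => half_sech (oddpow q n) * half_sech (oddpow q (n + m))).
Proof.
have [B _ HB] := asummable_bounded asummable_half_sech_odd.
by apply: (asummableMbounded asummable_half_sech_odd) => l; exact: HB.
Qed.

End FixedBase.

Lemma asummable_kerS_sqr q : 0 < q -> q < 1 ->
  asummable (fun n => kerS q n ^+ 2 + half_sech (oddpow q n) ^+ 2).
Proof.
move=> q0 q1.
have := asummableD (asummable_kerS_autocorrelation q0 q1 0)
  (asummable_sech_autocorrelation q0 q1 0).
by under [X in asummable X]eq_fun do rewrite addr0 -!expr2.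
Qed.

(* With [k n = 1 / (2 sinh (2 (2 n + 1) h))], a shift of [k] is subtracted
   from [k]: the identity [coth - tanh = 2 / sinh (2 .)] makes the partial
   fractions of the two autocorrelations cancel. *)
Lemma kerS_sech_autocorrelation q m : 0 < q -> q < 1 ->
  hsum (fun n => kerS q n * kerS q (n + m)
                 + half_sech (oddpow q n) * half_sech (oddpow q (n + m)))
    (if m == 0 then kerS_norm_const q else 0).
Proof.
move=> q0 q1; case: eqVneq => [->|m0].
  apply: eq_hsum (asummable_hsumR (asummable_kerS_sqr q0 q1)) => n.
  by rewrite addr0 -!expr2.
set b := evenpow q m.
have b1 : 1 - b != 0 by rewrite subr_eq0 eq_sym evenpow_neq1.
have b2 : 1 - b ^+ 2 != 0.
  rewrite subr_eq0 eq_sym sqrf_eq1 negb_or evenpow_neq1 //=.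
  by rewrite gt_eqF // (lt_trans _ (evenpow_gt0 q0 m)) // oppr_lt0.
have q20 : 0 < q ^+ 2 by rewrite exprn_gt0.
have q21 : q ^+ 2 < 1 by rewrite expr_lt1 // ltW.
have h := asummable_hsumR (asummable_kerS q20 q21).
have := hsumZ (2 * b / (1 - b ^+ 2)) (hsumB h (hsum_shift m h)).
rewrite subrr mulr0; apply: eq_hsum => n.
have E l : oddpow (q ^+ 2) l = oddpow q l ^+ 2.
  by rewrite !expr2 /oddpow expfzMl.
rewrite /kerS /half_csch /half_sech !E oddpowD // -/b.
have := oddpow_sqr_neq1 q20 q21 (n + m).
have := oddpow_sqr_neq1 q0 q1 (n + m).
have := sum1sqr_neq0 (oddpow q (n + m)).
rewrite !E oddpowD // -/b.
have := oddpow_sqr_neq1 q20 q21 n.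
have := oddpow_sqr_neq1 q0 q1 n.
have := sum1sqr_neq0 (oddpow q n).
rewrite !E; set a := oddpow q n => *.
by field; do ?[apply/andP; split].
Qed.

(** Obtained by summing [kerS_sech_autocorrelation] over all m: the [kerS] part contributes the
    square of its sum, which is 0, and the [half_sech] part the square of [sech_odd_sum]. *)
Lemma kerS_norm_constE q : 0 < q -> q < 1 ->
  kerS_norm_const q = sech_odd_sum q ^+ 2.
Proof.
move=> q0 q1.
have hg m := asummable_hsumR (asummable_kerS_autocorrelation q0 q1 m).
have he m := asummable_hsumR (asummable_sech_autocorrelation q0 q1 m).
have h1 := hsum_autocorrelation (asummable_kerS q0 q1) (hsum_kerS q0 q1) hg.
have sse := asummable_half_sech_odd q0 q1.
have h2 := hsum_autocorrelation sse (asummable_hsumR sse) he.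
have := hsumD h1 h2; rewrite expr0n /= add0r => h3.
have h4 : hsum (fun m : int => if m == 0 then kerS_norm_const q else 0)
    (sech_odd_sum q ^+ 2).
  apply: eq_hsum h3 => m.
  exact: hsum_unique (hsumD (hg m) (he m)) (kerS_sech_autocorrelation m q0 q1).
by apply: hsum_unique h4; exact: hsum_delta.
Qed.

End Kernels.

(** * Doubling identities for the sums of [half_sech] *)

Lemma hsum_int_parity (K : numFieldType) (f : int -> K) s1 s2 :
  hsum (fun l => f (2 * l)) s1 -> hsum (fun l => f (2 * l + 1)) s2 ->
  hsum f (s1 + s2).
Proof.
move=> h1 h2.
have k1 : hsum (fun n : int => if (2 %| n)%Z then f n else 0) s1.
  apply/(@hsum_comp K _ _ (fun l : int => 2 * l)).
  - by move=> x y; arith.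
  - move=> j H; case: ifP => // /dvdzP[l jl]; case: (H l); arith.
  - by apply: eq_hsum h1 => l; case: ifP => //; arith.
have k2 : hsum (fun n : int => if (2 %| n)%Z then 0 else f n) s2.
  apply/(@hsum_comp K _ _ (fun l : int => 2 * l + 1)).
  - by move=> x y; arith.
  - move=> j H; case: ifP => // /negP j2; case: (H ((j - 1) %/ 2)%Z); arith.
  - by apply: eq_hsum h2 => l; case: ifP => //; arith.
by apply: eq_hsum (hsumD k1 k2) => n; case: ifP; rewrite ?addr0 ?add0r.
Qed.

Section SechSums.
Variables (R : realType) (q : R).
Hypotheses (q0 : 0 < q) (q1 : q < 1).

Let q20 : 0 < q ^+ 2. Proof. by rewrite exprn_gt0. Qed.
Let q21 : q ^+ 2 < 1. Proof. by rewrite expr_lt1 // ltW. Qed.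

Let E n := half_sech (evenpow q n).
Let O n := half_sech (oddpow q n).

Let sE : asummable E. Proof. exact: asummable_half_sech_even. Qed.
Let sO : asummable O. Proof. exact: asummable_half_sech_odd. Qed.

Let D2 := tsum (fun n => E n * E n - O n * O n).

Let sEE m : asummable (fun n => E n * E (n + m)).
Proof.
have [B _ HB] := asummable_bounded sE.
by apply: (asummableMbounded sE) => l; exact: HB.
Qed.

Let sOO m : asummable (fun n => O n * O (n + m)).
Proof. exact: asummable_sech_autocorrelation. Qed.

(* [tanh ((2 n + 1) h) - tanh (2 n h)], up to a constant factor. *)
Let tanh_step n := (1 + evenpow q n ^+ 2)^-1 - (1 + oddpow q n ^+ 2)^-1.

Let asummable_tanh_step : asummable tanh_step.
Proof.
apply: asummable_le (asummableZ (q^-1) sE) _ => n /=.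
rewrite /tanh_step /E /half_sech oddpowE //.
set a := evenpow q n; have a0 : 0 < a by exact: evenpow_gt0.
have d1 : 0 < 1 + a ^+ 2 by rewrite ltr_pwDl // sqr_ge0.
have d2 : 0 < 1 + (a * q) ^+ 2 by rewrite ltr_pwDl // sqr_ge0.
have -> : (1 + a ^+ 2)^-1 - (1 + (a * q) ^+ 2)^-1 =
    - ((1 - q ^+ 2) * a ^+ 2 / ((1 + a ^+ 2) * (1 + (a * q) ^+ 2))).
  by field; rewrite !gt_eqF.
have p2 : 0 <= 1 - q ^+ 2 by rewrite subr_ge0 ltW.
have n1 : 0 <= q^-1 * (a / (1 + a ^+ 2)).
  by rewrite mulr_ge0 ?invr_ge0 ?divr_ge0 ?(ltW q0) ?(ltW a0) ?(ltW d1).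
have n2 : 0 <= (1 - q ^+ 2) * a ^+ 2 / ((1 + a ^+ 2) * (1 + (a * q) ^+ 2)).
  by apply: divr_ge0; apply: mulr_ge0; rewrite ?sqr_ge0 // ltW.
rewrite normrN !ger0_norm //.
rewrite ler_pdivrMr ?mulr_gt0 //.
have -> : q^-1 * (a / (1 + a ^+ 2)) * ((1 + a ^+ 2) * (1 + (a * q) ^+ 2)) =
    q^-1 * (a * (1 + (a * q) ^+ 2)) by field; rewrite !gt_eqF.
rewrite ler_pdivlMl //.
have aq0 : 0 < a * q by rewrite mulr_gt0.
have H : a * q <= 1 + (a * q) ^+ 2.
  move: (a * q) aq0 => x x0; have : 0 <= (x - 1) ^+ 2 by exact: sqr_ge0.
  by rewrite sqrrB1 => ?; lra.
apply: le_trans (_ : a * (a * q) <= _); last by rewrite ler_pM2l.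
have -> : a * (a * q) = q * (1 * a ^+ 2) by ring.
by rewrite ler_pM2l // ler_wpM2r ?sqr_ge0 // lerBlDr lerDl ltW.
Qed.

(** For m != 0 the general term is a multiple of [tanh_step n - tanh_step (n + m)], which sums to 0.
    The autocorrelations of [E] and [O] therefore differ at lag 0 only. *)
Lemma sech_autocorrelation_diff m :
  hsum (fun n => E n * E (n + m) - O n * O (n + m)) (if m == 0 then D2 else 0).
Proof.
case: eqVneq => [->|m0].
  apply: eq_hsum (asummable_hsumR _) => [n|]; first by rewrite addr0.
  rewrite (_ : (fun n => _) = (fun n => E n * E (n + 0) + -1 * (O n * O (n + 0)))).
    by apply: asummableD; [exact: sEE|apply: asummableZ; exact: sOO].
  by apply/funext => n; rewrite addr0 mulN1r.
set b := evenpow q m.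
have b1 : 1 - b != 0 by rewrite subr_eq0 eq_sym evenpow_neq1.
have b2 : b ^+ 2 - 1 != 0.
  rewrite subr_eq0 sqrf_eq1 negb_or evenpow_neq1 //=.
  by rewrite gt_eqF // (lt_trans _ (evenpow_gt0 q0 m)) // oppr_lt0.
have h := asummable_hsumR asummable_tanh_step.
have := hsumZ (b / (b ^+ 2 - 1)) (hsumB h (hsum_shift m h)).
rewrite subrr mulr0; apply: eq_hsum => n.
rewrite /tanh_step /E /O /half_sech !oddpowE // !evenpowD // -/b.
set a := evenpow q n.
have := sum1sqr_neq0 a.
have := sum1sqr_neq0 (a * b).
have := sum1sqr_neq0 (a * q).
have := sum1sqr_neq0 (a * b * q).
by move=> *; field; do ?[apply/andP; split].
Qed.

(** [chi] is a character of the integers with values 1 and -1. Twisting both sequences by it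
    multiplies their autocorrelations at lag m by [chi m]; since these differ at m = 0 only, the
    value of x^2 - y^2 is the same for all such [chi]. *)
Let autocorrelation_diff (chi : int -> R) x y :
  (forall n, `|chi n| = 1) -> (forall n m, chi n * chi (n + m) = chi m) ->
  hsum (fun n => chi n * E n) x -> hsum (fun n => chi n * O n) y ->
  x ^+ 2 - y ^+ 2 = D2.
Proof.
move=> chi1 chiM hx hy.
have chi0 : chi 0 = 1.
  have := chiM 0 0; rewrite addr0 => c0.
  have : chi 0 != 0 by rewrite -normr_gt0 chi1.
  by move=> /mulfI; apply; rewrite mulr1.
have sx : asummable (fun n => chi n * E n).
  by apply: asummable_le sE _ => n; rewrite normrM chi1 mul1r.
have sy : asummable (fun n => chi n * O n).
  by apply: asummable_le sO _ => n; rewrite normrM chi1 mul1r.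
have hE m := hsumZ (chi m) (asummable_hsumR (sEE m)).
have hO m := hsumZ (chi m) (asummable_hsumR (sOO m)).
have hxE m : hsum (fun n => chi n * E n * (chi (n + m) * E (n + m)))
    (chi m * tsum (fun n => E n * E (n + m))).
  by apply: eq_hsum (hE m) => n; rewrite -(chiM n m); ring.
have hyO m : hsum (fun n => chi n * O n * (chi (n + m) * O (n + m)))
    (chi m * tsum (fun n => O n * O (n + m))).
  by apply: eq_hsum (hO m) => n; rewrite -(chiM n m); ring.
have h := hsumB (hsum_autocorrelation sx hx hxE)
  (hsum_autocorrelation sy hy hyO).
apply: hsum_unique h _; apply: eq_hsum (hsum_delta 0 D2) => m.
have := hsum_unique (hsumB (hE m) (hO m)) _.
have H := hsumZ (chi m) (sech_autocorrelation_diff m).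
rewrite (@hsum_unique _ _ _ _ _ (eq_hsum _ (hsumB (hE m) (hO m))) H).
  by move=> _; case: eqP => [->|]; rewrite ?mulr0 ?chi0 ?mul1r.
by move=> n /=; ring.
Qed.

Lemma sech_sums_sqr_diff :
  sech_even_sum q ^+ 2 - sech_odd_sum q ^+ 2 = D2.
Proof.
apply: (@autocorrelation_diff (fun _ => 1)).
- by move=> _; rewrite normr1.
- by move=> _ _; rewrite mulr1.
- by apply: eq_hsum (asummable_hsumR sE) => n; rewrite mul1r.
- by apply: eq_hsum (asummable_hsumR sO) => n; rewrite mul1r.
Qed.

Let evenpow_double l : evenpow q (2 * l) = evenpow (q ^+ 2) l.
Proof.
by rewrite /evenpow exprnP exprz_exp; congr (_ ^ _); arith.
Qed.

Let evenpow_double1 l : evenpow q (2 * l + 1) = oddpow (q ^+ 2) l.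
Proof.
by rewrite /evenpow /oddpow exprnP exprz_exp; congr (_ ^ _); arith.
Qed.

Lemma sech_even_sum_split :
  sech_even_sum q = sech_even_sum (q ^+ 2) + sech_odd_sum (q ^+ 2).
Proof.
apply: hsum_tsumE; apply: hsum_int_parity.
  under [X in hsum X]eq_fun do rewrite evenpow_double.
  exact/asummable_hsumR/asummable_half_sech_even.
under [X in hsum X]eq_fun do rewrite evenpow_double1.
exact/asummable_hsumR/asummable_half_sech_odd.
Qed.

(** The twist by (-1)^n. Splitting by parity, the alternating sum of [E] is the difference of the
    two sums at [q ^+ 2]. The alternating sum of [O] is 0: the reflection n -> -1 - n preserves [O]
    and reverses the sign. *)
Lemma sech_alternating_sqr :
  (sech_even_sum (q ^+ 2) - sech_odd_sum (q ^+ 2)) ^+ 2 = D2.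
Proof.
have N1 : (-1 : R) != 0 by rewrite oppr_eq0 oner_eq0.
rewrite -[LHS]subr0 -[X in _ - X](expr0n R 2).
apply: (@autocorrelation_diff (fun n : int => (-1) ^ n)).
- by move=> n; rewrite expN1r normrX normrN1 expr1n.
- move=> n m; rewrite expfzDr // mulrA -expfzDr //.
  rewrite -[X in _ = X]mul1r; congr (_ * _).
  have -> : n + n = 2 * n by arith.
  by rewrite -exprz_exp (_ : (-1) ^ 2 = 1) ?exp1rz // -exprnP sqrrN expr1n.
- apply: hsum_int_parity.
    have h := asummable_hsumR (asummable_half_sech_even q20 q21).
    apply: eq_hsum h => l; rewrite /E evenpow_double -exprz_exp.
    by rewrite (_ : (-1) ^ 2 = 1) ?exp1rz ?mul1r // -exprnP sqrrN expr1n.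
  have h := hsumN (asummable_hsumR (asummable_half_sech_odd q20 q21)).
  apply: eq_hsum h => l; rewrite /E evenpow_double1 expfzDr // -exprz_exp.
  rewrite (_ : (-1) ^ 2 = 1) ?exp1rz ?mul1r ?expr1z ?mulN1r //.
  by rewrite -exprnP sqrrN expr1n.
- have sc : asummable (fun n : int => (-1) ^ n * O n).
    by apply: asummable_le sO _ => n; rewrite normrM expN1r normrX normrN1 expr1n mul1r.
  have h := asummable_hsumR sc.
  have := hsum_reflect (-1) h.
  have hr l : (-1) ^ (-1 - l) * O (-1 - l) = - ((-1) ^ l * O l).
    rewrite /O oddpow_reflect // half_sechV expfzDr // exprN1 invrN1 mulN1r mulNr.
    by rewrite !expN1r abszN.
  move/(eq_hsum hr) => /hsum_unique /(_ (hsumN h)) Z.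
  have Z0 : tsum (fun n : int => (-1) ^ n * O n) = 0 by lra.
  by move: h; rewrite Z0.
Qed.

Lemma sech_odd_sum_sqr :
  sech_odd_sum q ^+ 2 = 4 * (sech_even_sum (q ^+ 2) * sech_odd_sum (q ^+ 2)).
Proof.
have := sech_sums_sqr_diff; rewrite -sech_alternating_sqr sech_even_sum_split.
by move=> H; lra.
Qed.

Lemma sech_odd_sum_gt0 : 0 < sech_odd_sum q.
Proof.
have h := asummable_hsumR sO.
have p n : 0 < O n.
  by rewrite divr_gt0 ?oddpow_gt0 // ltr_pwDl // sqr_ge0.
have := hsum_le_partial h (fun n => ltW (p n)) (isT : uniq [:: 0 : int]).
by rewrite big_seq1; exact: lt_le_trans.
Qed.

Lemma sech_even_sum_ge : 2^-1 <= sech_even_sum q.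
Proof.
have h := asummable_hsumR sE.
have p n : 0 <= E n.
  by rewrite divr_ge0 ?(ltW (evenpow_gt0 _ _)) // addr_ge0 // sqr_ge0.
have := hsum_le_partial h p (isT : uniq [:: 0 : int]).
rewrite big_seq1 /E /evenpow mulr0 expr0z /half_sech expr1n mul1r.
exact.
Qed.

(** The difference of the squares at q is the square of the difference at [q ^+ 2], hence positive
    as soon as the latter difference is not 0. *)
Lemma sech_odd_lt_even_double :
  sech_odd_sum (q ^+ 2) < sech_even_sum (q ^+ 2) ->
  sech_odd_sum q < sech_even_sum q.
Proof.
move=> H; have := sech_sums_sqr_diff; rewrite -sech_alternating_sqr => H2.
have H3 : 0 < (sech_even_sum (q ^+ 2) - sech_odd_sum (q ^+ 2)) ^+ 2.
  by rewrite exprn_gt0 // subr_gt0.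
have := sech_odd_sum_gt0; have := sech_even_sum_ge; nra.
Qed.

End SechSums.

(** * The strict inequality M < c0 *)

Section StrictInequality.
Variable R : realType.

Lemma sech_odd_lt_even_small : exists2 d : R, 0 < d &
  forall q, 0 < q -> q < d -> sech_odd_sum q < sech_even_sum q.
Proof.
have h0 : 0 <= (2^-1 : R) by rewrite invr_ge0.
have h1 : (2^-1 : R) < 1 by rewrite invf_lt1 // ltr1n.
have hW := asummable_hsumR (asummable_geometric_int h0 h1).
set W := tsum _ in hW.
have W0 : 0 <= W by apply: (hsum_ge0 hW) => l; rewrite exprn_ge0.
(* The odd sum will be at most [2 * q * W]. This threshold makes it smaller than 1/2, the term of
   index 0 of the even sum, and also gives q < 1/4, which is used to compare powers of q^2 with
   powers of 1/2. *)
exists (4 * W + 4)^-1 => [|q q0 qd]; first by rewrite invr_gt0; lra.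
have d4 : (4 * W + 4)^-1 <= 4^-1 by rewrite lef_pV2 ?posrE; lra.
have q1 : q < 1 by lra.
have hO := asummable_hsumR (asummable_half_sech_odd q0 q1).
(* The factor 2 is spent on negative indices, where the absolute value of [Negz n] is n + 1 and not
   n. *)
have H : `|sech_odd_sum q| <= 2 * q * W.
  apply: hsum_le_hsum hO (hsumZ (2 * q) hW) _ => l.
  have bnd (n : nat) : q ^+ (2 * n).+1 <= q * 2^-1 ^+ n.
    rewrite exprS ler_wpM2l ?(ltW q0) // exprM lerXn2r ?nnegrE ?exprn_ge0 ?ltW //.
    by rewrite expr2; nra.
  case: l => n.
    rewrite oddpow_nat //; set x := q ^+ _.
    have x0 : 0 < x by rewrite exprn_gt0.
    have /andP[? hx] := half_sech_bound x0.
    rewrite ger0_norm // (le_trans hx) // (le_trans (bnd n)) //.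
    by rewrite ler_wpM2r ?exprn_ge0 // ler_pMl // ler1n.
  rewrite oddpow_Negz // half_sechV; set x := q ^+ _.
  have x0 : 0 < x by rewrite exprn_gt0.
  have /andP[? hx] := half_sech_bound x0.
  rewrite ger0_norm // (le_trans hx) // (le_trans (bnd n)) //.
  by rewrite /= exprS mulrA [2 * q]mulrC mulfK.
have := sech_even_sum_ge q0 q1.
have := ler_norm (sech_odd_sum q).
have : q * (4 * W + 4) < 1 by rewrite -ltr_pdivlMr ?div1r //; lra.
nra.
Qed.

(** Repeated squaring brings q into the range of small values, and [sech_odd_lt_even_double] carries
    the inequality back through the successive square roots. *)
Lemma sech_odd_lt_even (q : R) : 0 < q -> q < 1 ->
  sech_odd_sum q < sech_even_sum q.
Proof.
move=> q0 q1; have [d d0 Hd] := sech_odd_lt_even_small.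
have qX n : 0 < q ^+ (2 ^ n) < 1.
  rewrite exprn_gt0 //= exprn_ilt1 ?ltW //.
  by rewrite -lt0n expn_gt0.
have [N HN] : exists N, q ^+ (2 ^ N) < d.
  have /cvg_expr/cvgrPdist_lt/(_ d d0)[N _ HN] : `|q| < 1 by rewrite gtr0_norm.
  exists N; have := HN N (leqnn N); rewrite /= sub0r normrN.
  rewrite gtr0_norm ?exprn_gt0 //; apply: le_lt_trans.
  by apply: ler_wiXn2l; rewrite ?ltW // ltnW // ltn_expl.
have H : sech_odd_sum (q ^+ (2 ^ N)) < sech_even_sum (q ^+ (2 ^ N)).
  by apply: Hd => //; have /andP[] := qX N.
elim: N {HN} H => [|N IH]; first by rewrite expn0 expr1.
rewrite expnSr exprM => H; apply: IH.
by have /andP[? ?] := qX N; apply: sech_odd_lt_even_double.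
Qed.

(* The sequence [tau] is orthogonal to its shifts: its autocorrelation is, up to
   a geometric factor, the one of [kerT] and [kerS]. Symmetrising its sum turns
   [kerT] into [half_sech]. *)
Lemma kerS_toeplitz_constE (q : R) : 0 < q -> q < 1 ->
  kerS_toeplitz_const q = sech_even_sum q * sech_odd_sum q.
Proof.
move=> q0 q1; set r := Num.sqrt q.
have r0 : 0 < r by rewrite sqrtr_gt0.
have r2 : r ^+ 2 = q by rewrite sqr_sqrtr // ltW.
have r1 : r < 1 by rewrite -(expr_lt1 (n := 2)) ?r2 // ltW.
pose tau l := oddpow r l * kerT q l.
have odd2 l : oddpow q l = oddpow r l ^+ 2.
  by rewrite -r2 !expr2 /oddpow expfzMl.
have even2 l : evenpow q l = evenpow r l ^+ 2.
  by rewrite -r2 !expr2 /evenpow expfzMl.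
have d0 l := gt_eqF (oddpow_gt0 r0 l); have e0 l := gt_eqF (evenpow_gt0 r0 l).
have q21 : 0 < 1 - q ^+ 2 by rewrite subr_gt0 expr_lt1 // ltW.
have den x : 0 < x -> x <= r -> 1 - q ^+ 2 <= 1 - x ^+ 2 ^+ 2.
  move=> x0 xr; rewrite -r2 lerD2l lerN2 -!exprM.
  by apply: lerXn2r xr; rewrite nnegrE ltW.
have stau : asummable tau.
  apply: (@asummable_le _ _ _ (fun l => oddpow r l / (1 - (oddpow r l ^+ 2) ^+ 2))).
    apply: (asummable_oddpow r0 r1 (F := fun x => x / (1 - x ^+ 2 ^+ 2))
      (C := (1 - q ^+ 2)^-1)) => x x0 xr;
      have h := den _ x0 xr; have h' := lt_le_trans q21 h;
      have H : (1 - x ^+ 2 ^+ 2)^-1 <= (1 - q ^+ 2)^-1 by rewrite lef_pV2.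
      rewrite mulrC ger0_norm ?ler_wpM2r ?(ltW x0) //.
      by rewrite mulr_ge0 ?invr_ge0 ?ltW.
    have -> : x^-1 / (1 - x^-1 ^+ 2 ^+ 2) = - (x ^+ 3 / (1 - x ^+ 2 ^+ 2)).
      have x2 : x ^+ 2 ^+ 2 - 1 != 0 by rewrite -oppr_eq0 opprB gt_eqF.
      by field; rewrite (gt_eqF x0) x2 (gt_eqF h').
    rewrite normrN ger0_norm; last by rewrite divr_ge0 ?exprn_ge0 ?ltW.
    rewrite mulrC; apply: ler_pM => //.
    - by rewrite invr_ge0 ltW.
    - by rewrite exprn_ge0 // ltW.
    rewrite -[leRHS]expr1; apply: ler_wiXn2l => //; first exact: ltW.
    by rewrite (le_trans xr) // ltW.
  by move=> l; rewrite /tau /kerT odd2.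
have htau := asummable_hsumR stau.
have corr m : hsum (fun n => tau n * tau (n + m))
    (if m == 0 then kerS_toeplitz_const q else 0).
  have h := hsumZ (evenpow r m)^-1 (kerT_kerS q0 q1 m).
  have -> : (if m == 0 then kerS_toeplitz_const q else 0) = (evenpow r m)^-1 *
      (if m == 0 then kerS_toeplitz_const q else 0).
    case: eqP => [->|]; last by rewrite mulr0.
    by rewrite /evenpow mulr0 expr0z invr1 mul1r.
  apply: eq_hsum h => n; rewrite /tau kerSE !oddpowD // odd2 even2.
  by field; rewrite e0.
have H := hsum_unique (hsum_autocorrelation stau htau corr) (hsum_delta 0 _).
have E : tsum tau = 2^-1 * sech_odd_sum r.
  have hs := hsumZ 2^-1 (asummable_hsumR (asummable_half_sech_odd r0 r1)).
  have h2 := hsumZ 2^-1 (hsumD htau (hsum_reflect (-1) htau)).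
  have -> : tsum tau = 2^-1 * (tsum tau + tsum tau) by field.
  apply: hsum_unique h2 _; apply: eq_hsum hs => l.
  rewrite /tau /kerT /half_sech !odd2 !oddpow_reflect //.
  have := oddpow_sqr_neq1 q0 q1 l; rewrite odd2.
  have := sum1sqr_neq0 (oddpow r l); have := d0 l.
  set x := oddpow r l => /negbT x0 x2 x4.
  have x5 : x ^+ 2 ^+ 2 - 1 != 0 by rewrite -oppr_eq0 opprB.
  by field; rewrite x0 x2 x4 x5.
(* The doubling identity is applied at r, with r^2 = q; its factor 4 cancels the square of the 1/2
   produced by the symmetrisation. *)
by rewrite -H E exprMn sech_odd_sum_sqr // r2; field.
Qed.

Lemma kerS_norm_lt_toeplitz (q : R) : 0 < q -> q < 1 ->
  0 < kerS_norm_const q < kerS_toeplitz_const q.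
Proof.
move=> q0 q1; rewrite kerS_norm_constE // kerS_toeplitz_constE //.
have h := sech_odd_sum_gt0 q0 q1; have h' := sech_odd_lt_even q0 q1.
by rewrite exprn_gt0 //= expr2 ltr_pM2r.
Qed.

End StrictInequality.

(** * The squared norm of the convolution by [kerS] *)

Section Sqn.
Variable R : realType.
Local Notation C := R[i].

Definition sqn (z : C) : R := complex.Re z ^+ 2 + complex.Im z ^+ 2.

Lemma sqnE z : (sqn z)%:C = `|z| ^+ 2. Proof. exact: add_Re2_Im2. Qed.

Lemma sqn_ge0 z : 0 <= sqn z. Proof. by rewrite addr_ge0 ?sqr_ge0. Qed.

Lemma sqnM x y : sqn (x * y) = sqn x * sqn y.
Proof. by apply: complexI; rewrite rmorphM /= !sqnE normrM exprMn. Qed.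

Lemma sqn_norm1 z : `|z| = 1 -> sqn z = 1.
Proof. by move=> z1; apply: complexI; rewrite sqnE z1 expr1n. Qed.

Lemma sqnR (x : R) : sqn x%:C = x ^+ 2.
Proof. by rewrite /sqn /= expr0n addr0. Qed.

Lemma norm_le_sqn z (B : R) : 0 <= B -> (`|z| <= B%:C) = (sqn z <= B ^+ 2).
Proof.
move=> B0; rewrite -lecR sqnE rmorphXn /= ler_pXn2r // nnegrE ?normr_ge0 //.
by rewrite ler0c.
Qed.

End Sqn.

Section NormBound.
Variables (R : realType) (q : R).
Hypotheses (q0 : 0 < q) (q1 : q < 1).
Local Notation M := (kerS_norm_const q).

Let e (l : int) := half_sech (oddpow q l).

Let finite_real_bound (y : int -> R) (J K : seq int) : uniq J -> uniq K ->
  \sum_(n <- K) (\sum_(m <- J) y m * kerS q (n - m)) ^+ 2 <=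
  M * \sum_(m <- J) y m ^+ 2.
Proof.
move=> uJ uK.
pose F n := \sum_(m <- J) \sum_(m' <- J) y m * y m' *
  (kerS q (n - m) * kerS q (n - m') + e (n - m) * e (n - m')).
have FE n : F n = (\sum_(m <- J) y m * kerS q (n - m)) ^+ 2
    + (\sum_(m <- J) y m * e (n - m)) ^+ 2.
  rewrite !expr2 !big_distrlr /= -big_split /=; apply: eq_bigr => m _.
  by rewrite -big_split /=; apply: eq_bigr => m' _; ring.
have hF : hsum F (\sum_(m <- J) \sum_(m' <- J)
    y m * y m' * (if m - m' == 0 then M else 0)).
  apply: hsum_sum => m; apply: hsum_sum => m'; apply: hsumZ.
  apply: eq_hsum (hsum_shift (- m) (kerS_sech_autocorrelation (m - m') q0 q1)).
  by move=> n; rewrite /e (_ : n - m + (m - m') = n - m') //; arith.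
have -> : M * \sum_(m <- J) y m ^+ 2 =
    \sum_(m <- J) \sum_(m' <- J) y m * y m' * (if m - m' == 0 then M else 0).
  rewrite mulr_sumr big_seq [RHS]big_seq; apply: eq_bigr => m mJ.
  rewrite (bigD1_seq m) //= subrr eqxx big1 ?addr0; first by ring.
  by move=> m' mm'; rewrite subr_eq0 eq_sym (negbTE mm') mulr0.
apply: le_trans (hsum_le_partial hF _ uK) => [|n].
  by apply: ler_sum => n _; rewrite FE lerDl sqr_ge0.
by rewrite FE addr_ge0 ?sqr_ge0.
Qed.

Let finite_bound (y : int -> R[i]) (J K : seq int) : uniq J -> uniq K ->
  \sum_(n <- K) sqn (\sum_(m <- J) y m * (kerS q (n - m))%:C) <=
  M * \sum_(m <- J) sqn (y m).
Proof.
move=> uJ uK; rewrite /sqn !big_split /= mulrDr lerD //.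
  under eq_bigr do rewrite raddf_sum /=.
  apply: le_trans (finite_real_bound (fun m => complex.Re (y m)) uJ uK).
  rewrite le_eqVlt; apply/orP; left; apply/eqP; apply: eq_bigr => n _.
  congr (_ ^+ 2); apply: eq_bigr => m _.
  by case: (y m) => a b /=; rewrite mulr0 subr0.
under eq_bigr do rewrite raddf_sum /=.
apply: le_trans (finite_real_bound (fun m => complex.Im (y m)) uJ uK).
rewrite le_eqVlt; apply/orP; left; apply/eqP; apply: eq_bigr => n _.
congr (_ ^+ 2); apply: eq_bigr => m _.
by case: (y m) => a b /=; rewrite mulr0 add0r.
Qed.

Let sqn_diff (v w : R[i]) (d : R) : 0 <= d -> `|v - w| <= d%:C ->
  sqn v <= sqn w + d * (2 * (`|complex.Re v| + `|complex.Im v|)).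
Proof.
move=> d0; have := normc_ge_Re (v - w); have := normc_ge_Im (v - w).
move=> h1 h2 h; move: (le_trans h1 h) (le_trans h2 h); rewrite !lecR.
case: v {h h1 h2} => a b; case: w => a' b' /=; rewrite /sqn /= => hb ha.
have k (x x' : R) : `|x - x'| <= d -> x ^+ 2 <= x' ^+ 2 + d * (2 * `|x|).
  move=> h; have : 2 * (x * (x - x')) <= 2 * (`|x| * d).
    by rewrite ler_pM2l // (le_trans (ler_norm _)) // normrM ler_wpM2l.
  have := sqr_ge0 (x - x'); rewrite sqrrB => H1 H2; lra.
have := k _ _ ha; have := k _ _ hb; lra.
Qed.

(** Square summability is expressed by a common bound on finite partial sums. One truncation [J] of
    the input approximates [V n] for all n in [K] at once, which reduces the bound to the finite
    case. *)
Lemma kerS_norm_bound (y V : int -> R[i]) (B : R) :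
  (forall J, uniq J -> \sum_(m <- J) sqn (y m) <= B) ->
  (forall n, hsum (fun m => y m * (kerS q (n - m))%:C) (V n)) ->
  forall K, uniq K -> \sum_(n <- K) sqn (V n) <= M * B.
Proof.
move=> hy hV K uK; apply/ler_addgt0Pr => d d0.
set D := \sum_(n <- K) 2 * (`|complex.Re (V n)| + `|complex.Im (V n)|).
have D0 : 0 <= D by apply: sumr_ge0 => n _; rewrite mulr_ge0 ?addr_ge0.
have d'0 : 0 < d / (D + 1) by rewrite divr_gt0 // ltr_wpDl.
have d'C : 0 < (d / (D + 1))%:C by rewrite ltcR.
have [c Hc] := choice (fun n => hV n _ d'C).
set J := undup (flatten (map c K)).
have uJ : uniq J by exact: undup_uniq.
have HJ n : n \in K -> `|V n - \sum_(m <- J) y m * (kerS q (n - m))%:C|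
    <= (d / (D + 1))%:C.
  move=> nK; apply/ltW/Hc => // m mc; rewrite mem_undup.
  by apply/flattenP; exists (c n) => //; exact: map_f.
apply: le_trans (_ : \sum_(n <- K) (sqn (\sum_(m <- J) y m * (kerS q (n - m))%:C)
   + d / (D + 1) * (2 * (`|complex.Re (V n)| + `|complex.Im (V n)|))) <= _).
  rewrite big_seq [leRHS]big_seq; apply: ler_sum => n nK.
  by apply: sqn_diff; [exact: ltW|exact: HJ].
rewrite big_split /= lerD //.
  apply: le_trans (finite_bound y uJ uK) _; rewrite ler_wpM2l ?hy //.
  by have /andP[/ltW] := kerS_norm_lt_toeplitz q0 q1.
rewrite -mulr_sumr -/D -mulrA ler_piMr ?(ltW d0) //.
by rewrite mulrC ler_pdivrMr ?mul1r ?lerDl // ltr_wpDl.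
Qed.

End NormBound.

(** * Wiener-Hopf factorization *)

Lemma hsum_nat (K : numFieldType) (f : nat -> K) s : hsum f s ->
  forall e, 0 < e -> exists N, forall n, (N <= n)%N -> `|s - \sum_(i < n) f i| < e.
Proof.
move=> h e /h[J HJ]; exists (\max_(i <- J) i).+1 => n Nn.
rewrite -(big_mkord xpredT f); apply: HJ; first exact: iota_uniq.
move=> i iJ; rewrite mem_index_iota /=; apply: leq_ltn_trans Nn.
exact: leq_bigmax_seq.
Qed.

Section WienerHopf.
Variables (R : realType) (q : R).
Hypotheses (q0 : 0 < q) (q1 : q < 1).

Let p := q ^+ 4.

(* The coefficients of [(w; p) / (q ^ 2 w; p)], one Wiener-Hopf factor of the
   symbol with Fourier coefficients [kerT q]. *)
Fixpoint alpha (i : nat) : R :=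
  if i is j.+1 then alpha j * ((q ^+ 2 - p ^+ j) / (1 - p ^+ j.+1)) else 1.

(** Coefficients of the product of the symbol of [kerT] by the factor [alpha]. This product is the
    other Wiener-Hopf factor: it is supported on l <= 0 ([Sker_pos]). *)
Definition Sker (l : int) : R := tsum (fun i : nat => alpha i * kerT q (l - i%:Z)).

(** The quotient (q^2; p)_n / (p; p)_n of q-Pochhammer symbols, with p = q^4. *)
Definition qprod (n : nat) : R :=
  \prod_(i < n) ((1 - q ^+ (4 * i + 2)) / (1 - q ^+ (4 * i + 4))).

Let q_ne0 : q != 0. Proof. by rewrite gt_eqF. Qed.

Let X_lt1 n : (0 < n)%N -> 0 < 1 - q ^+ n.
Proof. by move=> n0; rewrite subr_gt0 exprn_ilt1 ?(ltW q0) // -lt0n. Qed.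

Let p_lt1 i : 0 < 1 - p ^+ i.+1.
Proof. by rewrite -exprM X_lt1. Qed.

Lemma alphaS i : alpha i.+1 * (1 - p ^+ i.+1) = alpha i * (q ^+ 2 - p ^+ i).
Proof. by rewrite /= mulrA divfK // gt_eqF. Qed.

(** The first ratio is negative and all later ones lie between 0 and q^2. This gives the geometric
    decay, and also the sign that makes [Sker 0] a sum of nonnegative terms. *)
Lemma alpha_neg i : - (q ^+ 2) ^+ i <= alpha i.+1 < 0.
Proof.
elim: i => [|i /andP[IH1 IH2]].
  rewrite /= expr0 mul1r expr1.
  have h : 0 < 1 - p by rewrite -[p]expr1 p_lt1.
  rewrite lerNl -mulNr opprB ler_pdivrMr // pmulr_llt0 ?invr_gt0 //.
  rewrite mul1r lerD2l lerN2 subr_lt0 expr_lt1 ?(ltW q0) // q1 andbT.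
  by apply: ler_wiXn2l; rewrite ?ltW.
have c0 : 0 < q ^+ 2 - p ^+ i.+1.
  rewrite subr_gt0 -exprM; apply: lt_le_trans (_ : q ^+ 3 <= _).
    by rewrite ltr_iXn2l //; arith.
  by rewrite ler_iXn2l.
have c1 : (q ^+ 2 - p ^+ i.+1) / (1 - p ^+ i.+2) <= q ^+ 2.
  rewrite ler_pdivrMr ?p_lt1 // mulrBr mulr1 lerD2l lerN2 -!exprM -exprD.
  by apply: ler_wiXn2l; rewrite ?(ltW q0) ?(ltW q1) //; arith.
have c2 : 0 < (q ^+ 2 - p ^+ i.+1) / (1 - p ^+ i.+2) by rewrite divr_gt0 ?p_lt1.
rewrite [alpha _](_ : _ = alpha i.+1 * ((q ^+ 2 - p ^+ i.+1) / (1 - p ^+ i.+2))) //.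
rewrite nmulr_rlt0 // c2 andbT.
apply: le_trans (_ : - (q ^+ 2) ^+ i * ((q ^+ 2 - p ^+ i.+1) / (1 - p ^+ i.+2)) <= _).
  rewrite mulNr lerN2 [(q ^+ 2) ^+ i.+1]exprSr; apply: ler_wpM2l c1.
  by rewrite -exprM exprn_ge0 // ltW.
by rewrite ler_wpM2r // ltW.
Qed.

Lemma asummable_alpha : asummable alpha.
Proof.
have h := asummable_geometric (ltW q0) q1.
apply: asummable_le (asummableZ q^-1 h) _ => -[|i].
  by rewrite /= normr1 expr0 mulr1 gtr0_norm ?invr_gt0 // invf_ge1 // ltW.
have /andP[h1 h2] := alpha_neg i.
rewrite ltr0_norm // gtr0_norm ?mulr_gt0 ?invr_gt0 ?exprn_gt0 //.
rewrite exprS mulKf // lerNl (le_trans _ h1) // lerN2 -exprM.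
by apply: ler_wiXn2l; rewrite ?(ltW q0) ?(ltW q1) //; arith.
Qed.

Lemma hsum_Sker l : hsum (fun i : nat => alpha i * kerT q (l - i%:Z)) (Sker l).
Proof.
have [B _ HB] := kerT_bounded q0 q1.
apply/asummable_hsumR/(asummableMbounded asummable_alpha) => i; exact: HB.
Qed.

Let pz (l : int) : R := q ^ (4 * l).

Let oddpow_sqr l : oddpow q l ^+ 2 = q ^+ 2 * pz l.
Proof.
rewrite /pz /oddpow exprnP [q ^+ 2]exprnP exprz_exp -expfzDr //.
congr (_ ^ _); arith.
Qed.

Let pzB l (i : nat) : pz l = pz (l - i%:Z) * p ^+ i.
Proof.
by rewrite /p -exprM exprnP /pz -expfzDr //; congr (_ ^ _); arith.
Qed.

(** Multiplying [kerT q (l - i)] by 1 - q^2 p^l leaves p^i plus 1 - p^i times the kernel. By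
    [alphaS] the second part is also what the right-hand side produces, with i shifted by one; the
    first part gives the same constant [X] on both sides. *)
Lemma SkerS l : Sker l * (1 - q ^+ 2 * q ^ (4 * l)) =
  q ^+ 2 * (Sker (l - 1) * (1 - q ^ (4 * (l - 1)))).
Proof.
rewrite -!/(pz _).
have sX : asummable (fun i => alpha i * p ^+ i).
  apply: (asummableMbounded asummable_alpha (B := 1)) => i.
  by rewrite -exprM normrX gtr0_norm // exprn_ile1 ?ltW.
have hX := asummable_hsumR sX; set X := tsum _ in hX.
pose A (i : nat) := alpha i * (1 - p ^+ i) * kerT q (l - i%:Z).
have hA : hsum A (Sker l * (1 - q ^+ 2 * pz l) - X).
  rewrite mulrC; apply: eq_hsum (hsumB (hsumZ _ (hsum_Sker l)) hX) => i.
  rewrite /A /kerT; have := oddpow_sqr_neq1 q0 q1 (l - i%:Z).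
  rewrite oddpow_sqr (pzB l i) => d; field; exact: d.
have hA' : hsum (fun i => A i.+1) (q ^+ 2 * (Sker (l - 1) * (1 - pz (l - 1))) - X).
  rewrite mulrCA mulrC.
  apply: eq_hsum (hsumB (hsumZ _ (hsum_Sker (l - 1))) hX) => i.
  rewrite /A alphaS /kerT.
  have -> : l - i.+1%:Z = l - 1 - i%:Z by arith.
  have := oddpow_sqr_neq1 q0 q1 (l - 1 - i%:Z).
  rewrite oddpow_sqr (pzB (l - 1) i) => d; field; exact: d.
have : hsum (fun i => A i.+1) (Sker l * (1 - q ^+ 2 * pz l) - X).
  apply/(@hsum_comp R _ _ succn A) => //; first by move=> ? ? [].
  by case=> [_|j /(_ j)//]; rewrite /A expr0 subrr mulr0 mul0r.
by move/hsum_unique => /(_ _ hA') /addIr.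
Qed.

(** In [SkerS] at l = 1 the factor 1 - q^(4 (l - 1)) vanishes, so [Sker 1] is 0, and the recurrence
    propagates this upwards. *)
Lemma Sker_pos (n : nat) : Sker n.+1%:Z = 0.
Proof.
have z (k : nat) : 1 - q ^+ 2 * q ^ (4 * k%:Z) != 0.
  rewrite (_ : q ^ (4 * k%:Z) = q ^+ (4 * k)); last by rewrite exprnP; congr (_ ^ _); arith.
  by rewrite -exprD gt_eqF // X_lt1.
elim: n => [|n IH].
  have := SkerS 1; rewrite subrr mulr0 expr0z subrr !mulr0 => /eqP.
  by rewrite mulf_eq0 (negbTE (z 1%N)) orbF => /eqP.
have := SkerS n.+2%:Z; rewrite (_ : n.+2%:Z - 1 = n.+1%:Z); last by arith.
by rewrite IH mul0r mulr0 => /eqP; rewrite mulf_eq0 (negbTE (z n.+2)) orbF => /eqP.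
Qed.

Lemma Sker0_gt0 : 0 < Sker 0.
Proof.
have hp (i : nat) : 0 <= alpha i * kerT q (0 - i%:Z).
  rewrite /kerT oddpow_sqr sub0r; case: i => [|i].
    by rewrite mul1r /pz mulr0 expr0z mulr1 invr_ge0 ltW // X_lt1.
  have /andP[_ h] := alpha_neg i; rewrite nmulr_rge0 // invr_le0 subr_le0.
  rewrite /pz (_ : 4 * - i.+1%:Z = - (4 * i.+1)%N%:Z); last by arith.
  rewrite -exprnN -ler_pdivrMr ?invr_gt0 ?exprn_gt0 // invrK mul1r.
  by apply: ler_wiXn2l; rewrite ?(ltW q0) ?(ltW q1) //; arith.
have := hsum_le_partial (hsum_Sker 0) hp (isT : uniq [:: 0%N]).
rewrite big_seq1 mul1r /kerT oddpow_sqr /pz mulr0 expr0z mulr1.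
by apply: lt_le_trans; rewrite invr_gt0 X_lt1.
Qed.

Lemma SkerN_rec (n : nat) : Sker (- n.+1%:Z) * (1 - q ^+ (4 * n + 4)) =
  Sker (- n%:Z) * (q ^+ 4 - q ^+ (4 * n + 2)).
Proof.
have := SkerS (- n%:Z).
have -> : - n%:Z - 1 = - n.+1%:Z by arith.
have -> : 4 * - n.+1%:Z = - (4 * n + 4)%N%:Z by arith.
have -> : 4 * - n%:Z = - (4 * n)%N%:Z by arith.
rewrite -!exprnN !(exprD _ (4 * n)).
set x := q ^+ (4 * n); have x0 : x != 0 by rewrite expf_neq0.
set s := Sker _; set s' := Sker _ => E.
apply: (mulfI (expf_neq0 2 q_ne0)).
have -> : q ^+ 2 * (s' * (1 - x * q ^+ 4)) =
    - (x * q ^+ 4) * (q ^+ 2 * (s' * (1 - (x * q ^+ 4)^-1))).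
  by field; rewrite x0 q_ne0.
by rewrite -E; field; rewrite x0.
Qed.

Lemma Sker_partial_sum n :
  \sum_(i < n.+1) Sker (- i%:Z) = Sker 0 * qprod n.
Proof.
have d k : 1 - q ^+ (4 * k + 4) != 0 by rewrite gt_eqF // X_lt1 // addn4.
(* The induction also needs the next term expressed through the current partial sum, which is the
   second component. *)
suff H : \sum_(i < n.+1) Sker (- i%:Z) = Sker 0 * qprod n /\
    Sker (- n.+1%:Z) * (1 - q ^+ (4 * n + 4)) =
    Sker 0 * qprod n * (q ^+ (4 * n + 4) - q ^+ (4 * n + 2)) by case: H.
elim: n => [|n [IH1 IH2]].
  rewrite /qprod big_ord0 mulr1 big_ord_recl big_ord0 addr0 oppr0; split=> //.
  by rewrite (SkerN_rec 0) oppr0.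
have E : \sum_(i < n.+2) Sker (- i%:Z) = Sker 0 * qprod n.+1.
  rewrite big_ord_recr /= IH1 /qprod big_ord_recr /= -/(qprod n).
  apply: (mulIf (d n)); rewrite mulrDl IH2; field; exact: d.
split=> //; rewrite SkerN_rec; apply: (mulIf (d n)).
rewrite mulrAC IH2 /qprod big_ord_recr /= -/(qprod n).
have := d n; rewrite (_ : (4 * n.+1 + 4 = 4 * n + 8)%N); last by arith.
rewrite (_ : (4 * n.+1 + 2 = 4 * n + 6)%N); last by arith.
rewrite !(exprD _ (4 * n)) => dn; field; exact: dn.
Qed.

Lemma qprod_lower : exists2 c, 0 < c & forall n, c <= qprod n.
Proof.
(* With y = q^(4 i + 2), each factor is at least 1 - y, hence at least exp(- y / (1 - y)). The
   exponents are dominated by q^i / (1 - q^2), and [D] bounds the sum of these. *)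
set D := ((1 - q) * (1 - q ^+ 2))^-1.
have f_ge i : expR (- (q ^+ i / (1 - q ^+ 2))) <=
    (1 - q ^+ (4 * i + 2)) / (1 - q ^+ (4 * i + 4)).
  have y0 : 0 < q ^+ (4 * i + 2) by rewrite exprn_gt0.
  have y2 : q ^+ (4 * i + 2) <= q ^+ 2.
    by apply: ler_wiXn2l; rewrite ?(ltW q0) ?(ltW q1) //; arith.
  have yi : q ^+ (4 * i + 2) <= q ^+ i.
    by apply: ler_wiXn2l; rewrite ?(ltW q0) ?(ltW q1) //; arith.
  have z1 : 0 < 1 - q ^+ (4 * i + 2) by rewrite X_lt1 // addn2.
  have z2 := X_lt1 (isT : (0 < 2)%N).
  apply: le_trans (_ : 1 - q ^+ (4 * i + 2) <= _); last first.
    rewrite ler_pdivlMr; last by rewrite X_lt1 // addn4.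
    by rewrite ler_piMr ?(ltW z1) // lerBlDr lerDl exprn_ge0 // ltW.
  rewrite expRN -[leRHS]invrK lef_pV2 ?posrE ?expR_gt0 ?invr_gt0 //.
  apply: le_trans (expR_ge1Dx _).
  have -> : (1 - q ^+ (4 * i + 2))^-1 =
      1 + q ^+ (4 * i + 2) / (1 - q ^+ (4 * i + 2)) by field; rewrite gt_eqF.
  rewrite lerD2l; apply: ler_pM; rewrite ?invr_ge0 ?(ltW y0) ?(ltW z1) //.
  by rewrite lef_pV2 // lerD2l lerN2.
exists (expR (- D)) => [|n]; first exact: expR_gt0.
apply: le_trans (_ : \prod_(i < n) expR (- (q ^+ i / (1 - q ^+ 2))) <= _); last first.
  by apply: ler_prod => i _; rewrite expR_ge0 f_ge.
rewrite -expR_sum ler_expR sumrN lerN2 -mulr_suml /D invfM.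
rewrite ler_wpM2r ?invr_ge0 ?(ltW (X_lt1 _)) //.
by apply: geometric_partial_le => //; exact: ltW.
Qed.

Lemma asummable_SkerN : asummable (fun n : nat => Sker (- n%:Z)).
Proof.
have r20 : 0 <= q ^+ 2 by rewrite sqr_ge0.
have r21 : q ^+ 2 < 1 by rewrite expr_lt1 // ltW.
have ratio n : `|Sker (- n.+1%:Z)| <= q ^+ 2 * `|Sker (- n%:Z)|.
  have d : 0 < 1 - q ^+ (4 * n + 4) by rewrite X_lt1 // addn4.
  rewrite -(ler_pM2r d) -[X in `|_| * X](gtr0_norm d) -normrM SkerN_rec.
  rewrite normrM mulrC mulrAC ler_wpM2r //.
  have y0 : 0 < q ^+ (4 * n + 2) by rewrite exprn_gt0.
  have yw : q ^+ (4 * n + 2) <= q ^+ 2.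
    by apply: ler_wiXn2l; rewrite ?(ltW q0) ?(ltW q1) //; arith.
  rewrite (_ : q ^+ 4 = q ^+ 2 * q ^+ 2); last by rewrite -exprD.
  rewrite (_ : q ^+ (4 * n + 4) = q ^+ (4 * n + 2) * q ^+ 2); last first.
    by rewrite -exprD -addnA.
  move: (q ^+ (4 * n + 2)) (q ^+ 2) y0 yw r20 r21 => y w y0 yw w0 w1.
  have h1 : w * w <= w by rewrite ler_piMr // ltW.
  have h2 : w * w * y <= y by rewrite ler_piMl ?(ltW y0) // mulr_ile1 // ltW.
  have h4 : w * w * y <= w * w.
    by rewrite ler_piMr ?mulr_ge0 // (le_trans yw) // ltW.
  by rewrite ler_norml; apply/andP; split; lra.
have bnd n : `|Sker (- n%:Z)| <= `|Sker 0 * (q ^+ 2) ^+ n|.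
  elim: n => [|n IH]; first by rewrite oppr0 expr0 mulr1.
  apply: le_trans (ratio n) _; rewrite [(q ^+ 2) ^+ n.+1]exprS.
  by rewrite mulrCA normrM (ger0_norm r20) ler_wpM2l.
exact: asummable_le (asummableZ _ (asummable_geometric r20 r21)) bnd.
Qed.

(** The partial sums stay above a positive multiple of [Sker 0], so the limit is not 0. Its inverse
    is the constant row that makes [Lam 0] equal to 1 on every column. *)
Lemma hsum_SkerN : exists2 sigma, 0 < sigma &
  hsum (fun n : nat => Sker (- n%:Z)) sigma.
Proof.
have h := asummable_hsumR asummable_SkerN.
have [c c0 hc] := qprod_lower.
exists (tsum (fun n : nat => Sker (- n%:Z))) => //.
have S0 := Sker0_gt0.
have [N] := hsum_nat h (mulr_gt0 S0 c0); move=> /(_ N.+1 (leqnSn N)).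
rewrite Sker_partial_sum; have : Sker 0 * c <= Sker 0 * qprod N by rewrite ler_pM2l.
rewrite ltr_norml => H /andP[H1 _]; lra.
Qed.

End WienerHopf.

(** * The quotient symbol *)

Lemma hsum_nat_shift (K : numFieldType) (f : nat -> K) s (k : nat) :
  (forall m, (m < k)%N -> f m = 0) ->
  hsum f s <-> hsum (fun n => f (k + n)%N) s.
Proof.
move=> f0; apply: iff_sym; apply: (@hsum_comp _ _ _ (addn k) f) => [|m H].
  exact: addnI.
apply: f0; rewrite ltnNge; apply/negP => km.
by apply: (H (m - k)%N); rewrite subnKC.
Qed.

Lemma hsum_nat_tail (K : numFieldType) (f : nat -> K) s : hsum f s ->
  hsum (fun n => f n.+1) (s - f 0%N).
Proof.
move=> h; have h0 := hsum_delta 0%N (f 0%N).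
have z0 n : (n < 1)%N -> f n - (if n == 0%N then f 0%N else 0) = 0.
  by case: n => // _; rewrite subrr.
apply: eq_hsum ((hsum_nat_shift _ z0).1 (hsumB h h0)) => n.
by rewrite add1n subr0.
Qed.

Lemma normr_unit_exprz (K : numFieldType) (u : K) (n : int) :
  `|u| = 1 -> `|u ^ n| = 1.
Proof.
move=> u1; case: n => n;
  by rewrite ?NegzE -?exprnN -?exprnP ?normfV normrX u1 expr1n ?invr1.
Qed.

Lemma hsum_int_halves (K : numFieldType) (f : int -> K) s1 s2 :
  hsum (fun n : nat => f n%:Z) s1 -> hsum (fun n : nat => f (Negz n)) s2 ->
  hsum f (s1 + s2).
Proof.
move=> h1 h2.
have k1 : hsum (fun l : int => if l is Posz _ then f l else 0) s1.
  apply/(@hsum_comp K _ _ Posz) => //; first by move=> ? ? [].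
  by case=> // n /(_ n).
have k2 : hsum (fun l : int => if l is Negz _ then f l else 0) s2.
  apply/(@hsum_comp K _ _ Negz) => //; first by move=> ? ? [].
  by case=> // n /(_ n).
by apply: eq_hsum (hsumD k1 k2) => -[] n; rewrite ?addr0 ?add0r.
Qed.

Lemma kerS_decay (R : realType) (q : R) : 0 < q -> q < 1 ->
  exists2 K, 0 <= K & forall l, `|kerS q l| <= K * q ^+ (2 * `|l|).
Proof.
move=> q0 q1.
have d : 0 < 1 - q ^+ 2 by rewrite subr_gt0 expr_lt1 // ltW.
have xq n : 0 < q ^+ (2 * n).+1 <= q.
  rewrite exprn_gt0 //= -[leRHS]expr1.
  by apply: ler_wiXn2l => //; exact: ltW.
exists ((1 - q ^+ 2)^-1 / q) => [|l].
  by rewrite divr_ge0 ?invr_ge0 ?(ltW d) ?(ltW q0).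
rewrite /kerS; case: l => n; have /andP[x0 xq'] := xq n.
  rewrite oddpow_nat //; apply: le_trans (half_csch_bound q0 q1 x0 xq') _.
  rewrite -mulrA ler_wpM2l ?invr_ge0 ?(ltW d) // mulrC.
  rewrite ler_pdivlMr // -exprSr; apply: ler_wiXn2l; [exact: ltW..|arith].
rewrite oddpow_Negz //; apply: le_trans (half_cschV_bound q0 q1 x0 xq') _.
rewrite -mulrA ler_wpM2l ?invr_ge0 ?(ltW d) // mulrC ler_pdivlMr // -exprSr.
by apply: ler_wiXn2l; [exact: ltW..|arith].
Qed.

Section Laurent.
Variables (R : realType) (q : R) (u : R[i]).
Hypotheses (q0 : 0 < q) (q1 : q < 1) (u1 : `|u| = 1).
Local Notation C := R[i].
Local Notation M := (kerS_norm_const q).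
Local Notation c0 := (kerS_toeplitz_const q).

Local Notation gC l := ((kerS q l)%:C : C).
Local Notation tC l := ((kerT q l)%:C : C).
Local Notation aC i := ((alpha q i)%:C : C).

Definition kerU (l : int) : C := u ^ (2 * l + 1) * (kerS q l)%:C.

Let M_gt0 : 0 < M. Proof. by have /andP[] := kerS_norm_lt_toeplitz q0 q1. Qed.

Let M_lt : M < c0. Proof. by have /andP[] := kerS_norm_lt_toeplitz q0 q1. Qed.

Let c0_gt0 : 0 < c0. Proof. exact: lt_trans M_lt. Qed.

Let c0C : c0%:C != 0 :> C.
Proof. by rewrite (inj_eq (@complexI R) c0 0) gt_eqF. Qed.

Let u_neq0 : u != 0. Proof. by rewrite -normr_eq0 u1 oner_eq0. Qed.

Let norm_uz n : `|u ^ n| = 1.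
Proof. exact: normr_unit_exprz. Qed.

Let norm_kerU l : `|kerU l| = `|gC l|.
Proof. by rewrite normrM norm_uz mul1r. Qed.

Let s_gC : asummable (fun l => gC l).
Proof. exact/asummable_RtoC/asummable_kerS. Qed.

Lemma asummable_kerU : asummable kerU.
Proof. by apply: asummable_le s_gC _ => l; rewrite norm_kerU. Qed.

(* The Laurent coefficients of the quotient of the symbols with Fourier
   coefficients [kerU] and [kerT]. *)
Definition quotb (n : int) : C :=
  (c0^-1)%:C * tsum (fun l => gC l * kerU (n + l)).

Let s_corr n : asummable (fun l => gC l * kerU (n + l)).
Proof.
have [B _ HB] := asummable_bounded asummable_kerU.
by apply: asummableMbounded s_gC _ => l; exact: HB.
Qed.

Lemma quotb_kerU n : hsum (fun l => gC l * kerU (n + l)) (c0%:C * quotb n).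
Proof.
rewrite /quotb mulrA -rmorphM /= divff ?gt_eqF // mul1r.
exact: asummable_hsum.
Qed.

(** [quotb] is the correlation of [kerU] with [kerS], divided by c0; by [kerT_kerS], the convolution
    by [kerT] undoes it. *)
Lemma kerT_quotb n : hsum (fun r => tC r * quotb (n - r)) (kerU n).
Proof.
pose f (sr : int * int) := gC (sr.2 + sr.1) * kerU (n + sr.1) * tC sr.2.
have [B B0 HB] := kerT_bounded q0 q1.
have sf : asummable f.
  apply: (@asummableMbounded _ _ _ _ B%:C) => [|sr]; last by rewrite normcR lecR.
  apply: (@asummable_comp _ _ _ (fun sr : int * int => (sr.2 + sr.1, n + sr.1))
    (fun xy => gC xy.1 * kerU xy.2)); last exact: (asummableM s_gC asummable_kerU).
  by move=> [s r] [s' r'] /= [] e1 /addrI e2; rewrite e2 in e1 *; move/addIr: e1 => ->.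
have hrow s : hsum (fun r => f (s, r)) (kerU (n + s) * (if s == 0 then c0 else 0)%:C).
  apply: eq_hsum (hsumZ (kerU (n + s)) (hsum_RtoC (kerT_kerS q0 q1 s))) => r.
  by rewrite /f /= rmorphM /=; ring.
have hcol r : hsum (fun s => f (s, r)) (tC r * (c0%:C * quotb (n - r))).
  apply: eq_hsum (hsumZ (tC r) (hsum_shift r (quotb_kerU (n - r)))) => s.
  rewrite /f /= (_ : n - r + (s + r) = n + s); last by arith.
  by rewrite [r + s]addrC; ring.
have ht : hsum (fun s : int => kerU (n + s) * (if s == 0 then c0 else 0)%:C)
    (kerU n * c0%:C).
  apply: eq_hsum (hsum_delta 0 (kerU n * c0%:C)) => s.
  by case: eqP => [->|]; rewrite ?addr0 // mulr0.
have := hsumZ (c0%:C)^-1 (hsum_fubini_swap (asummable_hsum sf) hrow hcol ht).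
rewrite mulrC mulfK //; apply: eq_hsum => r.
by rewrite mulrCA mulKf.
Qed.

Lemma quotb_decay : exists2 K, 0 <= K &
  forall n, `|quotb n| <= (K * q ^+ `|n|)%:C.
Proof.
have [K K0 HK] := kerS_decay q0 q1.
have hW := asummable_hsumR (asummable_geometric_int (ltW q0) q1).
set W := tsum _ in hW.
have W0 : 0 <= W by apply: (hsum_ge0 hW) => l; rewrite exprn_ge0 ?ltW.
exists (c0^-1 * (K ^+ 2 * W)) => [|n].
  by rewrite mulr_ge0 ?invr_ge0 ?(ltW c0_gt0) ?mulr_ge0 ?sqr_ge0.
rewrite /quotb normrM normcR (gtr0_norm (x := c0^-1)) ?invr_gt0 //.
rewrite -mulrA rmorphM /=.
rewrite ler_wpM2l ?ler0c ?invr_ge0 ?(ltW c0_gt0) //.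
have H := hsum_RtoC (hsumZ (K ^+ 2 * q ^+ `|n|) hW).
rewrite mulrAC; apply: hsum_le_hsum (asummable_hsum (s_corr n)) H _ => l.
rewrite normrM norm_kerU !normcR -rmorphM /= lecR.
apply: le_trans (ler_pM _ _ (HK l) (HK (n + l))) _ => //.
rewrite mulrACA -[K * K]expr2 -[leRHS]mulrA ler_wpM2l ?sqr_ge0 // -!exprD.
(* The exponents satisfy 2|l| + 2|n + l| >= |n| + |l|. *)
by apply: ler_wiXn2l; [exact: ltW..|arith].
Qed.

Lemma asummable_quotb : asummable quotb.
Proof.
have [K K0 HK] := quotb_decay.
apply: asummable_dominated HK.
exact/asummableZ/asummable_geometric_int/q1/ltW.
Qed.

(** Inherited from the vanishing sum of [kerS]. This zero of the quotient at 1 is what makes the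
    first step from a constant row decay. *)
Lemma hsum_quotb : hsum quotb 0.
Proof.
pose f (ln : int * int) := gC ln.1 * kerU (ln.2 + ln.1).
have sf : asummable f.
  apply: (@asummable_comp _ _ _ (fun sr : int * int => (sr.1, sr.2 + sr.1))
    (fun xy => gC xy.1 * kerU xy.2)); last exact: (asummableM s_gC asummable_kerU).
  by move=> [s r] [s' r'] /= [] -> /addIr ->.
have hU := asummable_hsum asummable_kerU; set U := tsum _ in hU.
have hrow l : hsum (fun n => f (l, n)) (gC l * U).
  exact: hsumZ (hsum_shift l hU).
have ht : hsum (fun l => gC l * U) 0.
  rewrite -(mulr0 U).
  apply: eq_hsum (hsumZ U (hsum_RtoC (hsum_kerS q0 q1))) => l; exact: mulrC.
have := hsumZ (c0%:C)^-1 (hsum_fubini_swap (asummable_hsum sf) hrow quotb_kerU ht).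
by rewrite mulr0; apply: eq_hsum => n; rewrite mulKf.
Qed.

Let s_aC : asummable (fun i => aC i).
Proof. exact/asummable_RtoC/asummable_alpha. Qed.

Let sS : asummable (fun n : nat => (Sker q (- n%:Z))%:C : C).
Proof. exact/asummable_RtoC/asummable_SkerN. Qed.

(** As [kerU] is the convolution of [kerT] and [quotb], applying [alpha] replaces [kerT] by [Sker],
    of which only the indices <= 0 remain. *)
Lemma alpha_kerU l s : hsum (fun i : nat => aC i * kerU (l - i%:Z)) s ->
  hsum (fun n : nat => (Sker q (- n%:Z))%:C * quotb (l + n%:Z)) s.
Proof.
move=> hs.
pose f (ir : nat * int) := aC ir.1 * quotb (l - ir.2) * tC (ir.2 - ir.1%:Z).
have [B B0 HB] := kerT_bounded q0 q1.
have sf : asummable f.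
  apply: (@asummableMbounded _ _ _ _ B%:C) => [|sr]; last by rewrite normcR lecR.
  apply: (@asummable_comp _ _ _ (fun ir : nat * int => (ir.1, l - ir.2))
    (fun xy => aC xy.1 * quotb xy.2)); last exact: (asummableM s_aC asummable_quotb).
  by move=> [i r] [i' r'] /= [] -> /addrI/oppr_inj ->.
have hrow i : hsum (fun r => f (i, r)) (aC i * kerU (l - i%:Z)).
  apply: eq_hsum (hsumZ (aC i) (hsum_shift (- i%:Z) (kerT_quotb (l - i%:Z)))) => r.
  rewrite /f /= (_ : l - i%:Z - (r - i%:Z) = l - r); last by arith.
  by ring.
have hcol r : hsum (fun i => f (i, r)) ((Sker q r)%:C * quotb (l - r)).
  rewrite mulrC.
  apply: eq_hsum (hsumZ (quotb (l - r)) (hsum_RtoC (hsum_Sker q0 q1 r))) => i.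
  by rewrite /f /= rmorphM /=; ring.
have H := hsum_fubini_swap (asummable_hsum sf) hrow hcol hs.
have : hsum (fun n : nat => (Sker q (- n%:Z))%:C * quotb (l - - n%:Z)) s.
  apply/(@hsum_comp _ _ _ (fun n : nat => - n%:Z)
    (fun r => (Sker q r)%:C * quotb (l - r))) => //.
  - by move=> x y; arith.
  - case=> [[|n]|n] h.
    + by case: (h 0%N).
    + by rewrite Sker_pos // mul0r.
    + by case: (h n.+1).
by apply: eq_hsum => n; rewrite opprK.
Qed.


Local Notation kappa := (M / c0).

Lemma kappa_ge0 : 0 <= kappa.
Proof. by rewrite divr_ge0 // ltW. Qed.

Lemma kappa_lt1 : kappa < 1.
Proof. by rewrite ltr_pdivrMr // mul1r. Qed.

Let sqn_uz n : sqn (u ^ n) = 1.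
Proof. exact/sqn_norm1/norm_uz. Qed.

Let sqn_bounded (T : eqType) (y : T -> C) B :
  (forall J, uniq J -> \sum_(m <- J) sqn (y m) <= B) ->
  0 <= B /\ forall m, `|y m| <= (Num.sqrt B)%:C.
Proof.
move=> hy; have B0 : 0 <= B by have := hy [::] isT; rewrite big_nil.
split=> // m; rewrite norm_le_sqn ?sqrtr_ge0 // sqr_sqrtr //.
by have := hy [:: m] isT; rewrite big_seq1.
Qed.

(* The compressed operator is [1 / c0] times a product of the convolutions by
   [kerU] and [kerS], each of squared norm at most [M]. *)
Lemma quotb_contraction (y : nat -> C) B :
  (forall J, uniq J -> \sum_(m <- J) sqn (y m) <= B) ->
  forall J, uniq J ->
  \sum_(m <- J) sqn (tsum (fun k : nat => y k * quotb (m%:Z - k%:Z)))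
    <= kappa ^+ 2 * B.
Proof.
move=> hy J uJ; have [B0 hyB] := sqn_bounded hy.
pose Y (l : int) : C := if l is Posz m then y m else 0.
have YB l : `|Y l| <= (Num.sqrt B)%:C.
  by case: l => m //=; rewrite normr0 ler0c sqrtr_ge0.
(* The phase of [kerU (j - m)] splits as u^(2 j + 1) u^(- 2 m). Up to unimodular diagonal factors,
   the convolution by [kerU] is thus the one by [kerS]. *)
pose Y' l := Y l * u ^ (- (2 * l)).
have hY' I : uniq I -> \sum_(l <- I) sqn (Y' l) <= B.
  move=> uI; pose I' := pmap (fun l : int => if l is Posz m then Some m else None) I.
  have uI' : uniq I'.
    by apply: (pmap_uniq (g := Posz)) => // -[].
  apply: le_trans (hy I' uI'); rewrite big_pmap; apply: ler_sum => -[] m _ /=.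
    by rewrite /Y' /= sqnM sqn_uz mulr1.
  by rewrite /Y' mul0r /sqn expr0n addr0.
have s_conv n (F : int -> C) D : (forall l, `|F l| <= D) ->
    asummable (fun m => F m * (kerS q (n - m))%:C).
  move=> FD; have := asummable_reflect n s_gC.
  move=> /asummableMbounded /(_ FD).
  by under [X in asummable X]eq_fun do rewrite mulrC.
pose V n := tsum (fun m => Y' m * (kerS q (n - m))%:C).
have hV n : hsum (fun m => Y' m * (kerS q (n - m))%:C) (V n).
  apply/asummable_hsum/(s_conv _ _ (Num.sqrt B)%:C) => l.
  by rewrite normrM norm_uz mulr1.
pose v j := u ^ (2 * j + 1) * V j.
have hv j : hsum (fun m : nat => y m * kerU (j - m%:Z)) (v j).
  apply/(@hsum_comp _ _ _ Posz (fun m => Y m * kerU (j - m))) => //.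
  - by move=> ? ? [].
  - by case=> m; [move/(_ m)|rewrite mul0r].
  apply: eq_hsum (hsumZ (u ^ (2 * j + 1)) (hV j)) => m.
  rewrite /Y' /kerU (_ : 2 * (j - m) + 1 = (2 * j + 1) + (- (2 * m))); last by arith.
  by rewrite (expfzDr (2 * j + 1) (- (2 * m)) u_neq0); ring.
have nv I : uniq I -> \sum_(l <- I) sqn (v l) <= M * B.
  move=> uI; under eq_bigr do rewrite sqnM sqn_uz mul1r.
  exact: (kerS_norm_bound q0 q1 hY' hV).
have [MB0 vB] := sqn_bounded nv.
pose W n := tsum (fun j => v j * (kerS q (n - j))%:C).
have hW n : hsum (fun j => v j * (kerS q (n - j))%:C) (W n).
  exact/asummable_hsum/s_conv/vB.
have nW I := @kerS_norm_bound _ _ q0 q1 _ _ _ nv hW I.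
(* The antisymmetry [kerS_reflect] turns the correlation with [kerS] into a convolution, at the cost
   of a sign and of a shift of the index by one. *)
have E m' : c0%:C * tsum (fun k : nat => y k * quotb (m'%:Z - k%:Z)) = - W (m'%:Z - 1).
  pose f (ml : nat * int) := gC ml.2 * kerU (m'%:Z - ml.1%:Z + ml.2) * y ml.1.
  have sf : asummable f.
    apply: asummableMbounded (fun ml => hyB ml.1).
    apply: (@asummable_comp _ _ _ (fun ml : nat * int => (ml.2, m'%:Z - ml.1%:Z + ml.2))
      (fun xy => gC xy.1 * kerU xy.2)); last exact: (asummableM s_gC asummable_kerU).
    move=> [m l] [n k] /= [] -> /addIr/addrI/oppr_inj [->] //.
  have hrow m : hsum (fun l => f (m, l)) (y m * (c0%:C * quotb (m'%:Z - m%:Z))).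
    by apply: eq_hsum (hsumZ (y m) (quotb_kerU _)) => l; rewrite /f /= mulrC.
  have hcol l : hsum (fun m => f (m, l)) (gC l * v (m'%:Z + l)).
    apply: eq_hsum (hsumZ (gC l) (hv (m'%:Z + l))) => m.
    by rewrite /f /= (_ : m'%:Z + l - m%:Z = m'%:Z - m%:Z + l); [ring|arith].
  have hb : hsum (fun m : nat => y m * (c0%:C * quotb (m'%:Z - m%:Z)))
      (c0%:C * tsum (fun k : nat => y k * quotb (m'%:Z - k%:Z))).
    have sb : asummable (fun k : nat => y k * quotb (m'%:Z - k%:Z)).
      have : asummable (fun k : nat => quotb (m'%:Z - k%:Z)).
        apply: asummable_comp asummable_quotb => x y0 /addrI/oppr_inj [] //.
      move=> /asummableMbounded /(_ hyB).
      by under [X in asummable X]eq_fun do rewrite mulrC.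
    by apply: eq_hsum (hsumZ _ (asummable_hsum sb)) => m; rewrite mulrCA.
  have H := hsum_fubini_swap (asummable_hsum sf) hrow hcol hb.
  have H2 := hsum_shift (- m'%:Z) H.
  apply: hsum_unique H2 _.
  apply: eq_hsum (hsumN (hW (m'%:Z - 1))) => j.
  rewrite (_ : m'%:Z + (j - m'%:Z) = j); last by arith.
  have := kerS_reflect q0 q1 (j - m'%:Z).
  rewrite (_ : -1 - (j - m'%:Z) = m'%:Z - 1 - j); last by arith.
  by move=> ->; rewrite rmorphN /=; ring.
have E2 m' : sqn (tsum (fun k : nat => y k * quotb (m'%:Z - k%:Z))) =
    sqn (W (m'%:Z - 1)) / c0 ^+ 2.
  have H : sqn (W (m'%:Z - 1)) = sqn (- W (m'%:Z - 1)).
    by rewrite -(mulN1r (W _)) sqnM (sqn_norm1 (normrN1 _)) mul1r.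
  rewrite H -E sqnM sqnR mulrAC divff ?mul1r //.
  by rewrite expf_neq0 // gt_eqF.
under eq_bigr do rewrite E2.
rewrite -mulr_suml ler_pdivrMr ?exprn_gt0 //.
have -> : kappa ^+ 2 * B * c0 ^+ 2 = M * (M * B) by field; rewrite gt_eqF.
rewrite -(big_map (fun m : nat => m%:Z - 1) xpredT (fun n => sqn (W n))).
by apply: nW; rewrite map_inj_uniq // => x y0 /addIr [].
Qed.

End Laurent.

(** * The row functionals and the expansion in powers of z *)

Section Functionals.
Variables (R : realType) (q : R) (u : R[i]).
Hypotheses (q0 : 0 < q) (q1 : q < 1) (u1 : `|u| = 1).
Local Notation C := R[i].
Local Notation kappa := (kerS_norm_const q / kerS_toeplitz_const q).
Local Notation gU := (kerU q u).
Local Notation b := (quotb q u).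
Local Notation tC l := ((kerT q l)%:C : C).
Local Notation aC i := ((alpha q i)%:C : C).

Fixpoint row_coef (nu : C) (n m : nat) : C :=
  if n is n'.+1 then tsum (fun k : nat => row_coef nu n' k * b (m%:Z - k%:Z)) else nu.

Let kappa_gt0 : 0 < kappa.
Proof.
have /andP[h1 h2] := kerS_norm_lt_toeplitz q0 q1.
by rewrite divr_gt0 // (lt_trans h1).
Qed.

Let kappa1 : kappa < 1. Proof. exact: kappa_lt1. Qed.

Let s_b : asummable b. Proof. exact: asummable_quotb. Qed.

Let s_b_row (y : nat -> C) D l : (forall m, `|y m| <= D) ->
  asummable (fun k : nat => y k * b (l - k%:Z)).
Proof.
move=> yD; have : asummable (fun k : nat => b (l - k%:Z)).
  by apply: asummable_comp s_b => x y0 /addrI/oppr_inj [].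
move=> /asummableMbounded /(_ yD).
by under [X in asummable X]eq_fun do rewrite mulrC.
Qed.

Lemma hsum_geometric_tail m :
  hsum (fun k : nat => q ^+ (m + k)) (q ^+ m * tsum (fun k : nat => q ^+ k)).
Proof.
apply: eq_hsum (hsumZ (q ^+ m) (asummable_hsumR (asummable_geometric (ltW q0) q1))).
by move=> k; rewrite exprD.
Qed.

(* The coefficients [b] sum to zero, so the tail sums decay. *)
Lemma row_coef1_decay nu : exists2 K, 0 <= K &
  forall m, `|row_coef nu 1 m| <= (K * q ^+ m)%:C.
Proof.
have [K K0 HK] := quotb_decay q0 q1 u1.
set s := tsum (fun k : nat => q ^+ k).
have hs := asummable_hsumR (asummable_geometric (ltW q0) q1).
have s0 : 0 <= s by apply: (hsum_ge0 hs) => k; rewrite exprn_ge0 // ltW.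
have [D D0 HD] : exists2 D : R, 0 <= D & `|nu| = D%:C.
  by exists (Normc.normc nu) => //; rewrite -ler0c; exact: (normr_ge0 nu).
exists (D * (K * s)) => [|m]; first by rewrite !mulr_ge0.
have h := hsum_reflect m%:Z (hsum_quotb q0 q1 u1).
have h1 : hsum (fun k : nat => b (m%:Z - k%:Z)) (tsum (fun k : nat => b (m%:Z - k%:Z))).
  apply: asummable_hsum; have := @s_b_row (fun=> 1) 1 m%:Z.
  by under [X in asummable X]eq_fun do rewrite mul1r; apply=> _; rewrite normr1.
have s2 : asummable (fun k : nat => b (m%:Z - Negz k)).
  by apply: asummable_comp s_b => x y /addrI/oppr_inj [].
have h2 := asummable_hsum s2.
have E := hsum_unique (hsum_int_halves h1 h2) h.
have H2 : `|tsum (fun k : nat => b (m%:Z - Negz k))| <= (K * (q ^+ m * s))%:C.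
  apply: hsum_le_hsum h2 (hsum_RtoC (hsumZ K (hsum_geometric_tail m))) _ => k.
  apply: le_trans (HK _) _; rewrite lecR ler_wpM2l //.
  by apply: ler_wiXn2l; [exact: ltW..|arith].
have -> : row_coef nu 1 m = - (nu * tsum (fun k : nat => b (m%:Z - Negz k))).
  rewrite /= (hsum_tsumE (hsumZ nu h1)) -mulrN; congr (_ * _).
  by apply/eqP; rewrite -addr_eq0 E.
rewrite normrN normrM HD (_ : D * (K * s) * q ^+ m = D * (K * (q ^+ m * s))); last by ring.
by rewrite rmorphM /= ler_wpM2l // ler0c.
Qed.

(** The row of index 0 is constant, so the contraction can only be iterated from the row of index 1,
    which decays. The division by [kappa] compensates this offset of the exponent. *)
Lemma row_coef_bound nu : exists2 K, 0 <= K &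
  forall n m, `|row_coef nu n m| <= (K * kappa ^+ n)%:C.
Proof.
have [K1 K10 HK1] := row_coef1_decay nu.
have [B HB] := asummable_geometric (ltW q0) q1.
have hB n : forall J, uniq J ->
    \sum_(m <- J) sqn (row_coef nu n.+1 m) <= (kappa ^+ 2) ^+ n * (K1 ^+ 2 * B).
  elim: n => [|n IH] J uJ.
    rewrite expr0 mul1r; apply: le_trans (_ : K1 ^+ 2 * \sum_(m <- J) `|q ^+ m| <= _).
      rewrite mulr_sumr; apply: ler_sum => m _.
      have := HK1 m; rewrite norm_le_sqn; last by rewrite mulr_ge0 ?exprn_ge0 // ltW.
      move=> h; apply: le_trans h _; rewrite exprMn ler_wpM2l ?sqr_ge0 //.
      rewrite ger0_norm ?exprn_ge0 ?(ltW q0) // -exprM.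
      by apply: ler_wiXn2l; [exact: ltW..|arith].
    by rewrite ler_wpM2l ?sqr_ge0 // HB.
  by rewrite exprS -mulrA; exact: quotb_contraction.
have B0 : 0 <= K1 ^+ 2 * B by have := hB 0%N [::] isT; rewrite big_nil expr0 mul1r.
have nu0 : 0 <= Normc.normc nu :> R by rewrite -ler0c; exact: (normr_ge0 nu).
have S0 : 0 <= Num.sqrt (K1 ^+ 2 * B) / kappa.
  by rewrite divr_ge0 ?sqrtr_ge0 // ltW.
exists (Normc.normc nu + Num.sqrt (K1 ^+ 2 * B) / kappa).
  exact: addr_ge0.
case=> [|n] m.
  by rewrite expr0 mulr1 -[`|_|]/((Normc.normc nu)%:C) lecR lerDl.
rewrite norm_le_sqn; last by rewrite mulr_ge0 ?addr_ge0 ?exprn_ge0 // ltW.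
have := hB n [:: m] isT; rewrite big_seq1 => h.
have k0 k : 0 <= kappa ^+ k by rewrite exprn_ge0 // ltW.
have p1 : 0 <= kappa ^+ n * Num.sqrt (K1 ^+ 2 * B) by rewrite mulr_ge0 ?sqrtr_ge0.
have p2 : 0 <= (Normc.normc nu + Num.sqrt (K1 ^+ 2 * B) / kappa) * kappa ^+ n.+1.
  by rewrite mulr_ge0 // addr_ge0.
rewrite (_ : K1 ^+ 2 * B = Num.sqrt (K1 ^+ 2 * B) ^+ 2) in h; last first.
  by rewrite sqr_sqrtr.
apply: le_trans h _; rewrite exprAC -exprMn ler_pXn2r ?nnegrE //.
rewrite [kappa ^+ n.+1]exprS mulrA [leRHS]mulrC ler_wpM2l // mulrDl divfK ?gt_eqF // lerDr.
by rewrite mulr_ge0 // ltW.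
Qed.

(** The row [y] applied after the triangular Toeplitz operator with coefficients [alpha]. On column
    k of T0 the inner sum is [Sker q (k - m)], which is 0 for m < k. *)
Definition lfun (y e : nat -> C) : C :=
  tsum (fun m => y m * tsum (fun i => aC i * e (m + i)%N)).

Section Dominated.
Variables (r : R) (y : nat -> C) (Y : R).
Hypotheses (r0 : 0 <= r) (r1 : r < 1).
Hypothesis yY : forall m, `|y m| <= Y%:C.

Let A := tsum (fun i => `|alpha q i|).
Let G := tsum (fun m : nat => r ^+ m).

Let s_aC : asummable (fun i => aC i).
Proof. exact/asummable_RtoC/asummable_alpha. Qed.

Let hA : hsum (fun i => `|alpha q i|) A.
Proof. exact/asummable_hsumR/asummable_norm/asummable_alpha. Qed.

Let hG : hsum (fun m : nat => r ^+ m) G.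
Proof. exact/asummable_hsumR/asummable_geometric. Qed.

Lemma lfun_const_ge0 : 0 <= A * G.
Proof.
by rewrite mulr_ge0 ?(hsum_ge0 hA) ?(hsum_ge0 hG) // => m; rewrite exprn_ge0.
Qed.

Variables (e : nat -> C) (E : R).
Hypothesis eE : forall j, `|e j| <= (E * r ^+ j)%:C.

Lemma lfun_inner m : hsum (fun i => aC i * e (m + i)%N)
  (tsum (fun i => aC i * e (m + i)%N)).
Proof.
apply/asummable_hsum/(asummableMbounded s_aC (B := E%:C)) => i.
have E0 : 0 <= E.
  by have := le_trans (normr_ge0 _) (eE 0); rewrite expr0 mulr1 ler0c.
by apply: le_trans (eE _) _; rewrite lecR ler_piMr // exprn_ile1 // ltW.
Qed.

Lemma lfun_inner_le m :
  `|tsum (fun i => aC i * e (m + i)%N)| <= (A * E * r ^+ m)%:C.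
Proof.
have E0 : 0 <= E.
  by have := le_trans (normr_ge0 _) (eE 0); rewrite expr0 mulr1 ler0c.
rewrite (_ : A * E * r ^+ m = E * r ^+ m * A); last by ring.
apply: hsum_le_hsum (lfun_inner m) (hsum_RtoC (hsumZ _ hA)) _ => i.
rewrite normrM normcR mulrC rmorphM /= ler_wpM2r ?ler0c //.
apply: le_trans (eE _) _; rewrite lecR ler_wpM2l //.
by apply: ler_wiXn2l => //; [exact: ltW|arith].
Qed.

Lemma hsum_lfun : hsum (fun m => y m * tsum (fun i => aC i * e (m + i)%N)) (lfun y e).
Proof.
apply: asummable_hsum.
apply: (@asummable_dominated _ _ _ (fun m => Y * (A * E) * r ^+ m)).
  exact/asummableZ/asummable_geometric.
by move=> m; rewrite normrM -mulrA rmorphM /=; apply: ler_pM (lfun_inner_le _).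
Qed.

Lemma lfun_le : `|lfun y e| <= (Y * E * (A * G))%:C.
Proof.
rewrite (_ : Y * E * (A * G) = Y * (A * E) * G); last by ring.
apply: hsum_le_hsum hsum_lfun (hsum_RtoC (hsumZ _ hG)) _ => m.
by rewrite normrM -mulrA rmorphM /=; apply: ler_pM (lfun_inner_le _).
Qed.

End Dominated.

Lemma lfunD r y Y e E e' E' : 0 <= r -> r < 1 ->
  (forall m, `|y m| <= Y%:C) ->
  (forall j, `|e j| <= (E * r ^+ j)%:C) -> (forall j, `|e' j| <= (E' * r ^+ j)%:C) ->
  lfun y (fun j => e j + e' j) = lfun y e + lfun y e'.
Proof.
move=> r0 r1 yY eE eE'.
apply: hsum_tsumE.
apply: eq_hsum (hsumD (hsum_lfun r0 r1 yY eE) (hsum_lfun r0 r1 yY eE')) => m.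
rewrite -mulrDr; congr (_ * _); apply/esym/hsum_tsumE.
apply: eq_hsum (hsumD (lfun_inner r0 r1 eE m) (lfun_inner r0 r1 eE' m)) => i.
by rewrite mulrDr.
Qed.

Lemma lfunZ r y Y e E a : 0 <= r -> r < 1 ->
  (forall m, `|y m| <= Y%:C) -> (forall j, `|e j| <= (E * r ^+ j)%:C) ->
  lfun y (fun j => a * e j) = a * lfun y e.
Proof.
move=> r0 r1 yY eE; apply: hsum_tsumE.
apply: eq_hsum (hsumZ a (hsum_lfun r0 r1 yY eE)) => m.
rewrite mulrCA; congr (_ * _); apply/esym/hsum_tsumE.
by apply: eq_hsum (hsumZ a (lfun_inner r0 r1 eE m)) => i; rewrite mulrCA.
Qed.

Lemma lfun_sum r y Y (T : Type) (I : seq T) (a : T -> C) (c : T -> nat -> C) :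
  0 <= r -> r < 1 -> (forall m, `|y m| <= Y%:C) ->
  (forall k, exists D, forall j, `|c k j| <= (D * r ^+ j)%:C) ->
  (exists D, forall j, `|\sum_(k <- I) a k * c k j| <= (D * r ^+ j)%:C) /\
  lfun y (fun j => \sum_(k <- I) a k * c k j) = \sum_(k <- I) a k * lfun y (c k).
Proof.
move=> r0 r1 yY hc; elim: I => [|k I [[F hF] IH]].
  split; first by exists 0 => j; rewrite big_nil normr0 mul0r.
  rewrite big_nil; apply: hsum_tsumE; apply: eq_hsum (@hsum0 _ _) => m.
  rewrite (_ : tsum _ = 0) ?mulr0 //; apply: hsum_tsumE.
  by apply: eq_hsum (@hsum0 _ _) => i; rewrite big_nil mulr0.
have [D hD] := hc k.
have hD' j : `|a k * c k j| <= (Normc.normc (a k) * D * r ^+ j)%:C.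
  by rewrite normrM -mulrA rmorphM /= ler_wpM2l.
have E j : \sum_(k <- k :: I) a k * c k j = a k * c k j + \sum_(k <- I) a k * c k j.
  by rewrite big_cons.
split.
  exists (Normc.normc (a k) * D + F) => j; rewrite E mulrDl rmorphD /=.
  exact: le_trans (ler_normD _ _) (lerD (hD' j) (hF j)).
rewrite big_cons -IH -(lfunZ _ r0 r1 yY hD) -(lfunD r0 r1 yY hD' hF).
by congr lfun; apply/funext => j; rewrite E.
Qed.

Let K_decay : exists2 K, 0 <= K & forall l, `|kerS q l| <= K * q ^+ (2 * `|l|).
Proof. exact: kerS_decay. Qed.

(** Along a column the index of [kerT] tends to -oo, where [oddpow] is at least 1 and [kerT] is no
    larger than [kerS]. The constant depends on k, which is harmless: only finite combinations of
    columns are used. *)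
Lemma kerT_col_decay (k : nat) : exists2 D, 0 <= D &
  forall j : nat, `|tC (k%:Z - j%:Z)| <= (D * q ^+ j)%:C.
Proof.
have [K K0 HK] := K_decay.
exists (K / q ^+ k.+1) => [|j]; first by rewrite divr_ge0 // exprn_ge0 // ltW.
rewrite normcR lecR mulrAC ler_pdivlMr ?exprn_gt0 //.
set l := k%:Z - j%:Z; have op := oddpow_gt0 q0 l.
rewrite -(ler_pM2r op).
have -> : `|kerT q l| * q ^+ k.+1 * oddpow q l = `|kerS q l| * q ^+ k.+1.
  by rewrite kerSE normrM (gtr0_norm op); ring.
apply: le_trans (_ : K * q ^+ (2 * `|l|) * q ^+ k.+1 <= _).
  by rewrite ler_wpM2r ?HK // exprn_ge0 // ltW.
rewrite -!mulrA ler_wpM2l // -exprD.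
have [jk|kj] := leqP j k.
  have -> : l = (k - j)%N%:Z by rewrite /l; arith.
  by rewrite oddpow_nat // -exprD; apply: ler_wiXn2l; [exact: ltW..|arith].
have -> : l = Negz (j - k).-1 by rewrite /l; arith.
rewrite oddpow_Negz // ler_pdivlMr ?exprn_gt0 // -exprD.
by apply: ler_wiXn2l; [exact: ltW..|arith].
Qed.

Lemma kerU_col_decay (k : nat) : exists2 D, 0 <= D &
  forall j : nat, `|gU (k%:Z - j%:Z)| <= (D * q ^+ j)%:C.
Proof.
have [K K0 HK] := K_decay.
exists (K / q ^+ k) => [|j]; first by rewrite divr_ge0 // exprn_ge0 // ltW.
rewrite /kerU normrM normr_unit_exprz // mul1r.
rewrite normcR lecR mulrAC ler_pdivlMr ?exprn_gt0 //.
apply: le_trans (_ : K * q ^+ (2 * `|k%:Z - j%:Z|) * q ^+ k <= _).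
  by rewrite ler_wpM2r ?HK // exprn_ge0 // ltW.
rewrite -mulrA ler_wpM2l // -exprD.
by apply: ler_wiXn2l; [exact: ltW..|arith].
Qed.

Section Expansion.
Variable sigma : R.
Hypotheses (sigma0 : 0 < sigma)
  (h_sigma : hsum (fun n : nat => Sker q (- n%:Z)) sigma).

Local Notation y := (row_coef (sigma^-1)%:C).

Definition Lam (n : nat) (e : nat -> C) : C := lfun (y n) e.

Let inner_T (k m : nat) :
  tsum (fun i => aC i * tC (k%:Z - (m + i)%N%:Z)) = (Sker q (k%:Z - m%:Z))%:C.
Proof.
apply: hsum_tsumE.
apply: eq_hsum (hsum_RtoC (hsum_Sker q0 q1 (k%:Z - m%:Z))) => i.
by rewrite rmorphM /= (_ : k%:Z - m%:Z - i%:Z = k%:Z - (m + i)%N%:Z) //; arith.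
Qed.

Let hsum_LamT n k : hsum (fun j : nat => y n (k + j)%N * (Sker q (- j%:Z))%:C)
  (Lam n (fun j => tC (k%:Z - j%:Z))).
Proof.
have [K K0 HK] := row_coef_bound (sigma^-1)%:C.
have [D D0 HD] := kerT_col_decay k.
have h : hsum (fun m : nat => y n m * (Sker q (k%:Z - m%:Z))%:C)
    (Lam n (fun j => tC (k%:Z - j%:Z))).
  by apply: eq_hsum (hsum_lfun (ltW q0) q1 (HK n) HD) => m; rewrite inner_T.
have z m : (m < k)%N -> y n m * (Sker q (k%:Z - m%:Z))%:C = 0.
  move=> mk; rewrite (_ : k%:Z - m%:Z = (k - m).-1.+1%:Z); last by arith.
  by rewrite Sker_pos // mulr0.
apply: eq_hsum ((hsum_nat_shift _ z).1 h) => j.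
by rewrite (_ : k%:Z - (k + j)%N%:Z = - j%:Z) //; arith.
Qed.

(** For a constant row, the sum in [hsum_LamT] does not depend on k: it is sigma^-1 times the sum
    sigma of the [Sker (- j)]. *)
Lemma Lam0_kerT k : Lam 0 (fun j => tC (k%:Z - j%:Z)) = 1.
Proof.
apply: hsum_unique (hsum_LamT 0 k) _ => /=.
have -> : 1 = (sigma^-1)%:C * sigma%:C :> C.
  by rewrite -rmorphM /= mulVf // gt_eqF.
exact: hsumZ (hsum_RtoC h_sigma).
Qed.

(** By [alpha_kerU], the right-hand side is a double sum of [y n m], [Sker (- j)] and b (k - m + j).
    Summing over m first produces [y n.+1 (k + j)], and what is left is [hsum_LamT]. *)
Lemma LamS_kerT n k : Lam n.+1 (fun j => tC (k%:Z - j%:Z)) =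
  Lam n (fun j => gU (k%:Z - j%:Z)).
Proof.
have [K K0 HK] := row_coef_bound (sigma^-1)%:C.
have [D D0 HD] := kerU_col_decay k.
pose f (mj : nat * nat) :=
  (Sker q (- mj.2%:Z))%:C * b (k%:Z - mj.1%:Z + mj.2%:Z) * y n mj.1.
have sS : asummable (fun n : nat => (Sker q (- n%:Z))%:C : C).
  exact/asummable_RtoC/asummable_SkerN.
have sf : asummable f.
  apply: asummableMbounded (fun mj => HK n mj.1).
  apply: (@asummable_comp _ _ _ (fun mj : nat * nat => (mj.2, k%:Z - mj.1%:Z + mj.2%:Z))
    (fun xy => (Sker q (- xy.1%:Z))%:C * b xy.2)); last exact: (asummableM sS s_b).
  by move=> [m j] [m' j'] /= [] -> /addIr/addrI/oppr_inj [->].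
have hrow m : hsum (fun j => f (m, j))
    (y n m * tsum (fun i => aC i * gU (k%:Z - (m + i)%N%:Z))).
  have h := lfun_inner (ltW q0) q1 HD m.
  have h' : hsum (fun i : nat => aC i * gU (k%:Z - m%:Z - i%:Z))
      (tsum (fun i => aC i * gU (k%:Z - (m + i)%N%:Z))).
    apply: eq_hsum h => i.
    by rewrite (_ : k%:Z - m%:Z - i%:Z = k%:Z - (m + i)%N%:Z) //; arith.
  apply: eq_hsum (hsumZ (y n m) (alpha_kerU q0 q1 u1 h')) => j.
  by rewrite /f /= mulrC.
have hcol j : hsum (fun m => f (m, j)) (y n.+1 (k + j)%N * (Sker q (- j%:Z))%:C).
  have h := asummable_hsum (s_b_row (k + j)%N%:Z (HK n)).
  rewrite [X in hsum _ X]mulrC; apply: eq_hsum (hsumZ _ h) => m.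
  rewrite /f /= (_ : k%:Z - m%:Z + j%:Z = (k + j)%N%:Z - m%:Z); [by ring|arith].
have H := hsum_fubini_swap (asummable_hsum sf) hrow hcol
  (hsum_lfun (ltW q0) q1 (HK n) HD).
exact: hsum_unique (hsum_LamT n.+1 k) H.
Qed.

Lemma Lam_bound r : 0 <= r -> r < 1 -> exists2 K, 0 <= K &
  forall n e E, (forall j, `|e j| <= (E * r ^+ j)%:C) ->
  `|Lam n e| <= (E * K * kappa ^+ n)%:C.
Proof.
move=> r0 r1; have [K K0 HK] := row_coef_bound (sigma^-1)%:C.
have c0 := lfun_const_ge0 r0 r1.
eexists; first exact: mulr_ge0 K0 c0.
move=> n e E eE; apply: le_trans (lfun_le r0 r1 (HK n) eE) _.
by rewrite lecR le_eqVlt; apply/orP; left; apply/eqP; ring.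
Qed.

Lemma LamD n r e E e' E' : 0 <= r -> r < 1 ->
  (forall j, `|e j| <= (E * r ^+ j)%:C) -> (forall j, `|e' j| <= (E' * r ^+ j)%:C) ->
  Lam n (fun j => e j + e' j) = Lam n e + Lam n e'.
Proof.
by move=> r0 r1; have [K _ HK] := row_coef_bound (sigma^-1)%:C; exact: (lfunD r0 r1 (HK n)).
Qed.

Lemma LamZ a n r e E : 0 <= r -> r < 1 -> (forall j, `|e j| <= (E * r ^+ j)%:C) ->
  Lam n (fun j => a * e j) = a * Lam n e.
Proof.
by move=> r0 r1; have [K _ HK] := row_coef_bound (sigma^-1)%:C; exact: (lfunZ _ r0 r1 (HK n)).
Qed.

Lemma Lam_sum n r (T : Type) (I : seq T) (a : T -> C) (c : T -> nat -> C) :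
  0 <= r -> r < 1 -> (forall k, exists D, forall j, `|c k j| <= (D * r ^+ j)%:C) ->
  (exists D, forall j, `|\sum_(k <- I) a k * c k j| <= (D * r ^+ j)%:C) /\
  Lam n (fun j => \sum_(k <- I) a k * c k j) = \sum_(k <- I) a k * Lam n (c k).
Proof.
by move=> r0 r1; have [K _ HK] := row_coef_bound (sigma^-1)%:C; exact: (lfun_sum I a r0 r1 (HK n)).
Qed.

Local Opaque Lam.

(** With L_n the value of [Lam n] on T0 x, applying [Lam n] to the system gives L_n - z L_(n+1).
    Weighted by z^n this telescopes to L_0, the sum of the x_k. The defect [e] enters through [E]
    alone, so the estimate is uniform in [N] and in [x]. *)
Lemma toeplitz_expansion r : q <= r -> r < 1 -> exists2 K, 0 <= K &
  (forall n e E, (forall j, `|e j| <= (E * r ^+ j)%:C) ->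
    `|Lam n e| <= (E * K * kappa ^+ n)%:C) /\
  (forall (z : C) (N : nat) (x : 'I_N -> C) (d e : nat -> C) (D E : R),
    `|z| <= 1 ->
    (forall j, `|d j| <= (D * r ^+ j)%:C) ->
    (forall j, `|e j| <= (E * r ^+ j)%:C) ->
    (forall j : nat, \sum_(k < N) (tC (k%:Z - j%:Z) - z * gU (k%:Z - j%:Z)) * x k
       = d j + e j) ->
    exists2 s, hsum (fun n => z ^+ n * Lam n d) s &
      `|\sum_(k < N) x k - s| <= (E * K)%:C).
Proof.
move=> qr r1; have r0 : 0 <= r := le_trans (ltW q0) qr.
have [K K0 HK] := Lam_bound r0 r1.
have hk := asummable_hsumR (asummable_geometric (ltW kappa_gt0) kappa1).
set G := tsum _ in hk.
have G1 : 1 <= G.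
  have := hsum_le_partial hk (fun n => exprn_ge0 n (ltW kappa_gt0)) (isT : uniq [:: 0%N]).
  by rewrite big_seq1 expr0.
exists (K * G); first by rewrite mulr_ge0 // (le_trans _ G1).
have kn0 n : 0 <= kappa ^+ n by rewrite exprn_ge0 // ltW.
split=> [n e E eE|z N x d e D E z1 dD eE Hx].
  have E0 : 0 <= E.
    by have := le_trans (normr_ge0 _) (eE 0); rewrite expr0 mulr1 ler0c.
  apply: le_trans (HK n e E eE) _; rewrite lecR ler_wpM2r //.
  by rewrite mulrA ler_peMr // mulr_ge0.
have colr (c : nat -> C) (D' : R) : (forall j, `|c j| <= (D' * q ^+ j)%:C) ->
    forall j, `|c j| <= (D' * r ^+ j)%:C.
  move=> h j; have D'0 : 0 <= D'.
    by have := le_trans (normr_ge0 _) (h 0); rewrite expr0 mulr1 ler0c.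
  apply: le_trans (h j) _; rewrite lecR ler_wpM2l // lerXn2r // nnegrE //.
  exact: ltW.
have dT (k : 'I_N) : exists D', forall j : nat, `|tC (k%:Z - j%:Z)| <= (D' * r ^+ j)%:C.
  by have [D' _ h] := kerT_col_decay k; exists D'; exact: (colr (fun j : nat => tC (k%:Z - j%:Z))).
have dU (k : 'I_N) : exists D', forall j : nat, `|gU (k%:Z - j%:Z)| <= (D' * r ^+ j)%:C.
  by have [D' _ h] := kerU_col_decay k; exists D'; exact: (colr (fun j : nat => gU (k%:Z - j%:Z))).
pose T0 (j : nat) : C := \sum_(k < N) x k * tC (k%:Z - j%:Z).
pose T1 (j : nat) : C := \sum_(k < N) x k * gU (k%:Z - j%:Z).
have L0 n : (exists F, forall j, `|T0 j| <= (F * r ^+ j)%:C) /\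
    Lam n T0 = \sum_(k < N) x k * Lam n (fun j : nat => tC (k%:Z - j%:Z)).
  exact: Lam_sum.
have L1 n : (exists F, forall j, `|T1 j| <= (F * r ^+ j)%:C) /\
    Lam n T1 = \sum_(k < N) x k * Lam n (fun j : nat => gU (k%:Z - j%:Z)).
  exact: Lam_sum.
have [[F0 hF0] _] := L0 0%N; have [[F1 hF1] _] := L1 0%N.
have L01 n : Lam n T1 = Lam n.+1 T0.
  by rewrite (L0 n.+1).2 (L1 n).2; apply: eq_bigr => k _; rewrite LamS_kerT.
have L00 : Lam 0 T0 = \sum_(k < N) x k.
  by rewrite (L0 0%N).2; apply: eq_bigr => k _; rewrite Lam0_kerT mulr1.
have Hde n : Lam n d + Lam n e = Lam n T0 - z * Lam n.+1 T0.
  have hz : forall j, `|- z * T1 j| <= (Normc.normc z * F1 * r ^+ j)%:C.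
    by move=> j; rewrite normrM normrN -mulrA rmorphM /= ler_wpM2l.
  have E0 : (fun j => d j + e j) = (fun j => T0 j + - z * T1 j).
    apply/funext => j; rewrite -Hx /T0 /T1 mulr_sumr -big_split /=.
    by apply: eq_bigr => k _; ring.
  have E1 := LamD n r0 r1 dD eE; have E2 := LamZ (- z) n r0 r1 hF1.
  have E3 := LamD n r0 r1 hF0 hz.
  apply: etrans (esym E1) _; apply: etrans (congr1 (Lam n) E0) _.
  apply: etrans E3 _; apply: (congr1 (fun w => Lam n T0 + w)).
  apply: etrans E2 _; apply: etrans (mulNr _ _) _.
  exact: (congr1 (fun w => - (z * w)) (L01 n)).
have zn n : `|z ^+ n| <= 1 by rewrite normrX exprn_ile1.
have sLam (c : nat -> C) F : (forall j, `|c j| <= (F * r ^+ j)%:C) ->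
    asummable (fun n => z ^+ n * Lam n c).
  move=> hc; apply: (@asummable_dominated _ _ _ (fun n => F * K * kappa ^+ n)).
    exact/asummableZ/asummable_geometric/kappa1/ltW.
  move=> n; rewrite normrM; apply: le_trans (HK n c F hc).
  by rewrite ler_piMl.
exists (tsum (fun n => z ^+ n * Lam n d)); first exact: asummable_hsum (sLam d D dD).
have h0 := asummable_hsum (sLam T0 F0 hF0).
have h0' : hsum (fun n => z ^+ n.+1 * Lam n.+1 T0)
    (tsum (fun n => z ^+ n * Lam n T0) - \sum_(k < N) x k).
  have := hsum_nat_tail h0; rewrite expr0 mul1r.
  by move: (Lam 0 T0) L00 => w ->.
have hd := asummable_hsum (sLam d D dD); have he := asummable_hsum (sLam e E eE).
have hsub := hsumB (hsumB h0 h0') hd.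
have -> : \sum_(k < N) x k - tsum (fun n => z ^+ n * Lam n d) =
    tsum (fun n => z ^+ n * Lam n e).
  have -> : \sum_(k < N) x k = tsum (fun n => z ^+ n * Lam n T0)
      - (tsum (fun n => z ^+ n * Lam n T0) - \sum_(k < N) x k) by ring.
  apply/esym/hsum_tsumE.
  apply: eq_hsum hsub => n; rewrite exprS.
  have key (zn' v a w c : C) : a + w = v - z * c ->
      zn' * v - z * zn' * c - zn' * a = zn' * w.
    by move=> H; rewrite (_ : w = v - z * c - a); [ring|rewrite -H; ring].
  exact: key (Hde n).
rewrite (_ : E * (K * G) = E * K * G); last by ring.
apply: hsum_le_hsum he (hsum_RtoC (hsumZ (E * K) hk)) _ => n.
rewrite normrM; apply: le_trans (HK n e E eE).
by rewrite ler_piMl.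
Qed.

End Expansion.

End Functionals.

(** * Cauchy matrices *)

Section Cauchy.
Variables (R : realType) (N : nat) (X Y : 'I_N -> R).
Hypotheses (injX : injective X) (injY : injective Y).
Hypothesis XY : forall j k, X j != Y k.

(** Lagrange coefficients, at the nodes X, of the difference of the products of the t - Y_k and of
    the t - X_i; the leading terms cancel, so its degree is less than [N]. Evaluation at t = Y_k and
    at t = 0 gives the two sum rules below. *)
Definition cauchy_weight (j : 'I_N) : R :=
  (\prod_(k < N) (X j - Y k)) / \prod_(i < N | i != j) (X j - X i).

Local Notation A := cauchy_weight.

Lemma cauchy_interpolation t : \prod_(k < N) (t - Y k) - \prod_(i < N) (t - X i)
  = \sum_(j < N) A j * \prod_(i < N | i != j) (t - X i).
Proof.
pose P : {poly R} := \prod_(k < N) ('X - (Y k)%:P) - \prod_(i < N) ('X - (X i)%:P)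
  - \sum_(j < N) A j *: \prod_(i < N | i != j) ('X - (X i)%:P).
have size1 (Z : 'I_N -> R) : size (\prod_(i < N) ('X - (Z i)%:P)) = N.+1.
  by rewrite size_prod_XsubC /index_enum -enumT size_enum_ord.
have lead (Z : 'I_N -> R) : (\prod_(i < N) ('X - (Z i)%:P))`_N = 1.
  have /eqP := monic_prod_XsubC (index_enum 'I_N) xpredT Z.
  by rewrite /lead_coef size1.
have sizeP : (size P <= N)%N.
  apply: leq_trans (size_polyD _ _) _; rewrite geq_max; apply/andP; split.
    apply/leq_sizeP => j; rewrite leq_eqVlt => /orP[/eqP <-|Nj].
      by rewrite coefB !lead subrr.
    by rewrite coefB !nth_default ?subr0 // size1.
  rewrite size_polyN; apply: leq_trans (size_sum _ _ _) _.
  apply/bigmax_leqP => j _; apply: leq_trans (size_scale_leq _ _) _.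
  rewrite -big_filter size_prod_XsubC size_filter.
  have := count_predC (fun i => i != j) (index_enum 'I_N).
  rewrite [X in (_ + X)%N = _](_ : _ = 1%N).
    by rewrite /index_enum -enumT size_enum_ord addn1 => ->.
  rewrite (eq_count (a2 := pred1 j)); last by move=> i /=; rewrite negbK.
  by rewrite count_uniq_mem ?mem_index_enum // index_enum_uniq.
have hW (p : pred 'I_N) (Z : 'I_N -> R) x :
    (\prod_(i < N | p i) ('X - (Z i)%:P)).[x] = \prod_(i < N | p i) (x - Z i).
  by rewrite horner_prod; apply: eq_bigr => i _; rewrite hornerXsubC.
have hP x : P.[x] = \prod_(k < N) (x - Y k) - \prod_(i < N) (x - X i)
    - \sum_(j < N) A j * \prod_(i < N | i != j) (x - X i).
  rewrite /P !(hornerD, hornerN) !hW horner_sum; congr (_ - _).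
  by apply: eq_bigr => j _; rewrite hornerZ hW.
have P0 : P = 0.
  apply: (@roots_geq_poly_eq0 _ _ (map X (index_enum 'I_N))).
  - apply/allP => x /mapP[j _ ->]; apply/rootP; rewrite hP.
    have -> : \prod_(i < N) (X j - X i) = 0 by rewrite (bigD1 j) //= subrr mul0r.
    rewrite [\sum_(_ < N) _](bigD1 j) //= [X in _ - (_ + X)]big1 => [|i ij]; last first.
      by rewrite (bigD1 j) 1?eq_sym //= subrr mul0r mulr0.
    rewrite /A subr0 addr0 divfK ?subrr //; apply/prodf_neq0 => i ij.
    by rewrite subr_eq0 (inj_eq injX) eq_sym.
  - by rewrite map_inj_uniq ?index_enum_uniq.
  - by rewrite size_map /index_enum -enumT size_enum_ord.
by have := hP t; rewrite P0 horner0 => /esym/subr0_eq.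
Qed.

Lemma cauchy_weight_sum k : \sum_(j < N) A j / (X j - Y k) = 1.
Proof.
have h := cauchy_interpolation (Y k).
rewrite (bigD1 k) //= subrr mul0r sub0r in h.
have nz : \prod_(i < N) (Y k - X i) != 0.
  by apply/prodf_neq0 => i _; rewrite subr_eq0 eq_sym.
apply: (mulIf nz); rewrite mul1r -[RHS]opprK h -sumrN mulr_suml.
apply: eq_bigr => j _; rewrite (bigD1 j) //=.
have d : X j - Y k != 0 by rewrite subr_eq0.
by field; exact: d.
Qed.

Hypotheses (X0 : forall j, 0 < X j) (Y0 : forall k, 0 < Y k).

Lemma cauchy_weight_sum0 : \sum_(j < N) A j / X j =
  1 - (\prod_(k < N) Y k) / \prod_(i < N) X i.
Proof.
have h := cauchy_interpolation 0.
have nz : \prod_(i < N) (0 - X i) != 0.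
  by apply/prodf_neq0 => i _; rewrite sub0r oppr_eq0 gt_eqF.
have e (Z : 'I_N -> R) : \prod_(i < N) (0 - Z i) = (-1) ^+ N * \prod_(i < N) Z i.
  under eq_bigr do rewrite sub0r; by rewrite prodrN card_ord.
have nX : \prod_(i < N) X i != 0 by apply/prodf_neq0 => i _; rewrite gt_eqF.
have nS : (-1 : R) ^+ N != 0 by rewrite expf_neq0 // oppr_eq0 oner_eq0.
apply: (mulIf nz); rewrite mulr_suml mulrBl mul1r.
have -> : (\prod_(k < N) Y k) / (\prod_(i < N) X i) * \prod_(i < N) (0 - X i) =
    \prod_(i < N) (0 - Y i) by rewrite !e; field.
rewrite -opprB h -sumrN; apply: eq_bigr => j _; rewrite (bigD1 j) //=.
by field; rewrite gt_eqF.
Qed.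

Definition cauchy_coef (k : 'I_N) : R := \sum_(j < N) A j / (X j - Y k) ^+ 2.
Local Notation B := cauchy_coef.

(** For k != l, partial fractions reduce the sum to a difference of two instances of
    [cauchy_weight_sum]. The columns of the Cauchy matrix are thus orthogonal for the weights
    [A]. *)
Let gram k l : \sum_(j < N) A j / ((X j - Y k) * (X j - Y l)) =
  if k == l then B k else 0.
Proof.
case: eqVneq => [->|kl]; first by apply: eq_bigr => j _; rewrite expr2.
have d : Y k - Y l != 0 by rewrite subr_eq0 (inj_eq injY).
apply: (mulfI d); rewrite mulr0 mulr_sumr.
transitivity (\sum_(j < N) (A j / (X j - Y k) - A j / (X j - Y l))); last first.
  by rewrite sumrB !cauchy_weight_sum subrr.
apply: eq_bigr => j _.
have d1 : X j - Y l != 0 by rewrite subr_eq0.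
have d2 : X j - Y k != 0 by rewrite subr_eq0.
by field; rewrite d1 d2.
Qed.

Let gram0 k l : \sum_(j < N) A j / X j / ((X j - Y k) * (X j - Y l)) =
  (if k == l then B k / Y k else 0)
  - (1 - \sum_(j < N) A j / X j) / (Y k * Y l).
Proof.
have k0 : Y k != 0 by rewrite gt_eqF.
have l0 : Y l != 0 by rewrite gt_eqF.
apply: (mulfI l0).
have -> : Y l * ((if k == l then B k / Y k else 0)
    - (1 - \sum_(j < N) A j / X j) / (Y k * Y l)) =
    (if k == l then B k else 0) - (1 - \sum_(j < N) A j / X j) / Y k.
  case: eqP => [<-|_]; field; rewrite ?k0 ?l0 //.
rewrite -gram mulr_sumr; apply: (mulfI k0).
have -> : Y k * (\sum_(j < N) A j / ((X j - Y k) * (X j - Y l)) -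
    (1 - \sum_(j < N) A j / X j) / Y k) =
    Y k * (\sum_(j < N) A j / ((X j - Y k) * (X j - Y l))) - 1 +
    \sum_(j < N) A j / X j by field.
rewrite -[X in _ - X + _](cauchy_weight_sum k) !mulr_sumr -sumrB -big_split /=.
apply: eq_bigr => j _.
have d1 : X j - Y l != 0 by rewrite subr_eq0.
have d2 : X j - Y k != 0 by rewrite subr_eq0.
by field; rewrite d1 d2 gt_eqF.
Qed.

Let quad (c : 'I_N -> R) (x : 'I_N -> R) :
  \sum_(j < N) c j * (\sum_(k < N) x k / (X j - Y k)) ^+ 2 =
  \sum_(k < N) \sum_(l < N) x k * x l *
    \sum_(j < N) c j / ((X j - Y k) * (X j - Y l)).
Proof.
under [RHS]eq_bigr do under eq_bigr do rewrite mulr_sumr.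
under [RHS]eq_bigr do rewrite exchange_big /=.
rewrite exchange_big /=; apply: eq_bigr => j _.
rewrite expr2 big_distrlr /= mulr_sumr; apply: eq_bigr => k _.
rewrite mulr_sumr; apply: eq_bigr => l _.
by rewrite invfM; ring.
Qed.

Let diag (c x : 'I_N -> R) :
  \sum_(k < N) \sum_(l < N) x k * x l * (if k == l then c k else 0) =
  \sum_(k < N) c k * x k ^+ 2.
Proof.
apply: eq_bigr => k _; rewrite (bigD1 k) //= eqxx big1 ?addr0; first by ring.
by move=> l kl; rewrite eq_sym (negbTE kl) mulr0.
Qed.

Let energy_real x : \sum_(j < N) A j * (\sum_(k < N) x k / (X j - Y k)) ^+ 2 =
  \sum_(k < N) B k * x k ^+ 2.
Proof.
by rewrite quad; under eq_bigr do under eq_bigr do rewrite gram; rewrite diag.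
Qed.

Let energy0_real x :
  \sum_(j < N) A j / X j * (\sum_(k < N) x k / (X j - Y k)) ^+ 2 <=
  \sum_(k < N) B k / Y k * x k ^+ 2.
Proof.
rewrite quad; under eq_bigr do under eq_bigr do rewrite gram0 mulrBr.
under eq_bigr do rewrite sumrB.
rewrite sumrB diag lerBlDr lerDl.
have -> : \sum_(k < N) \sum_(l < N) x k * x l *
    ((1 - \sum_(j < N) A j / X j) / (Y k * Y l)) =
    (1 - \sum_(j < N) A j / X j) * (\sum_(k < N) x k / Y k) ^+ 2.
  rewrite expr2 big_distrlr /= mulr_sumr; apply: eq_bigr => k _.
  by rewrite mulr_sumr; apply: eq_bigr => l _; rewrite invfM; ring.
rewrite mulr_ge0 ?sqr_ge0 // cauchy_weight_sum0 opprB addrC subrK.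
by rewrite divr_ge0 // prodr_ge0 // => i _; exact: ltW.
Qed.

Let Re_sum (x : 'I_N -> R[i]) j :
  complex.Re (\sum_(k < N) x k * ((X j - Y k)^-1)%:C) =
  \sum_(k < N) complex.Re (x k) / (X j - Y k).
Proof.
rewrite raddf_sum /=; apply: eq_bigr => k _.
by case: (x k) => a b /=; rewrite mulr0 subr0.
Qed.

Let Im_sum (x : 'I_N -> R[i]) j :
  complex.Im (\sum_(k < N) x k * ((X j - Y k)^-1)%:C) =
  \sum_(k < N) complex.Im (x k) / (X j - Y k).
Proof.
rewrite raddf_sum /=; apply: eq_bigr => k _.
by case: (x k) => a b /=; rewrite mulr0 add0r.
Qed.

Lemma cauchy_energy (x : 'I_N -> R[i]) :
  \sum_(j < N) A j * sqn (\sum_(k < N) x k * ((X j - Y k)^-1)%:C) =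
  \sum_(k < N) B k * sqn (x k).
Proof.
rewrite /sqn; under eq_bigr do rewrite Re_sum Im_sum mulrDr.
by under [RHS]eq_bigr do rewrite mulrDr; rewrite !big_split /= !energy_real.
Qed.

Lemma cauchy_energy_inv (x : 'I_N -> R[i]) :
  \sum_(j < N) A j / X j * sqn (\sum_(k < N) x k * ((X j - Y k)^-1)%:C) <=
  \sum_(k < N) B k / Y k * sqn (x k).
Proof.
rewrite /sqn; under eq_bigr do rewrite Re_sum Im_sum mulrDr.
under [leRHS]eq_bigr do rewrite mulrDr.
by rewrite !big_split /= lerD // energy0_real.
Qed.

(** Convexity of the square, with weights 1 - |z| and |z| on the points |g| / (1 - |z|) and |r|. *)
Lemma sqn_add_le (g z r : R[i]) : sqn z < 1 ->
  sqn (g + z * r) <= Normc.normc z * sqn r + sqn g / (1 - Normc.normc z).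
Proof.
have sqnN w : sqn w = Normc.normc w ^+ 2.
  by apply: complexI; rewrite sqnE rmorphXn.
have nn w : 0 <= Normc.normc w :> R by rewrite -ler0c; exact: (normr_ge0 w).
rewrite !sqnN; set s := Normc.normc z => s1'.
have s0 : 0 <= s by exact: nn.
have s1 : s < 1 by rewrite -(expr_lt1 (n := 2)).
have h : Normc.normc (g + z * r) <= Normc.normc g + s * Normc.normc r.
  by apply: le_trans (le_normcD _ _) _; rewrite Normc.normcM.
apply: le_trans (_ : (Normc.normc g + s * Normc.normc r) ^+ 2 <= _).
  by rewrite lerXn2r // nnegrE ?nn // addr_ge0 ?mulr_ge0.
move: (Normc.normc g) (Normc.normc r) => a b.
have d : 1 - s != 0 by rewrite subr_eq0 gt_eqF.
rewrite -subr_ge0.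
have -> : s * b ^+ 2 + a ^+ 2 / (1 - s) - (a + s * b) ^+ 2 =
    s / (1 - s) * ((1 - s) * b - a) ^+ 2 by field.
by rewrite mulr_ge0 ?sqr_ge0 // divr_ge0 // subr_ge0 ltW.
Qed.

(** With p and r the Cauchy transforms of x and of b x, the system reads a p = g + z r. Since |a|^2
    = X and |b|^2 = Y, the energy E of x equals the (A / X)-energy of a p, while that of r is at
    most E. Hence E <= |z| E + gamma / (1 - |z|), where the sum of the A / X is bounded by 1. *)
Lemma cauchy_system_bound (a b g x : 'I_N -> R[i]) (z : R[i]) (gamma : R) :
  0 <= gamma -> (forall j, 0 <= A j) -> sqn z < 1 ->
  (forall j, sqn (a j) = X j) -> (forall k, sqn (b k) = Y k) ->
  (forall j, sqn (g j) <= gamma) ->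
  (forall j, \sum_(k < N) (a j - z * b k) * ((X j - Y k)^-1)%:C * x k = g j) ->
  (1 - Normc.normc z) ^+ 2 * \sum_(k < N) B k * sqn (x k) <= gamma.
Proof.
move=> gamma0 A0 z1 aX bY gG Hx.
set s := Normc.normc z.
have s0 : 0 <= s by rewrite -ler0c; exact: (normr_ge0 z).
have s1 : s < 1.
  by rewrite -(expr_lt1 (n := 2)) // -ltcR rmorphXn /= -[s%:C]/`|z| -sqnE ltcR.
have s1' : 0 < 1 - s by rewrite subr_gt0.
pose p j := \sum_(k < N) x k * ((X j - Y k)^-1)%:C.
pose r j := \sum_(k < N) b k * x k * ((X j - Y k)^-1)%:C.
have pr j : a j * p j = g j + z * r j.
  rewrite -Hx /p /r !mulr_sumr -big_split /=; apply: eq_bigr => k _; ring.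
have h1 j : A j * sqn (p j) <= s * (A j / X j * sqn (r j)) + (A j / X j) * (gamma / (1 - s)).
  have Xj := X0 j; have -> : A j * sqn (p j) = A j / X j * sqn (a j * p j).
    by rewrite sqnM aX; field; rewrite gt_eqF.
  have -> : s * (A j / X j * sqn (r j)) + A j / X j * (gamma / (1 - s)) =
      A j / X j * (s * sqn (r j) + gamma / (1 - s)) by ring.
  rewrite pr; apply: ler_wpM2l; first by rewrite divr_ge0 ?(ltW Xj).
  apply: le_trans (sqn_add_le _ _ z1) _; rewrite lerD2l ler_wpM2r //.
  by rewrite invr_ge0 ltW.
have h2 := ler_sum (index_enum 'I_N) (P := xpredT) (fun j _ => h1 j).
rewrite cauchy_energy big_split /= -mulr_sumr -mulr_suml in h2.
have h3 := cauchy_energy_inv (fun k => b k * x k).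
have h4 : \sum_(k < N) B k / Y k * sqn (b k * x k) = \sum_(k < N) B k * sqn (x k).
  by apply: eq_bigr => k _; rewrite sqnM bY; field; rewrite gt_eqF.
rewrite h4 in h3.
have R0 : \sum_(j < N) A j / X j <= 1.
  by rewrite cauchy_weight_sum0 lerBlDr lerDl divr_ge0 // prodr_ge0 // => i _; exact: ltW.
set E := \sum_(k < N) B k * sqn (x k) in h2 h3 *.
have h5 : E <= s * E + gamma / (1 - s).
  apply: le_trans h2 _; rewrite lerD ?ler_wpM2l //.
  by rewrite ler_piMl // divr_ge0 // ltW.
have h6 : (1 - s) * E <= gamma / (1 - s) by lra.
by move: h6; rewrite ler_pdivlMr // mulrAC -expr2.
Qed.

End Cauchy.

(** * Power series *)

Section PowerSeries.
Variables (R : realType) (k r : R).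
Hypotheses (k0 : 0 <= k) (r0 : 0 <= r) (kr : k * r < 1).
Local Notation C := R[i].

Definition pseries_sum (c : nat -> C) (z : C) : C := tsum (fun n => c n * z ^+ n).

Let kr0 : 0 <= k * r. Proof. exact: mulr_ge0. Qed.

Let term_le (c : nat -> C) K (z : C) : (forall n, `|c n| <= (K * k ^+ n)%:C) ->
  `|z| <= r%:C -> forall n, `|c n * z ^+ n| <= (K * (k * r) ^+ n)%:C.
Proof.
move=> hc hz n; rewrite normrM normrX exprMn mulrA rmorphM /= rmorphXn /=.
have h : `|z| ^+ n <= r%:C ^+ n by rewrite lerXn2r // nnegrE // ler0c.
exact: (ler_pM _ (exprn_ge0 n (normr_ge0 z)) (hc n) h).
Qed.

Lemma hsum_pseries (c : nat -> C) K (z : C) : (forall n, `|c n| <= (K * k ^+ n)%:C) ->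
  `|z| <= r%:C -> hsum (fun n => c n * z ^+ n) (pseries_sum c z).
Proof.
move=> hc hz; apply/asummable_hsum/(asummable_dominated _ (term_le hc hz)).
exact/asummableZ/asummable_geometric.
Qed.

Let hG : hsum (fun n : nat => (k * r) ^+ n) (tsum (fun n : nat => (k * r) ^+ n)).
Proof. exact/asummable_hsumR/asummable_geometric. Qed.

Lemma pseries_sum_le (c : nat -> C) K (z : C) : (forall n, `|c n| <= (K * k ^+ n)%:C) ->
  `|z| <= r%:C -> `|pseries_sum c z| <= (K * tsum (fun n : nat => (k * r) ^+ n))%:C.
Proof.
move=> hc hz.
exact: hsum_le_hsum (hsum_pseries hc hz) (hsum_RtoC (hsumZ K hG)) (term_le hc hz).
Qed.

(** The coefficients in w of (f(w) - f(z)) / (w - z), as given by Horner's scheme. *)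
Definition synthetic_quotient (c : nat -> C) (z : C) (i : nat) : C :=
  pseries_sum (fun n => c (i + n).+1) z.

Let shifted_le (c : nat -> C) K i : (forall n, `|c n| <= (K * k ^+ n)%:C) ->
  forall n, `|c (i + n).+1| <= (K * k ^+ i.+1 * k ^+ n)%:C.
Proof. by move=> hc n; rewrite -mulrA -exprD addSn. Qed.

Lemma synthetic_quotient_le (c : nat -> C) K (z : C) : (forall n, `|c n| <= (K * k ^+ n)%:C) ->
  `|z| <= r%:C -> forall i, `|synthetic_quotient c z i| <=
    (K * k * tsum (fun n : nat => (k * r) ^+ n) * k ^+ i)%:C.
Proof.
move=> hc hz i; apply: le_trans (pseries_sum_le (shifted_le i hc) hz) _.
by rewrite lecR le_eqVlt; apply/orP; left; apply/eqP; rewrite exprS; ring.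
Qed.

Lemma pseries_sum_sub (c : nat -> C) K (z w : C) : (forall n, `|c n| <= (K * k ^+ n)%:C) ->
  `|z| <= r%:C -> `|w| <= r%:C ->
  pseries_sum c w - pseries_sum c z = (w - z) * pseries_sum (synthetic_quotient c z) w.
Proof.
move=> hc hz hw; set c' := synthetic_quotient c z.
have rec i : c' i = c i.+1 + z * c' i.+1.
  have h := hsum_nat_tail (hsum_pseries (shifted_le i hc) hz).
  have h' := hsumZ z (hsum_pseries (shifted_le i.+1 hc) hz).
  have : pseries_sum (fun n => c (i + n).+1) z - c (i + 0).+1 * z ^+ 0 = z * c' i.+1.
    apply: hsum_unique h _; apply: eq_hsum h' => n.
    by rewrite exprS addnS addSn; ring.
  rewrite expr0 mulr1 addn0 -/(synthetic_quotient c z i) -/c' => H.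
  by rewrite -H addrC subrK.
have rec0 : pseries_sum c z = c 0%N + z * c' 0%N.
  have h := hsum_nat_tail (hsum_pseries hc hz).
  have h' := hsumZ z (hsum_pseries (shifted_le 0 hc) hz).
  have : pseries_sum c z - c 0%N * z ^+ 0 = z * c' 0%N.
    apply: hsum_unique h _; apply: eq_hsum h' => n.
    by rewrite exprS add0n; ring.
  by rewrite expr0 mulr1 => H; rewrite -H addrC subrK.
have hc' := synthetic_quotient_le hc hz.
have h1 := hsum_pseries hc' hw.
have h2 := hsum_nat_tail h1.
have h3 := hsum_nat_tail (hsum_pseries hc hw).
have h4 := hsumB (hsumZ w h1) (hsumZ z h2).
have : pseries_sum c w - c 0%N * w ^+ 0 =
    w * pseries_sum c' w - z * (pseries_sum c' w - c' 0%N * w ^+ 0).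
  apply: hsum_unique h3 _; apply: eq_hsum h4 => n.
  rewrite -/c' [in X in w * X](rec n) exprS; ring.
rewrite !expr0 !mulr1 rec0 => H.
by rewrite opprD addrA H; ring.
Qed.

End PowerSeries.

Section Derivative.

Lemma difference_quotient_close (K : numFieldType) (x y a b b' t e M : K) :
  t != 0 -> x - y = t * a -> a - b = t * b' -> `|b'| <= M ->
  `|t| < e / (M + 1) -> `|b - t^-1 * (x - y)| < e.
Proof.
move=> t0 -> ab bM; have M0 : 0 <= M := le_trans (normr_ge0 _) bM.
rewrite ltr_pdivlMr ?ltr_wpDl // => te; rewrite mulKf // distrC ab normrM.
apply: le_lt_trans te; rewrite ler_wpM2l // (le_trans bM) // lerDl //.
Qed.

Local Opaque pseries_sum.

(** Two divisions: f(w) - f(z) = (w - z) g(w), then g(w) - g(z) = (w - z) h(w) with h bounded on the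
    disc. The derivative is g(z), and the difference quotient is within a multiple of |w - z| of
    it. *)
Lemma derivable_pseries_sum (R : realType) (k r : R) (c : nat -> R[i]) K z :
  0 <= k -> 0 <= r -> k * r < 1 -> (forall n, `|c n| <= (K * k ^+ n)%:C) ->
  `|z| < r%:C -> derivable (pseries_sum c : R[i]^o -> R[i]^o) z 1.
Proof.
move=> k0 r0 kr hc hz.
have hz' := ltW hz.
have hc' := synthetic_quotient_le k0 r0 kr hc hz'.
have hc'' := synthetic_quotient_le k0 r0 kr hc' hz'.
set c' := synthetic_quotient c z in hc' hc''.
set c'' := synthetic_quotient c' z in hc''.
set B := (_ * tsum _) in hc''.
have bnd w : `|w| <= r%:C -> `|pseries_sum c'' w| <= (B * tsum (fun n : nat => (k * r) ^+ n))%:C.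
  by move=> hw; apply: pseries_sum_le.
set M := B * _ in bnd.
apply/cvg_ex; exists (pseries_sum c' z).
apply/cvgrPdist_lt => e e0.
have M0 : 0 <= M%:C := le_trans (normr_ge0 _) (bnd z hz').
have M1 : 0 < M%:C + 1 by rewrite ltr_wpDl.
have d0 : 0 < e / (M%:C + 1) by rewrite divr_gt0.
have rz : 0 < r%:C - `|z| by rewrite subr_gt0.
near=> t.
have t0 : t != 0 by near: t; exact: nbhs_dnbhs_neq.
have t1 : `|t| < r%:C - `|z|.
  by near: t; apply: dnbhs0_lt.
have t2 : `|t| < e / (M%:C + 1) by near: t; apply: dnbhs0_lt.
have hw : `|t + z| <= r%:C.
  by apply: le_trans (ler_normD _ _) _; rewrite -lerBrDr ltW.
have E1 := pseries_sum_sub k0 r0 kr hc hz' hw.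
have E2 := pseries_sum_sub k0 r0 kr hc' hz' hw.
rewrite /= (_ : t *: (1 : R[i]^o) = t); last by rewrite /GRing.scale /= mulr1.
have K1 := etrans E1 (congr1 (fun s => s * pseries_sum c' (t + z)) (addrK z t)).
have K2 := etrans E2 (congr1 (fun s => s * pseries_sum c'' (t + z)) (addrK z t)).
exact: (difference_quotient_close t0 K1 K2 (bnd _ hw) t2).
Unshelve. all: by end_near.
Qed.

End Derivative.

Lemma expi_norm (R : realType) (t : R) : `|expi t| = 1.
Proof. by rewrite normc_def /= cos2Dsin2 sqrtr1. Qed.

Lemma expi_mulrn (R : realType) (t : R) n : expi (n%:R * t) = expi t ^+ n.
Proof.
elim: n => [|n IH]; first by rewrite mul0r /expi cos0 sin0 expr0.
rewrite exprS -IH -natr1 mulrDl mul1r /expi cosD sinD.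
by apply/eqP; rewrite eq_complex /=; apply/andP; split; apply/eqP; ring.
Qed.

(** * The Cauchy system with geometric nodes *)

Section GeometricSystem.
Variables (R : realType) (q : R) (u : R[i]).
Hypotheses (q0 : 0 < q) (q1 : q < 1) (u1 : `|u| = 1).
Local Notation C := R[i].
Variable N : nat.

Let X (j : 'I_N) : R := q ^+ (4 * j + 2).
Let Y (k : 'I_N) : R := q ^+ (4 * k + 4).
Let w : C := q%:C * u.

Let pow_lt m n : (m < n)%N -> q ^+ n < q ^+ m.
Proof. by move=> mn; rewrite ltr_iXn2l. Qed.

Let pow_inj m n : q ^+ m = q ^+ n -> m = n.
Proof.
by move=> h; case: (ltngtP m n) => // /pow_lt; rewrite h ltxx.
Qed.

Let injX : injective X.
Proof. by move=> i j /pow_inj h; apply: val_inj => /=; arith. Qed.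

Let injY : injective Y.
Proof. by move=> i j /pow_inj h; apply: val_inj => /=; arith. Qed.

Let XY j k : X j != Y k.
Proof. by apply/eqP => /pow_inj; arith. Qed.

Let X0 j : 0 < X j. Proof. exact: exprn_gt0. Qed.
Let Y0 k : 0 < Y k. Proof. exact: exprn_gt0. Qed.

Local Notation A := (cauchy_weight X Y).
Local Notation B := (cauchy_coef X Y).

(** In [A j], the factor k = j is kept apart and the factors with k > j are at least 1. Those with k
    < j, listed backwards from j - 1, are q^2 times the successive factors of [qprod]. *)
Lemma cauchy_weight_ge (j : 'I_N) :
  (X j - Y j) * (q ^+ (2 * j) * qprod q j) <= A j.
Proof.
pose f (k : 'I_N) := (X j - Y k) / (X j - X k).
have XYj : 0 < X j - Y j by rewrite subr_gt0 pow_lt //; arith.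
have -> : A j = (X j - Y j) * \prod_(k < N | k != j) f k.
  by rewrite /A (bigD1 j) //= -mulrA -prodf_div.
rewrite ler_pM2l //.
pose g (k : nat) := q ^+ 2 * ((1 - q ^+ (4 * (j.-1 - k) + 2)) / (1 - q ^+ (4 * (j.-1 - k) + 4))).
have d n : 0 < 1 - q ^+ n.+1 by rewrite subr_gt0 exprn_ilt1 ?(ltW q0).
have g0 k : 0 <= g k.
  by rewrite /g addn2 addn4 mulr_ge0 ?sqr_ge0 // divr_ge0 // ltW.
have fg (k : 'I_N) : (k < j)%N -> f k = g k.
  move=> kj; rewrite /f /g /X /Y.
  have [m jm] : exists m, (j = k + m.+1 :> nat)%N by exists (j - k).-1; arith.
  rewrite jm (_ : ((k + m.+1).-1 - k)%N = m); last by arith.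
  rewrite (_ : (4 * (k + m.+1) + 2 = 4 * k + 4 + (4 * m + 2))%N); last by arith.
  rewrite (_ : (4 * k + 4 + (4 * m + 2))%N = (4 * k + 2 + (4 * m + 4))%N); last by arith.
  have e1 : q ^+ (4 * k + 2 + (4 * m + 4)) = q ^+ (4 * k + 2) * q ^+ (4 * m + 4) by rewrite -exprD.
  have e2 : q ^+ (4 * k + 4) = q ^+ (4 * k + 2) * q ^+ 2 by rewrite -exprD -addnA.
  have e3 : q ^+ (4 * m + 4) = q ^+ (4 * m + 2) * q ^+ 2 by rewrite -exprD -addnA.
  have := d (4 * m + 3)%N; rewrite -addnS e1 e2 e3.
  have x0 : q ^+ (4 * k + 2) != 0 by rewrite gt_eqF // exprn_gt0.
  move: (q ^+ (4 * k + 2)) x0 => x x0; move: (q ^+ (4 * m + 2)) => y dy.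
  have dy' : y * q ^+ 2 - 1 != 0 by rewrite -oppr_eq0 opprB gt_eqF.
  have dz : x * (y * q ^+ 2) - x != 0.
    by rewrite -[X in _ - X]mulr1 -mulrBr mulf_neq0.
  by field; rewrite ?dz ?dy' ?(gt_eqF dy).
have -> : q ^+ (2 * j) * qprod q j = \prod_(k < N | (k < j)%N) g k.
  rewrite -(big_ord_widen N g (ltnW (ltn_ord j))) (reindex_inj rev_ord_inj) /=.
  rewrite /qprod exprM -{1}(card_ord j) -prodr_const -big_split /=.
  apply: eq_bigr => i _; rewrite /g (_ : (j.-1 - (j - i.+1))%N = i) //.
  by have := ltn_ord i; arith.
rewrite big_mkcond [leRHS]big_mkcond; apply: ler_prod => k _.
have [kj|jk] := ltnP k j.
  have kj' : k != j by apply: contraTneq kj => ->; rewrite ltnn.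
  by rewrite kj' fg // g0 lexx.
rewrite ler01 /=; case: eqP => //= kj.
have kj' : (j < k)%N by rewrite ltn_neqAle jk andbT; apply/eqP => h; apply: kj; exact: val_inj.
have XX : 0 < X j - X k by rewrite subr_gt0 pow_lt //; arith.
rewrite /f ler_pdivlMr // mul1r lerD2l lerN2.
by apply: ler_wiXn2l; [exact: ltW..|arith].
Qed.

Let A_gt0 j : 0 < A j.
Proof.
apply: lt_le_trans (cauchy_weight_ge j).
have [c c0 hc] := qprod_lower q0 q1.
rewrite !mulr_gt0 ?exprn_gt0 //; first by rewrite subr_gt0 pow_lt //; arith.
exact: lt_le_trans (hc _).
Qed.

Let B_ge k : A k / (X k - Y k) ^+ 2 <= B k.
Proof.
rewrite /B (bigD1 k) //= lerDl; apply: sumr_ge0 => j _.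
by rewrite divr_ge0 ?sqr_ge0 // ltW.
Qed.

Variable z : C.
Hypothesis z1 : `|z| < 1.

Let sqn_z : sqn z < 1.
Proof. by rewrite -ltcR sqnE exprn_ilt1. Qed.

Let sqn_w n : sqn (w ^+ n) = q ^+ (2 * n).
Proof.
apply: complexI; rewrite sqnE /w exprMn !normrM !normrX u1 expr1n mulr1.
by rewrite normcR gtr0_norm // -rmorphXn -rmorphXn /= -exprM mulnC.
Qed.

Definition geometric_entry (j k : nat) : C :=
  (w ^+ (2 * j + 1) - z * w ^+ (2 * k + 2)) / (q ^+ (4 * j + 2) - q ^+ (4 * k + 4))%:C.

Let system_bound (g x : 'I_N -> C) gamma : 0 <= gamma ->
  (forall j, sqn (g j) <= gamma) ->
  (forall j : 'I_N, \sum_(k < N) geometric_entry j k * x k = g j) ->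
  (1 - Normc.normc z) ^+ 2 * \sum_(k < N) B k * sqn (x k) <= gamma.
Proof.
move=> gamma0 hg Hx.
apply: (@cauchy_system_bound _ _ X Y injX injY XY X0 Y0
  (fun j => w ^+ (2 * j + 1)) (fun k => w ^+ (2 * k + 2)) g) => //.
- by move=> j; exact: ltW.
- by move=> j; rewrite sqn_w /X; congr (_ ^+ _); arith.
- by move=> k; rewrite sqn_w /Y; congr (_ ^+ _); arith.
- by move=> j; rewrite -Hx; apply: eq_bigr => k _; rewrite /geometric_entry fmorphV.
Qed.

Let nz1 : 0 < 1 - Normc.normc z.
Proof. by rewrite subr_gt0 -ltcR. Qed.

(** For a solution of the homogeneous system, [system_bound] with gamma = 0 makes the energy vanish,
    and all its coefficients [B] are positive. *)
Lemma geometric_unitmx : (\matrix_(j < N, k < N) geometric_entry j k) \in unitmx.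
Proof.
rewrite unitmxE unitfE; apply/negP => /eqP D0.
have : \det (\matrix_(j < N, k < N) geometric_entry j k)^T == 0 by rewrite det_tr D0.
move/det0P => [v v0 hv].
have Hv (j : 'I_N) : \sum_(k < N) geometric_entry j k * v 0 k = 0.
  have := congr1 (fun m : 'rV[C]_N => m 0 j) hv; rewrite !mxE => h.
  by rewrite -[RHS]h; apply: eq_bigr => k _; rewrite !mxE mulrC.
have := @system_bound (fun=> 0) (fun k => v 0 k) 0 (lexx 0) _ Hv.
move=> /(_ (fun=> _)) h.
case/negP: v0; apply/eqP/rowP => k; rewrite mxE.
have : (1 - Normc.normc z) ^+ 2 * \sum_(k < N) B k * sqn (v 0 k) <= 0.
  by apply: h; rewrite /sqn /= expr0n addr0.
rewrite pmulr_rle0 ?exprn_gt0 // => hs.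
have B0 i : 0 < B i.
  by apply: lt_le_trans (B_ge i); rewrite divr_gt0 // exprn_even_gt0 //= subr_eq0.
have : \sum_(k < N) B k * sqn (v 0 k) = 0.
  by apply/eqP; rewrite eq_le hs sumr_ge0 // => i _; rewrite mulr_ge0 ?sqn_ge0 // ltW.
move/eqP; rewrite psumr_eq0 => [|i _]; last by rewrite mulr_ge0 ?sqn_ge0 // ltW.
move/allP => /(_ k (mem_index_enum k)) /=.
rewrite mulf_eq0 gt_eqF //= => /eqP sv.
by apply/eqP; rewrite -normr_eq0 -sqrf_eq0 -sqnE sv.
Qed.

(** The diagonal term alone gives B_k >= A_k / (X_k - Y_k)^2 >= c q^(- 2 k), while the energy of the
    solution is at most (1 - |z|)^(-2). Neither bound depends on [N]. *)
Lemma geometric_solution_decay (c : R) (x : 'I_N -> C) :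
  0 < c -> (forall n, c <= qprod q n) ->
  (forall j : 'I_N, \sum_(k < N) geometric_entry j k * x k = 1) ->
  forall k, `|x k| <= ((Num.sqrt c)^-1 / (1 - Normc.normc z) * q ^+ k)%:C.
Proof.
move=> c0 hc Hx k.
have hg (j : 'I_N) : sqn (1 : C) <= 1 by rewrite sqn_norm1 ?normr1.
have h := system_bound ler01 hg Hx.
have sc : 0 < Num.sqrt c by rewrite sqrtr_gt0.
rewrite norm_le_sqn; last first.
  by rewrite mulr_ge0 ?divr_ge0 ?invr_ge0 ?exprn_ge0 ?(ltW sc) ?(ltW nz1) ?(ltW q0).
have XYk : 0 < X k - Y k by rewrite subr_gt0 pow_lt //; arith.
have h2 : B k * sqn (x k) <= \sum_(k < N) B k * sqn (x k).
  rewrite [leRHS](bigD1 k) //= lerDl; apply: sumr_ge0 => i _.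
  rewrite mulr_ge0 ?sqn_ge0 // (le_trans _ (B_ge i)) // divr_ge0 ?sqr_ge0 //.
  exact: ltW.
have h3 : q ^+ (2 * k) * c / (X k - Y k) <= B k.
  apply: le_trans (B_ge k).
  rewrite expr2 invfM mulrA ler_wpM2r ?invr_ge0 ?(ltW XYk) //.
  rewrite ler_pdivlMr // mulrC; apply: le_trans (cauchy_weight_ge k).
  by rewrite ler_pM2l // ler_pM2l ?exprn_gt0.
have h4 : (1 - Normc.normc z) ^+ 2 * (q ^+ (2 * k) * c / (X k - Y k) * sqn (x k)) <= 1.
  apply: le_trans h; rewrite ler_wpM2l ?sqr_ge0 //; apply: le_trans h2.
  by rewrite ler_wpM2r ?sqn_ge0.
have h5 : X k - Y k <= q ^+ (4 * k).
  rewrite lerBlDr; apply: le_trans (_ : q ^+ (4 * k) <= _).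
    by apply: ler_wiXn2l; [exact: ltW..|arith].
  by rewrite lerDl ltW.
have h6 : (1 - Normc.normc z) ^+ 2 * (c * sqn (x k)) <= q ^+ (2 * k).
  rewrite -(ler_pM2l (exprn_gt0 (2 * k) q0)) -exprD (_ : (2 * k + 2 * k = 4 * k)%N); last by arith.
  apply: le_trans h5; rewrite -[leRHS]mul1r -ler_pdivrMr //.
  by apply: le_trans h4; rewrite le_eqVlt; apply/orP; left; apply/eqP; ring.
rewrite !exprMn exprVn sqr_sqrtr ?(ltW c0) // -exprM [(k * 2)%N]mulnC exprVn.
rewrite -(ler_pM2l c0) -(ler_pM2l (exprn_gt0 2 nz1)); apply: le_trans h6 _.
rewrite le_eqVlt; apply/orP; left; apply/eqP; field.
by rewrite !gt_eqF.
Qed.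

End GeometricSystem.

(** * The limit of the finite systems *)

Lemma expr_eventually_small (R : realType) (r e : R) : 0 <= r -> r < 1 -> 0 < e ->
  exists N0, forall n, (N0 <= n)%N -> r ^+ n < e.
Proof.
move=> r0 r1 e0.
have /cvg_expr/cvgrPdist_lt/(_ e e0)[N _ HN] : `|r| < 1 by rewrite ger0_norm.
exists N => n /HN; rewrite /= sub0r normrN ger0_norm // exprn_ge0 //.
Qed.

Section GeometricLimit.
Variables (R : realType) (q : R) (u : R[i]).
Hypotheses (q0 : 0 < q) (q1 : q < 1) (u1 : `|u| = 1).
Local Notation C := R[i].
Local Notation tC l := ((kerT q l)%:C : C).
Local Notation gU := (kerU q u).

Let u0 : u != 0. Proof. by rewrite -normr_eq0 u1 oner_eq0. Qed.
Let q_neq0 : q != 0. Proof. by rewrite gt_eqF. Qed.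

Let unitX n : `|u ^+ n| = 1. Proof. by rewrite normrX u1 expr1n. Qed.

(** The row factor that makes the matrix Toeplitz. The right-hand side of the original system being
    1, it is also the new right-hand side. *)
Let source (j : nat) : C := (q ^+ (2 * j + 1))%:C * (u ^+ (2 * j + 1))^-1.

Lemma geometric_entryE z j k : source j * geometric_entry q u z j k =
  tC (k%:Z - j%:Z) - z * gU (k%:Z - j%:Z).
Proof.
set l := k%:Z - j%:Z.
have ho : oddpow q l * q ^+ (2 * j + 1) = q ^+ (2 * k + 2).
  by rewrite /oddpow !exprnP -expfzDr //; congr (_ ^ _); rewrite /l; arith.
have hu : u ^ (2 * l + 1) * u ^+ (2 * j + 1) = u ^+ (2 * k + 2).
  by rewrite !exprnP -expfzDr //; congr (_ ^ _); rewrite /l; arith.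
have d := oddpow_sqr_neq1 q0 q1 l.
rewrite /source /geometric_entry /kerU /kerS /half_csch /kerT !exprMn -!rmorphXn /=.
rewrite (_ : (4 * j + 2 = (2 * j + 1) * 2)%N); last by arith.
rewrite (_ : (4 * k + 4 = (2 * k + 2) * 2)%N); last by arith.
rewrite ![q ^+ (_ * 2)]exprM -ho -hu.
have x0 : q ^+ (2 * j + 1) != 0 by rewrite expf_neq0.
have a0 : u ^+ (2 * j + 1) != 0 by rewrite expf_neq0.
move: (oddpow q l) (q ^+ (2 * j + 1)) (u ^ _) (u ^+ (2 * j + 1)) d x0 a0 => o x v a d x0 a0.
have x0' : x%:C != 0 :> C by rewrite (inj_eq (@complexI R) x 0).
have d' : 1 - o%:C ^+ 2 != 0 :> C.
  rewrite -rmorphXn -(rmorph1 (real_complex R)) -rmorphB /=.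
  by rewrite (inj_eq (@complexI R) _ 0).
rewrite !(fmorphV, rmorphM, rmorphB, rmorphXn, rmorph1) /=.
move: (x%:C) (o%:C) x0' d' => x' o' x0' d'.
have d2 : x' ^+ 2 - (o' * x') ^+ 2 != 0.
  by rewrite exprMn -[X in X - _]mul1r -mulrBl mulf_neq0 // expf_neq0.
by field; rewrite d' a0 d2.
Qed.

Let row_decay : exists2 K, 0 <= K & forall (z : C) (k m : nat), `|z| <= 1 ->
  `|tC (k%:Z - (k + m.+1)%N%:Z) - z * gU (k%:Z - (k + m.+1)%N%:Z)| <= (K * q ^+ (2 * m.+1))%:C.
Proof.
have [K K0 HK] := kerS_decay q0 q1.
exists (K + K) => [|z k m z1]; first exact: addr_ge0.
have -> : k%:Z - (k + m.+1)%N%:Z = Negz m by arith.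
have hS : `|kerS q (Negz m)| <= K * q ^+ (2 * m.+1) by exact: HK.
have hT : `|kerT q (Negz m)| <= K * q ^+ (2 * m.+1).
  have op : 0 < oddpow q (Negz m) by exact: oddpow_gt0.
  have : `|kerS q (Negz m)| = oddpow q (Negz m) * `|kerT q (Negz m)|.
    by rewrite kerSE normrM gtr0_norm.
  have : 1 <= oddpow q (Negz m).
    rewrite oddpow_Negz // invf_ge1 ?exprn_gt0 // exprn_ile1 //; exact: ltW.
  move: (normr_ge0 (kerT q (Negz m))) hS => h1 h2 h3 h4.
  by apply: le_trans h2; rewrite h4 ler_peMl.
apply: le_trans (ler_normB _ _) _; rewrite mulrDl rmorphD /= lerD //.
  by rewrite normcR lecR.
rewrite normrM; apply: le_trans (_ : 1 * `|gU (Negz m)| <= _).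
  by rewrite ler_wpM2r.
by rewrite mul1r /kerU normrM normr_unit_exprz // mul1r normcR lecR.
Qed.

Lemma geometric_limit : exists (c : nat -> C) (K kappa : R),
  [/\ 0 <= kappa, kappa < 1, forall n, `|c n| <= (K * kappa ^+ n)%:C &
   forall z : C, `|z| < 1 -> forall e : R, 0 < e -> exists N0, forall N, (N0 <= N)%N ->
     forall x : 'I_N -> C,
     (forall j : 'I_N, \sum_(k < N) geometric_entry q u z j k * x k = 1) ->
     `|\sum_(k < N) x k - pseries_sum c z| < e%:C].
Proof.
have [sigma sigma0 hsigma] := hsum_SkerN q0 q1.
(* Half of the decay is set aside: for j >= N one has q^j <= r^N r^j. The defect of the rows beyond
   N still decays at rate r, while its size is O(r^N). *)
set r := Num.sqrt q.
have r0 : 0 < r by rewrite sqrtr_gt0.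
have r2 : r ^+ 2 = q by rewrite sqr_sqrtr // ltW.
have r1 : r < 1 by rewrite -(expr_lt1 (n := 2)) ?r2 // ltW.
have qr : q <= r by rewrite -r2 expr2 ler_piMl // ltW.
have [K K0 [HK Hexp]] := toeplitz_expansion q0 q1 u1 sigma0 hsigma qr r1.
have qj j : q ^+ j <= r ^+ j.
  by rewrite lerXn2r // nnegrE; exact: ltW.
have norm_source j : `|source j| = (q ^+ (2 * j + 1))%:C.
  by rewrite normrM normfV unitX invr1 mulr1 normcR ger0_norm // exprn_ge0 // ltW.
have source_le j : `|source j| <= (1 * r ^+ j)%:C.
  rewrite norm_source lecR mul1r; apply: le_trans (qj j).
  by apply: ler_wiXn2l; [exact: ltW..|arith].
exists (fun n => Lam q u sigma n source).
exists (1 * K), (kerS_norm_const q / kerS_toeplitz_const q).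
split; [exact: kappa_ge0|exact: kappa_lt1|by move=> n; exact: HK|].
move=> z z1 e e0.
have [c c0 hc] := qprod_lower q0 q1.
have [K1 K10 HK1] := row_decay.
set D := (Num.sqrt c)^-1 / (1 - Normc.normc z).
have nz1 : 0 < 1 - Normc.normc z by rewrite subr_gt0 -ltcR.
have D0 : 0 <= D by rewrite divr_ge0 ?invr_ge0 ?sqrtr_ge0 // ltW.
set F := K1 * D * (1 - q)^-1 + 1.
have F0 : 0 <= F.
  apply: addr_ge0 => //; apply: mulr_ge0; first exact: mulr_ge0.
  by rewrite invr_ge0 subr_ge0 ltW.
have FK1 : 0 < F * K + 1 by rewrite ltr_wpDl // mulr_ge0.
have [N0 HN0] := expr_eventually_small (ltW r0) r1 (divr_gt0 e0 FK1).
exists N0 => N /HN0 rN x Hx.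
have xk := geometric_solution_decay q0 q1 u1 z1 c0 hc Hx.
(* The finite solution is inserted in all rows of the infinite system. Only the rows j >= N, which
   the finite system does not contain, have a defect. *)
pose T (j : nat) : C := \sum_(k < N) (tC (k%:Z - j%:Z) - z * gU (k%:Z - j%:Z)) * x k.
have TE (j : 'I_N) : T j = source j.
  rewrite -[RHS]mulr1 -(Hx j) mulr_sumr; apply: eq_bigr => k _.
  by rewrite mulrA geometric_entryE.
have T_le (j : nat) : (N <= j)%N -> `|T j| <= (K1 * D * (1 - q)^-1 * q ^+ j)%:C.
  move=> Nj; apply: le_trans (ler_norm_sum _ _ _) _.
  apply: le_trans (_ : \sum_(k < N) (K1 * D * q ^+ j * q ^+ (N - k.+1))%:C <= _).
    apply: ler_sum => k _; have kN := ltn_ord k.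
    have [m jm] : exists m, (j = k + m.+1)%N by exists (j - k.+1)%N; move: Nj kN; clear; lia.
    rewrite normrM jm; apply: le_trans (ler_pM _ _ (HK1 z k m (ltW z1)) (xk k)) _ => //.
    (* With m + 1 = j - k, the exponent k + 2 (m + 1) equals j + (j - k), which is at least j + (N -
       k - 1). *)
    rewrite -rmorphM /= lecR -/D mulrACA -[leRHS]mulrA -!exprD.
    apply: ler_wpM2l; first exact: mulr_ge0.
    by apply: ler_wiXn2l; [exact: ltW..|move: Nj kN; rewrite jm; clear; lia].
  rewrite -rmorph_sum /= lecR -mulr_sumr [leRHS]mulrAC; apply: ler_wpM2l.
    by apply: mulr_ge0; [exact: mulr_ge0|rewrite exprn_ge0 // ltW].
  rewrite (reindex_inj rev_ord_inj) /=.
  under eq_bigr => i _ do rewrite subnSK // subKn ?(ltnW (ltn_ord i)) //.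
  exact: geometric_partial_le (ltW q0) q1.
pose err (j : nat) : C := if (j < N)%N then 0 else T j - source j.
have err_le j : `|err j| <= (F * r ^+ N * r ^+ j)%:C.
  rewrite /err; case: ltnP => [_|Nj].
    by rewrite normr0 ler0c !mulr_ge0 // exprn_ge0 // ltW.
  apply: le_trans (ler_normB _ _) _.
  apply: le_trans (_ : (F * q ^+ j)%:C <= _); last first.
    rewrite lecR -mulrA ler_wpM2l // -r2 -exprM -exprD.
    by apply: ler_wiXn2l; [exact: ltW..|move: Nj; clear; lia].
  rewrite /F mulrDl mul1r rmorphD /= lerD ?T_le // norm_source lecR.
  by apply: ler_wiXn2l; [exact: ltW..|clear; lia].
have HT (j : nat) : T j = source j + err j.
  rewrite /err; case: ltnP => [jN|_]; last by rewrite addrC subrK.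
  by rewrite addr0; exact: (TE (Ordinal jN)).
have [s hs Hs] := Hexp z N x source err 1 (F * r ^+ N) (ltW z1) source_le err_le HT.
have -> : pseries_sum (fun n => Lam q u sigma n source) z = s.
  by apply: hsum_tsumE; apply: eq_hsum hs => n; exact: mulrC.
apply: le_lt_trans Hs _; rewrite ltcR mulrAC.
move: rN; rewrite ltr_pdivlMr // => rN; apply: le_lt_trans rN.
by rewrite mulrC ler_wpM2l ?exprn_ge0 ?(ltW r0) // lerDl.
Qed.

End GeometricLimit.

Theorem theorem4 (R : realType) (h theta : R) (s psi : nat -> R)
    (h_gt0 : 0 < h)
    (sE : forall r : nat, (1 <= r)%N -> s r = expR (- (r%:R * h)))
    (psiE : forall r : nat, (1 <= r)%N -> psi r = r%:R * theta * h) :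
  exists2 rho : R, 0 < rho &
    forall u : R -> R[i], torusT s u -> has_angles s psi u ->
      holomorphic_bounded_in_disc u (1 + rho).
Proof.
set q := expR (- h); set v : R[i] := expi (theta * h).
have q0 : 0 < q := expR_gt0 _.
have q1 : q < 1 by rewrite expR_lt1 oppr_lt0.
have v1 : `|v| = 1 := expi_norm _.
have [c [K [kappa [kappa0 kappa1 hc Hlim]]]] := geometric_limit q0 q1 v1.
(* For r = 1 + (1 - kappa) / 2 one has kappa r = 1 - (1 - kappa) (1 - kappa / 2), which is less than
   1. *)
have rho0 : 0 < (1 - kappa) / 2 by rewrite divr_gt0 // subr_gt0.
exists ((1 - kappa) / 2) => // u _ hu.
set r := 1 + (1 - kappa) / 2.
have r0 : 0 <= r by rewrite addr_ge0 // ltW.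
have kr : kappa * r < 1.
  have := mulr_ge0 kappa0 (ltW rho0); rewrite /r; nra.
exists (pseries_sum c); split.
- move=> z hz; have z1 : `|z| < 1 := hz.
  (* Both values are limits of the same finite sums, which are compared at a common index [N]. *)
  apply/eqP; rewrite -subr_eq0; apply/eqP/norm_lt_eps_eq0 => e e0.
  have eE : e = (complex.Re e)%:C by rewrite RRe_real // gtr0_real.
  have e1 : 0 < complex.Re e / 2 by rewrite divr_gt0 // -ltcR -eE.
  have e2 : 0 < (complex.Re e / 2)%:C by rewrite ltcR.
  have [N0 HN0] := Hlim z z1 _ e1.
  have /cvgrPdist_lt/(_ _ e2)[N1 _ HN1] := hu z z1.
  set N := maxn N0 N1.
  (* Here s_n e^(i psi_n) = (q v)^n: amplitudes and phases form a single geometric progression. *)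
  have E : matC s psi N z = \matrix_(j < N, k < N) geometric_entry q v z j k.
    have sq n : (0 < n)%N -> s n = q ^+ n.
      by move=> n0; rewrite sE // -mulrN expRM_natl.
    have sp n : (0 < n)%N -> (s n)%:C * expi (psi n) = (q%:C * v) ^+ n.
      by move=> n0; rewrite sq // psiE // -mulrA expi_mulrn exprMn -rmorphXn.
    apply/matrixP => j k; rewrite !mxE /geometric_entry.
    have j1 : (0 < 2 * j + 1)%N by rewrite addn1.
    have k1 : (0 < 2 * k + 2)%N by rewrite addn2.
    rewrite (sp _ j1) (sp _ k1) (sq _ j1) (sq _ k1) -!exprM.
    rewrite (_ : ((2 * j + 1) * 2 = 4 * j + 2)%N); last by clear; lia.
    by rewrite (_ : ((2 * k + 2) * 2 = 4 * k + 4)%N) //; clear; lia.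
  pose x (j : 'I_N) := (invmx (matC s psi N z) *m (const_mx 1 : 'cV[R[i]]_N)) j 0.
  have Hx (j : 'I_N) : \sum_(k < N) geometric_entry q v z j k * x k = 1.
    have := mulKVmx (geometric_unitmx q0 q1 v1 N z1)
      (const_mx 1 : 'cV[R[i]]_N).
    move/(congr1 (fun m : 'cV[R[i]]_N => m j 0)); rewrite mxE [RHS]mxE => <-.
    by apply: eq_bigr => k _; rewrite /x E; congr (_ * _); rewrite mxE.
  have h1 := HN0 N (leq_maxl _ _) x Hx.
  have h2 := HN1 N (leq_maxr _ _).
  rewrite eE [complex.Re e]splitr rmorphD /=.
  have -> : pseries_sum c z - disc_value u z =
      (invC_one_one s psi N z - disc_value u z) - (\sum_(k < N) x k - pseries_sum c z).
    have key (a b d : R[i]) : a - b = (d - b) - (d - a) by ring.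
    exact: key.
  apply: le_lt_trans (ler_normB _ _) _; rewrite ltrD //.
  by rewrite distrC.
- by move=> z hz; exact: (derivable_pseries_sum kappa0 r0 kr hc hz).
- exists (K * tsum (fun n : nat => (kappa * r) ^+ n)) => z hz.
  exact: (pseries_sum_le kappa0 r0 kr hc (ltW hz)).
Qed.
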